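(* Let $\nu>0$ and denote the radius of starlikeness $r^\star(u_\nu)$ by $t_{\nu,1}$. Then $t_{\nu,1}<\sqrt[4]{8\nu(\nu+1)^2(\nu+2)}$. Moreover, $$2\sqrt[4]{\nu(\nu+1)^2}<t_{\nu,1}<2\sqrt[4]{\frac{(\nu)_4(\nu+1)_2}{5\nu^2+15\nu+12}},$$ $$2\sqrt[8]{\frac{(\nu)_3(\nu)_4(\nu+1)^2}{5\nu^2+15\nu+12}}<t_{\nu,1}<\sqrt[4]{\frac{8\nu(\nu+1)^2(\nu+3)_3(5\nu^2+15\nu+12)}{\nu_7}}$$ and $$\sqrt[12]{\frac{2^{11}\nu(\nu)_4(\nu)_6(\nu+1)^4}{\nu_7}}<t_{\nu,1}<2\sqrt[4]{\frac{2\nu(\nu+1)^2(\nu+2)^2(\nu+4)(\nu+6)(\nu+7)\nu_7}{\nu_8}},$$ where $$\nu_7=21\nu^4+173\nu^3+533\nu^2+717\nu+360$$ and $$\nu_8=429\nu^8+8688\nu^7+76280\nu^6+377494\nu^5+1148139\nu^4+2194202\nu^3+2574064\nu^2+1698048\nu+483840.$$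
   Context: For $\nu>-1$, with $J_\nu,I_\nu$ the Bessel and modified Bessel functions of the first kind, $$\mathbf{\Pi}_\nu(z)=J_\nu(z)I_\nu(z)=\sum_{n\ge0}\frac{(-1)^n(z/2)^{2\nu+4n}}{n!\,\Gamma(\nu+n+1)\Gamma(\nu+2n+1)},$$ and for $\nu\ne0$, $u_\nu(z)=\left(2^{2\nu}\Gamma^2(\nu+1)\mathbf{\Pi}_\nu(z)\right)^{\frac{1}{2\nu}}$, with the branch chosen so that $u_\nu$ is analytic near $0$, $u_\nu(0)=0$, $u_\nu'(0)=1$; in particular $zu_\nu'(z)/u_\nu(z)=\frac{1}{2\nu}z\mathbf{\Pi}_\nu'(z)/\mathbf{\Pi}_\nu(z)$. The radius of starlikeness is $r^\star(f)=\sup\{r>0:\operatorname{Re}(zf'(z)/f(z))>0\text{ for all }|z|<r\}$. The number $t_{\nu,1}$ is also the first positive zero of $\mathbf{\Pi}_\nu'$. Pochhammer symbol: $(a)_n=a(a+1)\cdots(a+n-1)$. *)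

(* Defs.v *)
(* Stdlib reals and Coquelicot. *)
From Stdlib Require Import Reals Arith.
From Coquelicot Require Import Coquelicot.
Open Scope R_scope.

Definition Gamma (x : R) : R :=
  RInt_gen (fun t => Rpower t (x - 1) * exp (- t))
    (at_right 0) (Rbar_locally p_infty).

Fixpoint poch (a : R) (n : nat) : R :=
  match n with
  | O => 1
  | S m => poch a m * (a + INR m)
  end.

(* [nroot n x] is meant for n > 0 and x > 0 only. *)
Definition nroot (n : nat) (x : R) : R := Rpower x (/ INR n).

Definition Cexp (z : C) : C :=
  (exp (Re z) * cos (Im z), exp (Re z) * sin (Im z)).

(* Principal argument in (-PI, PI], for z <> 0. *)
Definition Carg (z : C) : R :=
  if Rle_dec 0 (Im z) then acos (Re z / Cmod z) else - acos (Re z / Cmod z).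

(* Principal branch of z^a for a real exponent.  The value 0 at z = 0 is the
   right one for a > 0, the only case in which it is used. *)
Definition Cpower (z : C) (a : R) : C :=
  if Ceq_dec z 0 then RtoC 0
  else Cexp (a * ln (Cmod z), a * Carg z).

Definition CSeries (a : nat -> C) : C :=
  (Series (fun n => Re (a n)), Series (fun n => Im (a n))).

Definition BesselJ (nu : R) (z : C) : C :=
  (Cpower (z / 2) nu *
   CSeries (fun n =>
     RtoC ((-1) ^ n / (INR (fact n) * Gamma (nu + INR n + 1)))
       * (z / 2) ^ (2 * n)))%C.

Definition BesselI (nu : R) (z : C) : C :=
  (Cpower (z / 2) nu *
   CSeries (fun n =>
     RtoC (1 / (INR (fact n) * Gamma (nu + INR n + 1)))
       * (z / 2) ^ (2 * n)))%C.

Definition PiBessel (nu : R) (z : C) : C := (BesselJ nu z * BesselI nu z)%C.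

(* v is one of the values of the multivalued power w^a, where a > 0. *)
Definition is_power_value (w : C) (a : R) (v : C) : Prop :=
  (w = 0 /\ v = 0) \/ (exists l : C, Cexp l = w /\ v = Cexp (a * l)%C).

Definition analytic_on_disc (r : R) (f : C -> C) : Prop :=
  forall z : C, Cmod z < r -> ex_derive (K := C_AbsRing) (V := C_NormedModule) f z.

(* [is_u nu r u]: on the disc |z| < r, the function u is the analytic branch of
   (2^(2 nu) Gamma(nu+1)^2 Pi_nu(z))^(1/(2 nu)) with u(0) = 0 and u'(0) = 1.
   The cut of [PiBessel] along the negative real axis is harmless: replacing
   Pi_nu(z) by exp(4 i k PI nu) Pi_nu(z) does not change the set of values of
   its power 1/(2 nu). *)
Definition is_u (nu r : R) (u : C -> C) : Prop :=
  analytic_on_disc r u /\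
  u 0 = 0 /\
  is_derive (K := C_AbsRing) (V := C_NormedModule) u (RtoC 0) (RtoC 1) /\
  (forall z : C, z <> 0 -> Cmod z < r ->
     is_power_value
       (RtoC (Rpower 2 (2 * nu) * Gamma (nu + 1) ^ 2) * PiBessel nu z)%C
       (1 / (2 * nu)) (u z)).

(* Re (z f'(z) / f(z)) > 0 for |z| < r.  The point z = 0 is left out: there
   z f'(z) / f(z) has a removable singularity with value 1, since f(0) = 0 and
   f'(0) = 1. *)
Definition starlike_on_disc (r : R) (f : C -> C) : Prop :=
  forall z : C, z <> 0 -> Cmod z < r ->
    f z <> 0 /\ 0 < Re (z * C_derive f z / f z)%C.

(* The radius of starlikeness r*(u_nu).  As u_nu is given only as an analytic
   germ at 0, a radius r is admitted when the germ has an analytic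
   continuation, as a branch of the above power, to the disc |z| < r. *)
Definition starlikeness_radius_u (nu : R) : Rbar :=
  Lub_Rbar (fun r => 0 < r /\ exists u : C -> C, is_u nu r u /\ starlike_on_disc r u).

(* Main.v *)
Require Import Defs.
From Stdlib Require Import Reals Arith Lra Lia Psatz.
From Coquelicot Require Import Coquelicot.
Open Scope R_scope.

(** Write [y = z^2], and let [f(y) = sum_i (-1)^i y^i / (i! 4^i (nu+1)_i)], so that [J_nu(z)] and
[I_nu(z)] are the same constant multiple of [z^nu f(z^2)] and of [z^nu f(-z^2)].  Put
[h = - f'/f = sum_n h_n y^n].  The differential equation of [f] becomes a Riccati equation for [h],
that is the recursion [(n + nu + 2) h_(n+1) = sum_(i<=n) h_i h_(n-i)] with
[h_0 = 1 / (4 (nu+1))]; in particular all [h_n] are positive.  Adding the logarithmic derivatives of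
the two factors keeps only the odd coefficients:
[z u'(z) / u(z) = 1 - (2/nu) P(z^4)] with [P(x) = sum_k h_(2k+1) x^(k+1)].

The radius.  As [P] has positive coefficients, the real part of [1 - (2/nu) P(x)] on the circle
[|x| = r] is smallest at [x = r].  Hence the radius of starlikeness is [t] with [P(t^4) = nu/2].
This equation has a root strictly inside the disc of convergence of [P] ([odd_root_exists]).  There
[u(z) = z exp (- (g(z^2) + g(-z^2)) / (2 nu))] with [g' = h], [g(0) = 0] is the required branch,
because [f exp(g)] has derivative zero ([bessel_exp]).  Beyond [t] every branch fails: on the positive
axis its modulus is that of the branch above, so at [t] the real part of its [z u'/u] is the same, namely zero
([not_starlike_beyond]).

The bounds.  The zeros themselves do not enter; two facts about the sequence [h_n] replace the sums over zeros
that lie behind Euler-Rayleigh inequalities.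
(a) [h_n] and [h_(2k+1)] are log-convex.  The quotient of two contiguous Bessel series is a Stieltjes
continued fraction with positive coefficients, so [h_n] counts weighted Dyck paths of length [2n], and
cutting the paths at a given time writes the Hankel matrix of these numbers as a Gram matrix
([dyck_gram]).
(b) The recursion propagates a bound [h_(n+1) <= rho h_n] to all [n] as soon as it holds at some
index [m] and [h_(m+1) <= rho^(m+2)] ([ratio_bound_of_term]); with [rho^6 = h_5] this gives
[h_(n+6) <= h_5 h_n].
By (a) the tail of [P] dominates a geometric series, and then [P(X) > nu/2] at the last upper bound [X] of
[t^4] ([odd_psum_exceeds_upper4]).  By (b) the tail of [P(T)] is at most [h_5 T^3] times a part of [P(T)]
itself, and then [P(T) < nu/2] at the last lower bound [T] of [t^4] ([odd_psum_bounded_lower3]).  Here [T] is a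
cube root of a rational function of [nu]; the sign of [a + b T + c T^2] is decided by that of its norm
[a^3 + b^3 T^3 + c^3 T^6 - 3 a b c T^3], which is rational in [nu].  In both cases, and for the
comparison of the last bounds with the other ones, what remains is that an explicit polynomial in
[nu], with all coefficients of one sign, has that sign for [nu > 0]. *)

(** * Convolution of coefficient sequences *)

(** The recursion on the first argument turns the ring laws into one-line inductions; [conv_sum] gives
    the usual form. *)
Fixpoint conv (a b : nat -> R) (n : nat) : R :=
  match n with
  | O => a O * b O
  | S m => a O * b (S m) + conv (fun i => a (S i)) b m
  end.

Lemma conv_ext a a' b b' n :
  (forall i, (i <= n)%nat -> a i = a' i) -> (forall i, (i <= n)%nat -> b i = b' i) ->
  conv a b n = conv a' b' n.
Proof.
  revert a a'; induction n as [|n IH]; intros a a' Ha Hb; simpl.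
  - rewrite Ha, Hb by lia; reflexivity.
  - rewrite (Ha O), (Hb (S n)) by lia; f_equal.
    apply IH; intros i Hi; [apply Ha | apply Hb]; lia.
Qed.

Lemma conv_S_r a b n : conv a b (S n) = conv a (fun i => b (S i)) n + a (S n) * b O.
Proof.
  revert a; induction n as [|n IH]; intros a; [simpl; ring|].
  change (conv a b (S (S n))) with (a O * b (S (S n)) + conv (fun i => a (S i)) b (S n)).
  rewrite IH; simpl; ring.
Qed.

Lemma conv_comm a b n : conv a b n = conv b a n.
Proof.
  revert b; induction n as [|n IH]; intros b; [simpl; ring|].
  rewrite conv_S_r; simpl; rewrite IH; ring.
Qed.

Lemma conv_plus_l a a' b n : conv (fun i => a i + a' i) b n = conv a b n + conv a' b n.
Proof.
  revert a a'; induction n as [|n IH]; intros a a'; simpl; [ring|].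
  rewrite (IH (fun i => a (S i)) (fun i => a' (S i))); ring.
Qed.

Lemma conv_scal_l l a b n : conv (fun i => l * a i) b n = l * conv a b n.
Proof.
  revert a; induction n as [|n IH]; intros a; simpl; [ring|].
  rewrite (IH (fun i => a (S i))); ring.
Qed.

Lemma conv_plus_r a b b' n : conv a (fun i => b i + b' i) n = conv a b n + conv a b' n.
Proof. now rewrite conv_comm, conv_plus_l, (conv_comm b), (conv_comm b'). Qed.

Lemma conv_scal_r l a b n : conv a (fun i => l * b i) n = l * conv a b n.
Proof. now rewrite conv_comm, conv_scal_l, conv_comm. Qed.

Lemma conv_assoc a b d n : conv (conv a b) d n = conv a (conv b d) n.
Proof.
  revert a; induction n as [|n IH]; intros a; simpl; [ring|].
  rewrite conv_plus_l, conv_scal_l, IH; ring.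
Qed.

(** The Euler operator [y d/dy] multiplies the [n]-th coefficient by [n], and it is a derivation. *)
Lemma conv_euler a b n :
  INR n * conv a b n =
  conv (fun i => INR i * a i) b n + conv a (fun i => INR i * b i) n.
Proof.
  revert a; induction n as [|n IH]; intros a; [simpl; ring|].
  assert (E : forall u v, conv u v (S n) = u O * v (S n) + conv (fun i => u (S i)) v n)
    by reflexivity.
  rewrite !E; clear E; cbv beta.
  rewrite (conv_ext (fun i => INR (S i) * a (S i))
             (fun i => INR i * a (S i) + a (S i)) b b n);
    [| intros; rewrite S_INR; ring | reflexivity].
  rewrite conv_plus_l.
  specialize (IH (fun i => a (S i))); cbv beta in IH.
  rewrite S_INR; simpl (INR 0); lra.
Qed.

(** A power series with invertible constant term is not a zero divisor. *)
Lemma conv_cancel a b : a O <> 0 -> (forall n, conv a b n = 0) -> forall n, b n = 0.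
Proof.
  intros Ha H n; induction n as [n IH] using (well_founded_induction Wf_nat.lt_wf).
  specialize (H n); rewrite conv_comm in H.
  assert (E : conv b a n = b n * a O).
  { destruct n as [|n]; [reflexivity|].
    rewrite conv_S_r, (conv_ext b (fun _ => 0 * 0) _ (fun i => a (S i)) n);
      [| intros i Hi; rewrite IH by lia; ring | reflexivity].
    rewrite (conv_scal_l 0 (fun _ => 0)); ring. }
  rewrite E in H; apply Rmult_integral in H; tauto.
Qed.

Lemma conv_sum a b n : conv a b n = sum_f_R0 (fun k => a k * b (n - k)%nat) n.
Proof.
  revert a; induction n as [|n IH]; intros a; [reflexivity|].
  rewrite decomp_sum by lia; simpl pred; simpl conv.
  rewrite IH; reflexivity.
Qed.

Lemma conv_nonneg a b n :
  (forall i, 0 <= a i) -> (forall i, 0 <= b i) -> 0 <= conv a b n.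
Proof.
  intros Ha Hb; revert a Ha; induction n as [|n IH]; intros a Ha; simpl.
  - apply Rmult_le_pos; auto.
  - apply Rplus_le_le_0_compat; [apply Rmult_le_pos|apply IH]; auto.
Qed.

(** Here [p] is the series of [- y f'/f], and the last hypothesis is
    [E (E f) + nu E f + (y/4) f = 0] with [E = y d/dy].  Applying [E] to [f p = - E f] and eliminating the
    second order term leaves [f (E p + nu p - p^2 - y/4) = 0], and [f] can be cancelled. *)
Lemma log_derivative_riccati nu f p :
  f O = 1 -> p O = 0 ->
  (forall n, conv f p n = - (INR n * f n)) ->
  (forall n, INR (S n) * (INR (S n) + nu) * f (S n) = - f n / 4) ->
  forall n, (INR n + nu) * p n = conv p p n + match n with 1%nat => / 4 | _ => 0 end.
Proof.
  intros Hf0 Hp0 Hfp Hode n.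
  set (one := fun n : nat => match n with 1%nat => / 4 | _ => 0 end).
  set (e := fun n => (conv p p n + one n) + (-1) * (INR n * p n + nu * p n)).
  assert (E : e n = 0).
  { apply (conv_cancel f); [lra|]; clear n; intros n; unfold e.
    rewrite !conv_plus_r, conv_scal_r, conv_plus_r, conv_scal_r, <- conv_assoc.
    rewrite (conv_ext (conv f p) (fun i => (-1) * (INR i * f i)) p p n);
      [| intros; rewrite Hfp; ring | reflexivity].
    rewrite conv_scal_l.
    pose proof (conv_euler f p n) as HE; rewrite Hfp in HE; rewrite Hfp.
    assert (O1 : conv f one n = match n with O => 0 | S m => f m / 4 end).
    { destruct n as [|n]; [simpl; unfold one; ring|].
      rewrite conv_S_r; unfold one at 2.
      rewrite (conv_ext f f (fun i => one (S i)) (fun i => / 4 * match i with O => 1 | _ => 0 end) n);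
        [| reflexivity | intros [|i] _; unfold one; simpl; ring].
      rewrite conv_scal_r.
      assert (D : conv f (fun i => match i with O => 1 | _ => 0 end) n = f n).
      { rewrite conv_comm; destruct n as [|n]; simpl; [ring|].
        rewrite (conv_ext _ (fun _ => 0 * 0) f f n); [| intros; ring | reflexivity].
        rewrite (conv_scal_l 0 (fun _ => 0)); ring. }
      rewrite D; field. }
    rewrite O1; destruct n as [|n]; [simpl in *; lra|].
    specialize (Hode n); lra. }
  unfold e, one in E; lra.
Qed.

(** * Weighted Dyck paths and a Hankel matrix *)

(** [dyck c n k] is the total weight of the paths with steps [+1] and [-1] that stay nonnegative and lead
    from height [0] to height [k] in [n] steps, where a step down from [k + 1] to [k] has weight [c k]. *)
Fixpoint dyck (c : nat -> R) (n k : nat) : R :=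
  match n with
  | O => match k with O => 1 | _ => 0 end
  | S m => match k with O => 0 | S j => dyck c m j end + c k * dyck c m (S k)
  end.

Lemma dyck_above c n k : (n < k)%nat -> dyck c n k = 0.
Proof.
  revert k; induction n as [|n IH]; intros [|k] H; simpl; try lia; [reflexivity|].
  rewrite !IH by lia; ring.
Qed.

Lemma dyck_nonneg c : (forall k, 0 <= c k) -> forall n k, 0 <= dyck c n k.
Proof.
  intros Hc; induction n as [|n IH]; intros [|k]; simpl; try lra.
  - apply Rplus_le_le_0_compat; [lra|]; now apply Rmult_le_pos.
  - apply Rplus_le_le_0_compat; [apply IH|]; now apply Rmult_le_pos.
Qed.

(** The weight of the straight descent from height [k] to [0]: a path from height [0] to [k], read
    backwards, has this weight times its own. *)
Fixpoint weight_product (c : nat -> R) (k : nat) : R :=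
  match k with O => 1 | S j => weight_product c j * c j end.

Lemma weight_product_pos c : (forall k, 0 < c k) -> forall k, 0 < weight_product c k.
Proof. intros Hc; induction k; simpl; [lra|]; now apply Rmult_lt_0_compat. Qed.

Definition wsum (w x y : nat -> R) (K : nat) : R :=
  sum_f_R0 (fun k => w k * (x k * y k)) K.

(** The step operator of the paths is self-adjoint for the weights [weight_product c]; on a
    truncated sum only a boundary term survives. *)
Lemma dyck_shift c K m n :
  wsum (weight_product c) (dyck c (S m)) (dyck c n) K - wsum (weight_product c) (dyck c m) (dyck c (S n)) K
  = weight_product c (S K) * (dyck c m (S K) * dyck c n K - dyck c m K * dyck c n (S K)).
Proof.
  unfold wsum; induction K as [|K IH]; [simpl; ring|].
  rewrite !tech5.
  match goal with |- (?a + ?b) - (?d + ?e) = _ =>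
    replace ((a + b) - (d + e)) with ((a - d) + (b - e)) by ring end.
  rewrite IH; simpl; ring.
Qed.

(** Cut a path of length [m + n] after [m] steps.  The Hankel matrix of the closed path
    weights is thus a Gram matrix, whence all the log-convexity below. *)
Lemma dyck_gram c m n K : (m + n <= K)%nat ->
  dyck c (m + n) 0 = wsum (weight_product c) (dyck c m) (dyck c n) K.
Proof.
  revert n; induction m as [|m IH]; intros n H.
  - unfold wsum; simpl (0 + n)%nat; clear H.
    induction K as [|K IH]; [simpl; ring|].
    rewrite tech5, <- IH; simpl; ring.
  - replace (S m + n)%nat with (m + S n)%nat by lia.
    rewrite (IH (S n)) by lia.
    pose proof (dyck_shift c K m n) as D.
    rewrite (dyck_above c m (S K)), (dyck_above c n (S K)) in D by lia. lra.
Qed.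

Lemma cauchy_schwarz_step A B D v p q :
  0 <= v -> 0 <= A -> 0 <= B -> D ^ 2 <= A * B ->
  (D + v * (p * q)) ^ 2 <= (A + v * (p * p)) * (B + v * (q * q)).
Proof.
  intros Hv HA HB HC.
  assert (Q : 0 <= A * q ^ 2 + B * p ^ 2 - 2 * D * (p * q)).
  { destruct (Req_dec A 0) as [->|HA'].
    - assert (D = 0) by nra; subst; nra.
    - apply Rmult_le_reg_l with A; [lra|].
      replace (A * (A * q ^ 2 + B * p ^ 2 - 2 * D * (p * q)))
        with ((A * q - D * p) ^ 2 + (A * B - D ^ 2) * p ^ 2) by ring.
      pose proof (pow2_ge_0 (A * q - D * p)); pose proof (pow2_ge_0 p); nra. }
  apply Rminus_le_0.
  replace ((A + v * (p * p)) * (B + v * (q * q)) - (D + v * (p * q)) ^ 2)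
    with ((A * B - D ^ 2) + v * (A * q ^ 2 + B * p ^ 2 - 2 * D * (p * q))) by ring.
  apply Rplus_le_le_0_compat; [lra | now apply Rmult_le_pos].
Qed.

Lemma wsum_cauchy_schwarz w x y K : (forall k, 0 <= w k) ->
  0 <= wsum w x x K /\ 0 <= wsum w y y K /\
  wsum w x y K ^ 2 <= wsum w x x K * wsum w y y K.
Proof.
  intros Hw; unfold wsum; induction K as [|K (HA & HB & HC)].
  - simpl; specialize (Hw O); pose proof (pow2_ge_0 (x O)); pose proof (pow2_ge_0 (y O)).
    repeat split; nra.
  - rewrite !tech5; specialize (Hw (S K)).
    repeat split; [| | now apply cauchy_schwarz_step];
      apply Rplus_le_le_0_compat; auto; apply Rmult_le_pos; auto; apply Rle_0_sqr.
Qed.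

Lemma dyck_cauchy_schwarz c m n : (forall k, 0 < c k) ->
  dyck c (m + n) 0 ^ 2 <= dyck c (m + m) 0 * dyck c (n + n) 0.
Proof.
  intros Hc.
  rewrite (dyck_gram c m n (m + m + n + n)), (dyck_gram c m m (m + m + n + n)),
    (dyck_gram c n n (m + m + n + n)) by lia.
  apply wsum_cauchy_schwarz; intros k; now apply Rlt_le, weight_product_pos.
Qed.

(** * Bessel coefficients and Rayleigh sums *)

Lemma poch_pos a n : 0 < a -> 0 < poch a n.
Proof.
  intros Ha; induction n as [|n IH]; simpl; [lra|].
  apply Rmult_lt_0_compat; [assumption|]; pose proof (pos_INR n); lra.
Qed.

Lemma poch_shift a n : poch a (S n) = a * poch (a + 1) n.
Proof.
  induction n as [|n IH]; [simpl; ring|].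
  change (poch a (S (S n))) with (poch a (S n) * (a + INR (S n))).
  rewrite IH, S_INR; simpl; ring.
Qed.

(** The coefficients of [f(y)], with [J_nu(z) = (z/2)^nu f(z^2) / Gamma(nu+1)] and
    [I_nu(z) = (z/2)^nu f(-z^2) / Gamma(nu+1)]. *)
Definition bessel_coef (nu : R) (i : nat) : R :=
  (-1) ^ i / (INR (fact i) * 4 ^ i * poch (nu + 1) i).

Lemma bessel_coef_succ nu i : 0 <= nu ->
  bessel_coef nu (S i) = - bessel_coef nu i / (4 * INR (S i) * (nu + INR (S i))).
Proof.
  intros Hn; unfold bessel_coef; rewrite fact_simpl, mult_INR, S_INR; simpl (poch _ _); simpl pow.
  pose proof (poch_pos (nu + 1) i ltac:(lra)); pose proof (pos_INR i).
  pose proof (INR_fact_neq_0 i); pose proof (pow_nonzero 4 i ltac:(lra)).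
  field; repeat split; lra.
Qed.

Lemma bessel_coef_shift nu i : 0 <= nu ->
  bessel_coef (nu + 1) i = - (4 * (nu + 1)) * (INR (S i) * bessel_coef nu (S i)).
Proof.
  intros Hn; unfold bessel_coef; rewrite fact_simpl, mult_INR, poch_shift, S_INR; simpl pow.
  pose proof (poch_pos (nu + 1 + 1) i ltac:(lra)); pose proof (pos_INR i).
  pose proof (INR_fact_neq_0 i); pose proof (pow_nonzero 4 i ltac:(lra)).
  field; repeat split; lra.
Qed.

(** [f_(nu+1) = f_nu + y / (4 (nu+1) (nu+2)) f_(nu+2)]: the three-term recurrence of the Bessel
    functions. *)
Lemma bessel_coef_contiguous nu i : 0 <= nu ->
  bessel_coef (nu + 1) (S i) =
  bessel_coef nu (S i) + / (4 * (nu + 1) * (nu + 2)) * bessel_coef (nu + 2) i.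
Proof.
  intros Hn; replace (nu + 2) with (nu + 1 + 1) by ring.
  rewrite (bessel_coef_shift (nu + 1)) by lra.
  unfold bessel_coef; rewrite fact_simpl, mult_INR, (poch_shift (nu + 1)), S_INR; simpl pow; simpl (poch _ (S _)).
  pose proof (poch_pos (nu + 1 + 1) i ltac:(lra)); pose proof (pos_INR i).
  pose proof (INR_fact_neq_0 i); pose proof (pow_nonzero 4 i ltac:(lra)).
  field; repeat split; lra.
Qed.

(** The coefficients of the continued fraction of a quotient of contiguous Bessel series. *)
Definition dyck_weight (nu : R) (k : nat) : R :=
  / (4 * (nu + INR k + 1) * (nu + INR k + 2)).

Lemma dyck_weight_pos nu k : 0 <= nu -> 0 < dyck_weight nu k.
Proof.
  intros H; unfold dyck_weight; pose proof (pos_INR k).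
  apply Rinv_0_lt_compat; repeat apply Rmult_lt_0_compat; lra.
Qed.

Lemma dyck_diag c k : dyck c k k = 1.
Proof.
  induction k as [|k IH]; [reflexivity|].
  simpl; rewrite IH, (dyck_above c k (S (S k))) by lia; ring.
Qed.

(** The paths that end at height [k] have generating function [y^(k/2) f_(nu+k+1) / f_nu] (a
    step counts [y^(1/2)]): by the three-term recurrence these quotients obey the recursion of the path
    weights. *)
Lemma dyck_quotient nu : 0 <= nu -> forall j k,
  conv (bessel_coef nu) (fun i => dyck (dyck_weight nu) (k + 2 * i) k) j = bessel_coef (nu + INR k + 1) j.
Proof.
  intros Hn; induction j as [|j IHj]; intros k.
  - cbn [conv]; replace (k + 2 * 0)%nat with k by lia; rewrite dyck_diag.
    unfold bessel_coef; simpl; field.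
  - induction k as [|k IHk].
    + rewrite conv_S_r.
      rewrite (conv_ext (bessel_coef nu) (bessel_coef nu) _
        (fun i => dyck_weight nu 0 * dyck (dyck_weight nu) (1 + 2 * i) 1) j); [| reflexivity |].
      2:{ intros i _. replace (0 + 2 * S i)%nat with (S (1 + 2 * i)) by lia.
          cbn [dyck]; ring. }
      rewrite conv_scal_r, (IHj 1%nat).
      change (dyck (dyck_weight nu) (0 + 2 * 0) 0) with 1.
      unfold dyck_weight; simpl INR; replace (nu + 0 + 1) with (nu + 1) by ring.
      rewrite bessel_coef_contiguous by lra.
      replace (nu + 1 + 1) with (nu + 2) by ring; replace (nu + 0 + 2) with (nu + 2) by ring. ring.
    + rewrite conv_S_r.
      rewrite (conv_ext (bessel_coef nu) (bessel_coef nu) _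
        (fun i => dyck (dyck_weight nu) (k + 2 * S i) k
                  + dyck_weight nu (S k) * dyck (dyck_weight nu) (S (S k) + 2 * i) (S (S k))) j);
        [| reflexivity |].
      2:{ intros i _. replace (S k + 2 * S i)%nat with (S (k + 2 * S i)) by lia.
          cbn [dyck]. do 2 f_equal; f_equal; lia. }
      rewrite conv_plus_r, conv_scal_r, (IHj (S (S k))).
      rewrite conv_S_r in IHk.
      replace (S k + 2 * 0)%nat with (S k) by lia; rewrite dyck_diag.
      replace (k + 2 * 0)%nat with k in IHk by lia; rewrite dyck_diag in IHk.
      pose proof (pos_INR k).
      assert (L : dyck_weight nu (S k) = / (4 * (nu + INR k + 1 + 1) * (nu + INR k + 1 + 2)))
        by (unfold dyck_weight; rewrite S_INR; do 2 f_equal; ring).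
      rewrite L; rewrite !S_INR in *.
      replace (nu + (INR k + 1) + 1) with (nu + INR k + 1 + 1) by ring.
      rewrite (bessel_coef_contiguous (nu + INR k + 1)) by lra.
      replace (nu + (INR k + 1 + 1) + 1) with (nu + INR k + 1 + 2) by ring.
      lra.
Qed.

(** The coefficient [h_n] of [- f'/f], that is [sum_j j^(-2n-2)] over the positive zeros [j] of
    [J_nu] (Rayleigh's sums).  Since [- f_nu' = f_(nu+1) / (4 (nu+1))], [- f'/f] is a quotient of contiguous
    Bessel series; defining it by paths makes the Hankel positivity available from the start. *)
Definition rayleigh (nu : R) (n : nat) : R := dyck (dyck_weight nu) (2 * n) 0 / (4 * (nu + 1)).

Lemma conv_bessel_coef_rayleigh nu n : 0 <= nu ->
  conv (bessel_coef nu) (rayleigh nu) n = - (INR (S n) * bessel_coef nu (S n)).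
Proof.
  intros Hn; pose proof (dyck_quotient nu Hn n 0) as H.
  rewrite (conv_ext (bessel_coef nu) (bessel_coef nu) (rayleigh nu)
    (fun i => / (4 * (nu + 1)) * dyck (dyck_weight nu) (0 + 2 * i) 0) n);
    [| reflexivity | intros; unfold rayleigh; cbn [Nat.add]; field; lra].
  rewrite conv_scal_r, H; simpl (INR 0); replace (nu + 0 + 1) with (nu + 1) by ring.
  rewrite bessel_coef_shift by lra; field; lra.
Qed.

Lemma rayleigh_0 nu : 0 <= nu -> rayleigh nu 0 = / (4 * (nu + 1)).
Proof. intros; unfold rayleigh; simpl; field; lra. Qed.

(** The Riccati equation [y h' + (nu+1) h = y h^2 + 1/4], coefficient by coefficient. *)
Lemma rayleigh_succ nu n : 0 <= nu ->
  rayleigh nu (S n) = conv (rayleigh nu) (rayleigh nu) n / (INR n + nu + 2).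
Proof.
  intros Hn; pose proof (pos_INR n).
  set (p := fun i => match i with O => 0 | S m => rayleigh nu m end).
  pose proof (log_derivative_riccati nu (bessel_coef nu) p) as HR.
  assert (E : (INR (S (S n)) + nu) * p (S (S n)) = conv p p (S (S n)) + 0).
  { apply HR.
    - unfold bessel_coef; simpl; field.
    - reflexivity.
    - intros [|m]; [simpl; ring|].
      rewrite conv_S_r; simpl (p 0%nat); rewrite Rmult_0_r, Rplus_0_r.
      exact (conv_bessel_coef_rayleigh nu m Hn).
    - intros m; rewrite (bessel_coef_succ nu m) by lra.
      pose proof (lt_0_INR (S m) ltac:(lia)); field; lra. }
  assert (E2 : conv p p (S (S n)) = conv (rayleigh nu) (rayleigh nu) n).
  { rewrite conv_S_r; cbn [conv].
    change (conv (fun i => p (S i)) (fun i => p (S i)) n)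
      with (conv (rayleigh nu) (rayleigh nu) n).
    simpl (p 0%nat); ring. }
  rewrite <- E2; rewrite !S_INR in E; simpl (p (S (S n))) in E.
  apply Rmult_eq_reg_r with (INR n + nu + 2); [|lra].
  unfold Rdiv; rewrite Rmult_assoc, Rinv_l by lra; lra.
Qed.

Lemma rayleigh_pos nu : 0 <= nu -> forall n, 0 < rayleigh nu n.
Proof.
  intros Hn; assert (H0 : 0 < rayleigh nu 0)
    by (rewrite rayleigh_0 by lra; apply Rinv_0_lt_compat; lra).
  assert (Hc : forall n, 0 <= rayleigh nu n).
  { intros n; unfold rayleigh; apply Rmult_le_pos;
      [apply dyck_nonneg; intros; now apply Rlt_le, dyck_weight_pos
      | apply Rlt_le, Rinv_0_lt_compat; lra]. }
  induction n as [|n IH]; [assumption|].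
  rewrite rayleigh_succ by lra; pose proof (pos_INR n).
  apply Rdiv_lt_0_compat; [|lra].
  destruct n as [|n]; cbn [conv]; [now apply Rmult_lt_0_compat|].
  apply Rplus_lt_le_0_compat; [now apply Rmult_lt_0_compat|].
  now apply conv_nonneg.
Qed.

Lemma rayleigh_hankel nu m n : 0 <= nu ->
  dyck (dyck_weight nu) (m + n) 0 ^ 2 <= dyck (dyck_weight nu) (2 * m) 0 * dyck (dyck_weight nu) (2 * n) 0.
Proof.
  intros Hn; replace (2 * m)%nat with (m + m)%nat by lia; replace (2 * n)%nat with (n + n)%nat by lia.
  apply dyck_cauchy_schwarz; intros; now apply dyck_weight_pos.
Qed.

Lemma rayleigh_log_convex nu i j : 0 <= nu ->
  rayleigh nu (i + j) ^ 2 <= rayleigh nu (2 * i) * rayleigh nu (2 * j) /\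
  rayleigh nu (i + j + 1) ^ 2 <= rayleigh nu (2 * i + 1) * rayleigh nu (2 * j + 1).
Proof.
  intros Hn; unfold rayleigh; set (D := 4 * (nu + 1)).
  assert (0 < / (D * D)) by (apply Rinv_0_lt_compat, Rmult_lt_0_compat; unfold D; lra).
  split.
  - pose proof (rayleigh_hankel nu (2 * i) (2 * j) Hn) as H'.
    replace (2 * (i + j))%nat with (2 * i + 2 * j)%nat by lia.
    apply Rmult_le_compat_r with (r := / (D * D)) in H'; [|lra].
    unfold Rdiv; field_simplify; [|unfold D; lra|unfold D; lra].
    field_simplify in H'; [|unfold D; lra|unfold D; lra]. exact H'.
  - pose proof (rayleigh_hankel nu (2 * i + 1) (2 * j + 1) Hn) as H'.
    replace (2 * (i + j + 1))%nat with (2 * i + 1 + (2 * j + 1))%nat by lia.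
    apply Rmult_le_compat_r with (r := / (D * D)) in H'; [|lra].
    unfold Rdiv; field_simplify; [|unfold D; lra|unfold D; lra].
    field_simplify in H'; [|unfold D; lra|unfold D; lra]. exact H'.
Qed.

(** * Ratios of consecutive Rayleigh sums *)

(** The ratios of consecutive terms of a log-convex sequence increase. *)
Lemma log_convex_ratio (a : nat -> R) (r : R) (m : nat) :
  (forall n, 0 < a n) -> (forall n, a (S n) ^ 2 <= a n * a (S (S n))) ->
  r * a m <= a (S m) -> forall n, (m <= n)%nat -> r * a n <= a (S n).
Proof.
  intros Hp Hc H0 n Hn; induction Hn as [|n Hn IH]; [assumption|].
  pose proof (Hp n); pose proof (Hp (S n)); specialize (Hc n).
  apply Rmult_le_reg_l with (a n); [assumption|].
  replace (a n * (r * a (S n))) with ((r * a n) * a (S n)) by ring.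
  apply Rle_trans with (a (S n) * a (S n)); [apply Rmult_le_compat_r; lra | lra].
Qed.

Lemma rayleigh_log_convex_step nu n : 0 <= nu ->
  rayleigh nu (S n) ^ 2 <= rayleigh nu n * rayleigh nu (S (S n)).
Proof.
  intros Hn; destruct (Nat.even n) eqn:E.
  - apply Nat.even_spec in E; destruct E as [k ->].
    destruct (rayleigh_log_convex nu k (k + 1) Hn) as [H _].
    replace (k + (k + 1))%nat with (S (2 * k)) in H by lia.
    replace (2 * (k + 1))%nat with (S (S (2 * k))) in H by lia. exact H.
  - assert (O : Nat.odd n = true) by (rewrite <- Nat.negb_even, E; reflexivity).
    apply Nat.odd_spec in O; destruct O as [k ->].
    destruct (rayleigh_log_convex nu k (k + 1) Hn) as [_ H].
    replace (k + (k + 1) + 1)%nat with (S (2 * k + 1)) in H by lia.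
    replace (2 * (k + 1) + 1)%nat with (S (S (2 * k + 1))) in H by lia. exact H.
Qed.

(** The coefficients of [P(x) = sum_k h_(2k+1) x^(k+1)]; they are also the sums [sum_j j^(-4k-4)] over the
    positive zeros of [J_nu]. *)
Definition odd_rayleigh (nu : R) (k : nat) : R := rayleigh nu (2 * k + 1).

Lemma odd_rayleigh_log_convex nu k : 0 <= nu ->
  odd_rayleigh nu (S k) ^ 2 <= odd_rayleigh nu k * odd_rayleigh nu (S (S k)).
Proof.
  intros Hn; unfold odd_rayleigh.
  destruct (rayleigh_log_convex nu k (k + 2) Hn) as [_ H].
  replace (k + (k + 2) + 1)%nat with (2 * S k + 1)%nat in H by lia.
  replace (2 * (k + 2) + 1)%nat with (2 * S (S k) + 1)%nat in H by lia. exact H.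
Qed.

Lemma odd_rayleigh_pos nu k : 0 <= nu -> 0 < odd_rayleigh nu k.
Proof. intros; now apply rayleigh_pos. Qed.

Definition ratio_bound (nu rho : R) : Prop :=
  0 < rho /\ forall n, rayleigh nu (S n) <= rho * rayleigh nu n.

(** Below [m] the bound holds by log-convexity.  Above it, put [b_i = h_i rho^(-i)], nonincreasing
    as far as the bound is known.  By the recursion at two consecutive indices the next case is
    [sum_(i<=n) (rho h_i - h_(i+1)) h_(n-i) >= (h_0 - rho) h_(n+1)].  Each summand is at least
    [(b_i - b_(i+1)) h_(n+1)], because [h_(n-i) >= rho^(-i-1) h_(n+1)]; these lower bounds telescope to
    [(h_0 - b_(n+1)) h_(n+1)], and [b_(n+1) <= b_(m+1) <= rho] by the hypothesis on [h_(m+1)]. *)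
Lemma ratio_bound_of_term nu rho m : 0 <= nu -> 0 < rho ->
  rayleigh nu (S m) <= rho * rayleigh nu m -> rayleigh nu (S m) <= rho ^ (m + 2) ->
  ratio_bound nu rho.
Proof.
  intros Hn Hr Hm Hpow; split; [assumption|].
  pose proof (rayleigh_pos nu Hn) as Hp.
  set (h := rayleigh nu) in *.
  (* [b i = h_i rho^-i] is nonincreasing as long as the ratios stay below [rho] *)
  set (b := fun i => h i / rho ^ i).
  assert (Hb : forall i, h (S i) <= rho * h i -> b (S i) <= b i).
  { intros i H; unfold b; simpl.
    apply Rmult_le_reg_r with (rho * rho ^ i);
      [apply Rmult_lt_0_compat; [|apply pow_lt]; assumption|].
    pose proof (pow_lt rho i Hr); field_simplify; lra. }
  intros n; induction n as [n IH] using (well_founded_induction Wf_nat.lt_wf).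
  destruct (Nat.le_gt_cases n m) as [Hle|Hlt].
  - apply Rnot_lt_le; intros Hc.
    (* a ratio above [rho] at [n] would persist up to [m], by log-convexity *)
    set (r := h (S n) / h n).
    assert (Hrn : r * h n <= h (S n)) by (unfold r; apply Req_le; field; specialize (Hp n); lra).
    assert (Hr' : rho < r).
    { unfold r; apply Rmult_lt_reg_r with (h n); [apply Hp|].
      unfold Rdiv; rewrite Rmult_assoc, Rinv_l; [lra|specialize (Hp n); lra]. }
    pose proof (log_convex_ratio h r n Hp (fun k => rayleigh_log_convex_step nu k Hn) Hrn m Hle) as H2.
    pose proof (Hp m); assert (rho * h m < r * h m) by (apply Rmult_lt_compat_r; lra). lra.
  - destruct n as [|n]; [lia|].
    pose proof (pos_INR (S n)) as HI.
    assert (E1 : (INR (S n) + nu + 2) * h (S (S n)) = conv h h (S n)).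
    { unfold h; rewrite (rayleigh_succ nu (S n)) by assumption; field; lra. }
    assert (E2 : (INR n + nu + 2) * h (S n) = conv h h n).
    { unfold h; rewrite (rayleigh_succ nu n) by assumption; field; pose proof (pos_INR n); lra. }
    cbn [conv] in E1.
    assert (Hmono : forall j, (j <= n)%nat -> b (S n) <= b (n - j)%nat).
    { induction j as [|j IHj]; intros Hj.
      - replace (n - 0)%nat with n by lia. apply Hb, IH; lia.
      - apply Rle_trans with (b (n - j)%nat); [apply IHj; lia|].
        replace (n - j)%nat with (S (n - S j)) by lia. apply Hb, IH; lia. }
    assert (Hbm : b (S n) <= b (S m)).
    { destruct (Nat.eq_dec m n) as [->|]; [lra|].
      replace (S m) with (n - (n - S m))%nat by lia. apply Hmono; lia. }
    assert (Hbm' : b (S m) <= rho).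
    { unfold b; apply Rmult_le_reg_r with (rho ^ S m); [now apply pow_lt|].
      unfold Rdiv; rewrite Rmult_assoc, Rinv_l by (apply pow_nonzero; lra).
      replace (m + 2)%nat with (S (S m)) in Hpow by lia; simpl in *; lra. }
    assert (K : (b O - b (S n)) * h (S n) <=
                sum_f_R0 (fun i => (rho * h i - h (S i)) * h (n - i)%nat) n).
    { assert (T : forall N, (b O - b (S N)) * h (S n) = sum_f_R0 (fun i => (b i - b (S i)) * h (S n)) N).
      { induction N as [|N IHN]; [simpl; ring|]. rewrite tech5, <- IHN; ring. }
      rewrite T; apply sum_Rle; intros i Hi.
      assert (G : h (S n) <= rho ^ S i * h (n - i)%nat).
      { specialize (Hmono i Hi); unfold b in Hmono.
        apply Rmult_le_compat_r with (r := rho ^ S n) in Hmono; [|now apply Rlt_le, pow_lt].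
        unfold Rdiv in Hmono; rewrite Rmult_assoc, Rinv_l in Hmono by (apply pow_nonzero; lra).
        replace (rho ^ S n) with (rho ^ S i * rho ^ (n - i)) in Hmono
          by (rewrite <- pow_add; f_equal; lia).
        pose proof (pow_lt rho (n - i) Hr).
        replace (h (n - i)%nat * / rho ^ (n - i) * (rho ^ S i * rho ^ (n - i)))
          with (rho ^ S i * h (n - i)%nat) in Hmono by (field; lra).
        lra. }
      assert (D : 0 <= b i - b (S i)).
      { assert (b (S i) <= b i) by (apply Hb, IH; lia). lra. }
      replace (rho * h i - h (S i)) with ((b i - b (S i)) * rho ^ S i).
      2:{ unfold b; simpl; field; split; [apply pow_nonzero|]; lra. }
      rewrite Rmult_assoc; now apply Rmult_le_compat_l. }
    assert (K2 : sum_f_R0 (fun i => (rho * h i - h (S i)) * h (n - i)%nat) n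
                 = rho * conv h h n - conv (fun i => h (S i)) h n).
    { rewrite !conv_sum, scal_sum, <- minus_sum; apply sum_eq; intros; ring. }
    assert (B0 : b O = h O) by (unfold b; simpl; field).
    rewrite K2, B0, <- E2 in K.
    pose proof (Hp (S n)).
    assert (b (S n) * h (S n) <= rho * h (S n)) by (apply Rmult_le_compat_r; lra).
    apply Rmult_le_reg_l with (INR (S n) + nu + 2); [lra|].
    rewrite E1; rewrite S_INR; nra.
Qed.

(** * The odd part of the logarithmic derivative and the radius equation *)

Lemma CV_radius_geometric (a : nat -> R) (M rho r : R) :
  0 < rho -> 0 <= r -> rho * r < 1 -> (forall n, Rabs (a n) <= M * rho ^ n) ->
  Rbar_lt r (CV_radius a).
Proof.
  intros Hrho Hr Hlt Ha.
  apply Rbar_lt_le_trans with (/ rho).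
  - simpl; apply Rmult_lt_reg_l with rho; [assumption|]. rewrite Rinv_r by lra; assumption.
  - apply (CV_radius_bounded a); exists M; intros n.
    rewrite Rabs_mult, (Rabs_pos_eq ((/ rho) ^ n))
      by (apply Rlt_le, pow_lt, Rinv_0_lt_compat; assumption).
    rewrite pow_inv; apply Rmult_le_reg_r with (rho ^ n); [now apply pow_lt|].
    rewrite Rmult_assoc, Rinv_l, Rmult_1_r by (apply pow_nonzero; lra); apply Ha.
Qed.

Lemma sum_unbounded (u : nat -> R) (m : nat) (d L : R) :
  0 < d -> (forall n, 0 <= u n) -> (forall n, (m <= n)%nat -> d <= u n) ->
  exists N, L < sum_f_R0 u N.
Proof.
  intros Hd Hu Hm.
  assert (H : forall k, d * INR k <= sum_f_R0 u (m + k)).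
  { induction k as [|k IH].
    - rewrite Rmult_0_r; apply cond_pos_sum; assumption.
    - replace (m + S k)%nat with (S (m + k)) by lia.
      rewrite tech5, S_INR; specialize (Hm (S (m + k)) ltac:(lia)); lra. }
  destruct (INR_unbounded (L / d)) as [k Hk]; exists (m + k)%nat.
  apply Rlt_le_trans with (d * INR k); [|apply H].
  apply Rmult_lt_compat_l with (r := d) in Hk; [|assumption].
  replace (d * (L / d)) with L in Hk by (field; lra); lra.
Qed.

Definition odd_psum (nu x : R) (N : nat) : R :=
  sum_f_R0 (fun k => odd_rayleigh nu k * x ^ S k) N.

Lemma odd_psum_term_pos nu x k : 0 <= nu -> 0 < x -> 0 < odd_rayleigh nu k * x ^ S k.
Proof. intros; apply Rmult_lt_0_compat; [apply odd_rayleigh_pos | apply pow_lt]; assumption. Qed.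

Lemma odd_rayleigh_step nu rho : 0 <= nu -> ratio_bound nu rho ->
  forall k, odd_rayleigh nu (S k) <= rho ^ 2 * odd_rayleigh nu k.
Proof.
  intros Hn [Hr H] k; unfold odd_rayleigh.
  replace (2 * S k + 1)%nat with (S (S (2 * k + 1))) by lia.
  pose proof (H (2 * k + 1)%nat); pose proof (H (S (2 * k + 1))).
  apply Rmult_le_compat_l with (r := rho) in H0; [|lra]. simpl (rho ^ 2); lra.
Qed.

Lemma rayleigh_geometric nu rho : ratio_bound nu rho ->
  forall n, rayleigh nu n <= rayleigh nu 0 * rho ^ n.
Proof.
  intros [Hr H]; induction n as [|n IH]; simpl; [lra|].
  specialize (H n); apply Rmult_le_compat_l with (r := rho) in IH; lra.
Qed.

Lemma odd_rayleigh_geometric nu rho : 0 <= nu -> ratio_bound nu rho ->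
  forall k, odd_rayleigh nu k <= odd_rayleigh nu 0 * (rho ^ 2) ^ k.
Proof.
  intros Hn Hr; induction k as [|k IH]; [simpl; lra|].
  pose proof (odd_rayleigh_step nu rho Hn Hr k).
  apply Rmult_le_compat_l with (r := rho ^ 2) in IH; [|apply pow2_ge_0].
  change ((rho ^ 2) ^ S k) with (rho ^ 2 * (rho ^ 2) ^ k); lra.
Qed.

Lemma pow_root (m : nat) (y : R) : (0 < m)%nat -> 0 < y -> 0 < nroot m y /\ nroot m y ^ m = y.
Proof.
  intros Hm Hy; assert (0 < nroot m y) by apply exp_pos.
  split; [assumption|].
  rewrite <- Rpower_pow by assumption; unfold nroot.
  rewrite Rpower_mult, Rinv_l, Rpower_1; auto.
  apply not_0_INR; lia.
Qed.

Lemma pow_lt_inv (m : nat) (x y : R) : 0 <= y -> x ^ m < y ^ m -> x < y.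
Proof.
  intros Hy H; apply Rnot_le_lt; intros Hc.
  pose proof (pow_incr y x m (conj Hy Hc)); lra.
Qed.

Lemma pow_le_inv (m : nat) (x y : R) : (0 < m)%nat -> 0 <= y -> x ^ m <= y ^ m -> x <= y.
Proof.
  intros Hm Hy; destruct m as [|m]; [lia|]; intros H; apply Rnot_lt_le; intros Hc.
  revert H; apply Rlt_not_le; clear Hm.
  induction m as [|m IH]; [simpl; lra|].
  change (y * y ^ S m < x * x ^ S m).
  apply Rmult_le_0_lt_compat; auto; now apply pow_le.
Qed.

(** If the partial sums of [P] at [x] stay bounded, then [x] is strictly inside the disc of convergence.
    With [rho0 = x^(-1/2)], boundedness gives an [n] with [h_(2n+1) < rho0^(2n+2)], and the ratio
    [h_(2n+1) / h_(2n)] is below [rho0], since otherwise by log-convexity the terms of [P(x)] would never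
    decrease again.  Both inequalities are strict, so a slightly smaller [rho] still satisfies
    [ratio_bound_of_term]. *)
Lemma rayleigh_ratio_of_bounded nu x L : 0 <= nu -> 0 < x ->
  (forall N, odd_psum nu x N <= L) ->
  exists rho, ratio_bound nu rho /\ rho ^ 2 * x < 1.
Proof.
  intros Hn Hx HL.
  pose proof (rayleigh_pos nu Hn) as Hp.
  set (rho0 := / sqrt x).
  assert (H0 : 0 < rho0) by (apply Rinv_0_lt_compat, sqrt_lt_R0; assumption).
  assert (Hx0 : rho0 ^ 2 * x = 1).
  { unfold rho0; rewrite <- (sqrt_sqrt x) at 2 by lra.
    field; apply Rgt_not_eq, sqrt_lt_R0; assumption. }
  assert (E1 : exists n, odd_rayleigh nu n * x ^ S n < 1).
  { apply Classical_Pred_Type.not_all_not_ex; intros Hc.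
    destruct (sum_unbounded (fun k => odd_rayleigh nu k * x ^ S k) 0 1 L) as [N HN].
    - lra.
    - intros; apply Rlt_le; now apply odd_psum_term_pos.
    - intros k _; apply Rnot_lt_le, Hc.
    - specialize (HL N); unfold odd_psum in HL; lra. }
  destruct E1 as [n E1].
  assert (E2 : rayleigh nu (S (2 * n)) < rho0 * rayleigh nu (2 * n)).
  { apply Rnot_le_lt; intros Hc.
    pose proof (log_convex_ratio _ _ _ Hp (fun k => rayleigh_log_convex_step nu k Hn) Hc) as Hr.
    destruct (sum_unbounded (fun k => odd_rayleigh nu k * x ^ S k) n
      (odd_rayleigh nu n * x ^ S n) L) as [N HN].
    - now apply odd_psum_term_pos.
    - intros; apply Rlt_le; now apply odd_psum_term_pos.
    - intros k Hk; induction Hk as [|k Hk IH]; [lra|].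
      eapply Rle_trans; [apply IH|].
      assert (rho0 ^ 2 * odd_rayleigh nu k <= odd_rayleigh nu (S k)).
      { unfold odd_rayleigh; replace (2 * S k + 1)%nat with (S (S (2 * k + 1))) by lia.
        pose proof (Hr (2 * k + 1)%nat ltac:(lia)) as A1.
        pose proof (Hr (S (2 * k + 1)) ltac:(lia)) as A2.
        apply Rmult_le_compat_l with (r := rho0) in A1; [|lra]. simpl (rho0 ^ 2); lra. }
      apply Rmult_le_compat_r with (r := x ^ S (S k)) in H; [|now apply Rlt_le, pow_lt].
      eapply Rle_trans; [|apply H].
      change (x ^ S (S k)) with (x * x ^ S k).
      replace (rho0 ^ 2 * odd_rayleigh nu k * (x * x ^ S k))
        with ((rho0 ^ 2 * x) * (odd_rayleigh nu k * x ^ S k)) by ring.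
      rewrite Hx0; lra.
    - specialize (HL N); unfold odd_psum in HL; lra. }
  set (r1 := rayleigh nu (S (2 * n)) / rayleigh nu (2 * n)).
  destruct (pow_root (2 * n + 2) (odd_rayleigh nu n) ltac:(lia) (odd_rayleigh_pos nu n Hn)) as [X1 X2].
  set (r2 := nroot (2 * n + 2) (odd_rayleigh nu n)) in *.
  exists (Rmax r1 r2).
  assert (Hmax : 0 < Rmax r1 r2) by (apply Rlt_le_trans with r2; [|apply Rmax_r]; assumption).
  assert (Hlt : Rmax r1 r2 < rho0).
  { apply Rmax_lub_lt.
    - unfold r1; apply Rmult_lt_reg_r with (rayleigh nu (2 * n)); [apply Hp|].
      unfold Rdiv; rewrite Rmult_assoc, Rinv_l; [lra|specialize (Hp (2 * n)%nat); lra].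
    - apply (pow_lt_inv (2 * n + 2)); [lra|].
      rewrite X2; apply Rmult_lt_reg_r with (x ^ S n); [now apply pow_lt|].
      eapply Rlt_le_trans; [apply E1|].
      replace (2 * n + 2)%nat with (2 * S n)%nat by lia.
      rewrite pow_mult, <- Rpow_mult_distr, Hx0, pow1; lra. }
  split.
  2:{ rewrite <- Hx0; apply Rmult_lt_compat_r; [assumption|].
      simpl; rewrite !Rmult_1_r; apply Rmult_le_0_lt_compat; lra. }
  - apply (ratio_bound_of_term nu _ (2 * n)); [assumption|assumption| |].
    + apply Rle_trans with (r1 * rayleigh nu (2 * n)).
      * unfold r1; apply Req_le; field; specialize (Hp (2 * n)%nat); lra.
      * apply Rmult_le_compat_r; [apply Rlt_le, Hp | apply Rmax_l].
    + replace (rayleigh nu (S (2 * n))) with (odd_rayleigh nu n)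
        by (unfold odd_rayleigh; f_equal; lia).
      rewrite <- X2; apply pow_incr; split; [lra | apply Rmax_r].
Qed.

(** The function [P]. *)
Definition odd_sum (nu x : R) : R := x * PSeries (odd_rayleigh nu) x.

Lemma odd_rayleigh_radius nu rho x : 0 <= nu -> ratio_bound nu rho ->
  0 <= x -> rho ^ 2 * x < 1 -> Rbar_lt (Rabs x) (CV_radius (odd_rayleigh nu)).
Proof.
  intros Hn Hr Hx Hlt; pose proof Hr as [Hr0 _]; rewrite Rabs_pos_eq by assumption.
  apply (CV_radius_geometric _ (odd_rayleigh nu 0) (rho ^ 2)); auto; [now apply pow_lt|].
  intros k; rewrite Rabs_pos_eq by (apply Rlt_le; now apply odd_rayleigh_pos).
  now apply odd_rayleigh_geometric.
Qed.

Lemma odd_psum_lim nu rho x : 0 <= nu -> ratio_bound nu rho ->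
  0 <= x -> rho ^ 2 * x < 1 -> is_lim_seq (odd_psum nu x) (odd_sum nu x).
Proof.
  intros Hn Hr Hx Hlt; unfold odd_sum.
  pose proof (odd_rayleigh_radius nu rho x Hn Hr Hx Hlt) as Hcv.
  pose proof (CV_radius_inside _ _ Hcv) as Hex.
  pose proof (PSeries_correct _ _ Hex) as Hps.
  apply is_pseries_R in Hps.
  apply (is_series_scal_l x) in Hps.
  apply is_lim_seq_ext with (2 := Hps).
  intros N; rewrite sum_n_Reals; unfold odd_psum; apply sum_eq; intros.
  unfold scal; simpl; unfold mult; simpl; ring.
Qed.

Lemma odd_psum_incr nu x N : 0 <= nu -> 0 < x -> odd_psum nu x N <= odd_psum nu x (S N).
Proof.
  intros; unfold odd_psum; rewrite tech5; pose proof (odd_psum_term_pos nu x (S N) H H0); lra.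
Qed.

Lemma odd_psum_mono nu x y N : 0 <= nu -> 0 <= x <= y -> odd_psum nu x N <= odd_psum nu y N.
Proof.
  intros Hn Hxy; unfold odd_psum; apply sum_Rle; intros k _.
  apply Rmult_le_compat_l; [apply Rlt_le; now apply odd_rayleigh_pos | now apply pow_incr].
Qed.

Lemma odd_psum_continuous nu N x : continuity_pt (fun x => odd_psum nu x N) x.
Proof.
  unfold odd_psum; induction N as [|N IH].
  - simpl; reg.
  - apply (continuity_pt_ext (fun x => sum_f_R0 (fun k => odd_rayleigh nu k * x ^ S k) N
      + odd_rayleigh nu (S N) * x ^ S (S N))); [intros; now rewrite tech5|].
    apply continuity_pt_plus; [assumption|]. reg.
Qed.

Lemma odd_psum_le_odd_sum nu rho x N : 0 <= nu -> ratio_bound nu rho ->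
  0 < x -> rho ^ 2 * x < 1 -> odd_psum nu x N <= odd_sum nu x.
Proof.
  intros Hn Hr Hx Hlt; revert N.
  apply is_lim_seq_incr_compare; [|intros; now apply odd_psum_incr].
  apply (odd_psum_lim nu rho); auto; lra.
Qed.

Lemma odd_sum_extend nu rho x L : 0 <= nu -> ratio_bound nu rho ->
  0 <= x -> rho ^ 2 * x < 1 -> odd_sum nu x < L ->
  exists y, x < y /\ forall N, odd_psum nu y N <= L.
Proof.
  intros Hn Hr Hx Hlt HL; pose proof Hr as [Hr0 _].
  assert (Hcont : continuity_pt (odd_sum nu) x).
  { apply continuity_pt_mult; [reg|]. apply PSeries_continuity.
    now apply (odd_rayleigh_radius nu rho x). }
  destruct (Hcont (L - odd_sum nu x)) as [d [Hd Hcl]]; [lra|].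
  assert (Hr2 : 0 < rho ^ 2) by now apply pow_lt.
  set (e := Rmin (d / 2) ((/ rho ^ 2 - x) / 2)).
  assert (He : 0 < / rho ^ 2 - x).
  { apply Rlt_0_minus, Rmult_lt_reg_l with (rho ^ 2); [assumption|]. rewrite Rinv_r; lra. }
  assert (He0 : 0 < e) by (apply Rmin_pos; lra).
  assert (e <= d / 2) by apply Rmin_l.
  assert (e <= (/ rho ^ 2 - x) / 2) by apply Rmin_r.
  assert (Hy : rho ^ 2 * (x + e) < 1).
  { apply Rlt_le_trans with (rho ^ 2 * / rho ^ 2);
      [apply Rmult_lt_compat_l; lra | rewrite Rinv_r; lra]. }
  exists (x + e); split; [lra|]; intros N.
  eapply Rle_trans; [apply (odd_psum_le_odd_sum nu rho); auto; lra|].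
  specialize (Hcl (x + e)); simpl in Hcl; unfold Rdist, D_x, no_cond in Hcl.
  assert (Hab : Rabs (odd_sum nu (x + e) - odd_sum nu x) < L - odd_sum nu x).
  { apply Hcl; split; [split; [exact I | lra]|].
    replace (x + e - x) with e by ring; rewrite Rabs_pos_eq; lra. }
  apply Rabs_def2 in Hab; lra.
Qed.

(** Take the supremum of the points where the partial sums of [P] stay below [L].  It is inside the disc
    of convergence by [rayleigh_ratio_of_bounded], so that a value of [P] smaller than [L] there could still be
    exceeded further to the right. *)
Lemma odd_root_exists nu L : 0 <= nu -> 0 < L ->
  exists x rho, 0 < x /\ ratio_bound nu rho /\ rho ^ 2 * x < 1 /\ odd_sum nu x = L.
Proof.
  intros Hn HL.
  set (Ex := fun x => 0 <= x /\ forall N, odd_psum nu x N <= L).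
  assert (Q0 : 0 < odd_rayleigh nu 0) by now apply odd_rayleigh_pos.
  destruct (completeness Ex) as [x [Hub Hlub]].
  - exists (L / odd_rayleigh nu 0); intros x [Hx H]; specialize (H O).
    unfold odd_psum in H; simpl in H.
    apply Rmult_le_reg_r with (odd_rayleigh nu 0); [assumption|].
    unfold Rdiv; rewrite Rmult_assoc, Rinv_l; lra.
  - exists 0; split; [lra|]; intros N; unfold odd_psum.
    rewrite (sum_eq _ (fun _ => 0)) by (intros; simpl; ring).
    rewrite sum_cte; lra.
  - assert (Hx : 0 < x).
    { set (r := rayleigh nu 0).
      assert (Hr : 0 < r) by now apply rayleigh_pos.
      assert (H1 : rayleigh nu 1 <= r * r).
      { rewrite rayleigh_succ by assumption; cbn [conv]; fold r; simpl INR.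
        unfold Rdiv; rewrite <- (Rmult_1_r (r * r)) at 2.
        apply Rmult_le_compat_l; [nra|].
        rewrite <- Rinv_1; apply Rinv_le_contravar; lra. }
      destruct (odd_sum_extend nu r 0 L) as [y [Hy1 Hy2]]; auto; try lra.
      - apply (ratio_bound_of_term nu r 0); auto; simpl; rewrite ?Rmult_1_r; assumption.
      - unfold odd_sum; lra.
      - assert (y <= x) by (apply Hub; split; [lra|assumption]). lra. }
    assert (HxE : forall N, odd_psum nu x N <= L).
    { (* a partial sum above [L] would stay above [L] slightly to the left of the supremum *)
      intros N; apply Rnot_lt_le; intros Hc.
      destruct (odd_psum_continuous nu N x (odd_psum nu x N - L)) as [d [Hd Hcl]]; [lra|].
      assert (Hy : x <= x - Rmin (d / 2) (x / 2)).
      { apply Hlub; intros z [Hz1 Hz2]; apply Rnot_lt_le; intros Hz.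
        set (e := Rmin (d / 2) (x / 2)) in *.
        assert (0 < e) by (apply Rmin_pos; lra).
        assert (e <= d / 2) by apply Rmin_l. assert (e <= x / 2) by apply Rmin_r.
        specialize (Hcl (x - e)); simpl in Hcl; unfold Rdist, D_x, no_cond in Hcl.
        assert (Hab : Rabs (odd_psum nu (x - e) N - odd_psum nu x N) < odd_psum nu x N - L).
        { apply Hcl; split; [split; [exact I | lra]|].
          replace (x - e - x) with (- e) by ring; rewrite Rabs_Ropp, Rabs_pos_eq; lra. }
        apply Rabs_def2 in Hab.
        pose proof (odd_psum_mono nu (x - e) z N Hn ltac:(lra)). specialize (Hz2 N); lra. }
      assert (0 < Rmin (d / 2) (x / 2)) by (apply Rmin_pos; lra). lra. }
    destruct (rayleigh_ratio_of_bounded nu x L Hn Hx HxE) as [rho [Hr Hrx]].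
    exists x, rho; split; [|split; [|split]]; auto.
    assert (Hle : odd_sum nu x <= L).
    { apply (is_lim_seq_le (odd_psum nu x) (fun _ => L) (odd_sum nu x) L HxE).
      - apply (odd_psum_lim nu rho); auto; lra.
      - apply is_lim_seq_const. }
    apply Rle_antisym; [assumption|]; apply Rnot_lt_le; intros Hc.
    destruct (odd_sum_extend nu rho x L) as [y [Hy1 Hy2]]; auto; try lra.
    assert (y <= x) by (apply Hub; split; [lra|assumption]). lra.
Qed.

Lemma odd_root_lt nu rho x y L : 0 <= nu -> ratio_bound nu rho ->
  0 < x -> rho ^ 2 * x < 1 -> odd_sum nu x = L -> 0 < y ->
  (exists N, L < odd_psum nu y N) -> x < y.
Proof.
  intros Hn Hr Hx Hlt HL Hy [N HN]; apply Rnot_le_lt; intros Hc.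
  pose proof (odd_psum_mono nu y x N Hn ltac:(lra)).
  pose proof (odd_psum_le_odd_sum nu rho x N Hn Hr Hx Hlt). lra.
Qed.

Lemma odd_root_gt nu rho x y L B : 0 <= nu -> ratio_bound nu rho ->
  0 < x -> rho ^ 2 * x < 1 -> odd_sum nu x = L ->
  (forall N, odd_psum nu y N <= B) -> B < L -> y < x.
Proof.
  intros Hn Hr Hx Hlt HL HB HBL; apply Rnot_le_lt; intros Hc.
  assert (odd_sum nu x <= B); [|lra].
  apply (is_lim_seq_le (odd_psum nu x) (fun _ => B) (odd_sum nu x) B).
  - intros N; apply Rle_trans with (odd_psum nu y N); [apply odd_psum_mono; auto; lra | apply HB].
  - apply (odd_psum_lim nu rho); auto; lra.
  - apply is_lim_seq_const.
Qed.

(** * Closed forms of the first Rayleigh sums *)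

Lemma rayleigh_value_1 nu : 0 <= nu -> rayleigh nu 1 =
  (1) /
  (2 ^ 4 * (nu + 1) ^ 2 * (nu + 2)).
Proof.
  intros Hn; rewrite rayleigh_succ by assumption; cbn [conv].
  rewrite ?rayleigh_0 by assumption.
  simpl INR; field; repeat split; lra.
Qed.

Lemma rayleigh_value_2 nu : 0 <= nu -> rayleigh nu 2 =
  (1) /
  (2 ^ 5 * (nu + 1) ^ 3 * (nu + 2) * (nu + 3)).
Proof.
  intros Hn; rewrite rayleigh_succ by assumption; cbn [conv].
  rewrite ?rayleigh_0, ?rayleigh_value_1 by assumption.
  simpl INR; field; repeat split; lra.
Qed.

Lemma rayleigh_value_3 nu : 0 <= nu -> rayleigh nu 3 =
  (5 * nu + 11) /
  (2 ^ 8 * (nu + 1) ^ 4 * (nu + 2) ^ 2 * (nu + 3) * (nu + 4)).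
Proof.
  intros Hn; rewrite rayleigh_succ by assumption; cbn [conv].
  rewrite ?rayleigh_0, ?rayleigh_value_1, ?rayleigh_value_2 by assumption.
  simpl INR; field; repeat split; lra.
Qed.

Lemma rayleigh_value_4 nu : 0 <= nu -> rayleigh nu 4 =
  (7 * nu + 19) /
  (2 ^ 9 * (nu + 1) ^ 5 * (nu + 2) ^ 2 * (nu + 3) * (nu + 4) * (nu + 5)).
Proof.
  intros Hn; rewrite rayleigh_succ by assumption; cbn [conv].
  rewrite ?rayleigh_0, ?rayleigh_value_1, ?rayleigh_value_2, ?rayleigh_value_3 by assumption.
  simpl INR; field; repeat split; lra.
Qed.

Lemma rayleigh_value_5 nu : 0 <= nu -> rayleigh nu 5 =
  (21 * nu ^ 3 + 181 * nu ^ 2 + 513 * nu + 473) /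
  (2 ^ 11 * (nu + 1) ^ 6 * (nu + 2) ^ 3 * (nu + 3) ^ 2 * (nu + 4) * (nu + 5) * (nu + 6)).
Proof.
  intros Hn; rewrite rayleigh_succ by assumption; cbn [conv].
  rewrite ?rayleigh_0, ?rayleigh_value_1, ?rayleigh_value_2, ?rayleigh_value_3, ?rayleigh_value_4 by assumption.
  simpl INR; field; repeat split; lra.
Qed.

Lemma rayleigh_value_6 nu : 0 <= nu -> rayleigh nu 6 =
  (33 * nu ^ 3 + 329 * nu ^ 2 + 1081 * nu + 1145) /
  (2 ^ 12 * (nu + 1) ^ 7 * (nu + 2) ^ 3 * (nu + 3) ^ 2 * (nu + 4) * (nu + 5) * (nu + 6) * (nu + 7)).
Proof.
  intros Hn; rewrite rayleigh_succ by assumption; cbn [conv].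
  rewrite ?rayleigh_0, ?rayleigh_value_1, ?rayleigh_value_2, ?rayleigh_value_3, ?rayleigh_value_4, ?rayleigh_value_5 by assumption.
  simpl INR; field; repeat split; lra.
Qed.

Lemma rayleigh_value_7 nu : 0 <= nu -> rayleigh nu 7 =
  (429 * nu ^ 5 + 7640 * nu ^ 4 + 53752 * nu ^ 3 + 185430 * nu ^ 2 + 311387 * nu + 202738) /
  (2 ^ 16 * (nu + 1) ^ 8 * (nu + 2) ^ 4 * (nu + 3) ^ 2 * (nu + 4) ^ 2 * (nu + 5) * (nu + 6) * (nu + 7) * (nu + 8)).
Proof.
  intros Hn; rewrite rayleigh_succ by assumption; cbn [conv].
  rewrite ?rayleigh_0, ?rayleigh_value_1, ?rayleigh_value_2, ?rayleigh_value_3, ?rayleigh_value_4, ?rayleigh_value_5, ?rayleigh_value_6 by assumption.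
  simpl INR; field; repeat split; lra.
Qed.

Lemma rayleigh_value_8 nu : 0 <= nu -> rayleigh nu 8 =
  (715 * nu ^ 6 + 16567 * nu ^ 5 + 158568 * nu ^ 4 + 798074 * nu ^ 3 + 2217079 * nu ^ 2 + 3212847 * nu + 1893046) /
  (2 ^ 17 * (nu + 1) ^ 9 * (nu + 2) ^ 4 * (nu + 3) ^ 3 * (nu + 4) ^ 2 * (nu + 5) * (nu + 6) * (nu + 7) * (nu + 8) * (nu + 9)).
Proof.
  intros Hn; rewrite rayleigh_succ by assumption; cbn [conv].
  rewrite ?rayleigh_0, ?rayleigh_value_1, ?rayleigh_value_2, ?rayleigh_value_3, ?rayleigh_value_4, ?rayleigh_value_5, ?rayleigh_value_6, ?rayleigh_value_7 by assumption.
  simpl INR; field; repeat split; lra.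
Qed.

Lemma rayleigh_value_9 nu : 0 <= nu -> rayleigh nu 9 =
  (2431 * nu ^ 8 + 80425 * nu ^ 7 + 1152851 * nu ^ 6 + 9315667 * nu ^ 5 + 46240675 * nu ^ 4 + 143917279 * nu ^ 3 + 273583653 * nu ^ 2 + 289891557 * nu + 130934438) /
  (2 ^ 19 * (nu + 1) ^ 10 * (nu + 2) ^ 5 * (nu + 3) ^ 3 * (nu + 4) ^ 2 * (nu + 5) ^ 2 * (nu + 6) * (nu + 7) * (nu + 8) * (nu + 9) * (nu + 10)).
Proof.
  intros Hn; rewrite rayleigh_succ by assumption; cbn [conv].
  rewrite ?rayleigh_0, ?rayleigh_value_1, ?rayleigh_value_2, ?rayleigh_value_3, ?rayleigh_value_4, ?rayleigh_value_5, ?rayleigh_value_6, ?rayleigh_value_7, ?rayleigh_value_8 by assumption.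
  simpl INR; field; repeat split; lra.
Qed.

(** * Polynomial inequalities *)

Ltac pos :=
  lazymatch goal with
  | |- 0 < _ * _ => apply Rmult_lt_0_compat; pos
  | |- 0 < _ / _ => apply Rdiv_lt_0_compat; pos
  | |- 0 < _ ^ _ => apply pow_lt; pos
  | |- 0 < poch _ _ => apply poch_pos; pos
  | |- _ => first [assumption | lra]
  end.

(** For polynomials in one positive variable whose expanded form has only positive coefficients. *)
Ltac poly_pos :=
  match goal with |- 0 < ?e => ring_simplify e end;
  repeat (apply Rplus_lt_0_compat; [|]); try lra;
  repeat first [apply Rmult_lt_0_compat | apply pow_lt]; lra.

(** The numerator of [sigma_3], where [sigma_k] is the sum of the [x^(-k)] over the zeros [x] of
    [phi(x) + (2/nu) x phi'(x)], with [phi(y^2) = f(y) f(-y)]; the smallest of these zeros is [t^4].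
    Likewise [num4] is the numerator of [sigma_4]. *)
Definition num3 (nu : R) : R :=
  21 * nu ^ 4 + 173 * nu ^ 3 + 533 * nu ^ 2 + 717 * nu + 360.

Definition num4 (nu : R) : R :=
  429 * nu ^ 8 + 8688 * nu ^ 7 + 76280 * nu ^ 6 + 377494 * nu ^ 5
  + 1148139 * nu ^ 4 + 2194202 * nu ^ 3 + 2574064 * nu ^ 2 + 1698048 * nu + 483840.

Lemma num3_pos nu : 0 < nu -> 0 < num3 nu.
Proof. intros H; unfold num3; poly_pos. Qed.

Lemma num4_pos nu : 0 < nu -> 0 < num4 nu.
Proof. intros H; unfold num4; poly_pos. Qed.

(** The quotient [sigma_3 / sigma_4]. *)
Definition upper4 (nu : R) : R :=
  32 * nu * (nu + 1) ^ 2 * (nu + 2) ^ 2 * (nu + 4) * (nu + 6) * (nu + 7) * num3 nu / num4 nu.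

(** The inverse of [sigma_3], hence the cube of the last lower bound of [t^4]. *)
Definition lower3 (nu : R) : R :=
  2 ^ 11 * nu ^ 3 * (nu + 1) ^ 6 * (nu + 2) ^ 2 * (nu + 3) ^ 2 * (nu + 4) * (nu + 5) / num3 nu.

(** In other words [h_5 / h_4 <= rho] for [rho^6 = h_5]. *)
Lemma rayleigh_base nu : 0 < nu -> rayleigh nu 5 ^ 5 <= rayleigh nu 4 ^ 6.
Proof.
  intros H; rewrite rayleigh_value_5, rayleigh_value_4 by lra.
  apply Rminus_le_0.
  match goal with |- 0 <= ?X => replace X with
    ((2 * (7 * nu + 19) ^ 6 * (nu + 2) ^ 3 * (nu + 3) ^ 4 * (nu + 6) ^ 5
      - (21 * nu ^ 3 + 181 * nu ^ 2 + 513 * nu + 473) ^ 5 * (nu + 4) * (nu + 5))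
     / (2 ^ 55 * (nu + 1) ^ 30 * (nu + 2) ^ 15 * (nu + 3) ^ 10 * (nu + 4) ^ 6 * (nu + 5) ^ 6 * (nu + 6) ^ 5))
  end.
  2:{ field; repeat split; lra. }
  apply Rlt_le, Rdiv_lt_0_compat; [poly_pos|].
  pos.
Qed.

Lemma upper4_ratio nu : 0 < nu ->
  rayleigh nu 7 * upper4 nu < rayleigh nu 5.
Proof.
  intros H; rewrite rayleigh_value_7, rayleigh_value_5 by lra; unfold upper4.
  pose proof (num4_pos nu H); apply Rminus_lt_0.
  match goal with |- 0 < ?X => replace X with
    (((21 * nu ^ 3 + 181 * nu ^ 2 + 513 * nu + 473) * (nu + 8) * num4 nu
      - (429 * nu ^ 5 + 7640 * nu ^ 4 + 53752 * nu ^ 3 + 185430 * nu ^ 2 + 311387 * nu + 202738)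
        * nu * (nu + 2) * (nu + 6) * num3 nu)
     / (2 ^ 11 * (nu + 1) ^ 6 * (nu + 2) ^ 3 * (nu + 3) ^ 2 * (nu + 4) * (nu + 5) * (nu + 6) * (nu + 8) * num4 nu))
  end.
  2:{ field; repeat split; lra. }
  apply Rdiv_lt_0_compat; [unfold num3, num4; poly_pos|].
  pos.
Qed.

(** After division by [h_5 - h_7 X > 0] this says that [nu/2] is smaller than
    [h_1 X + h_3 X^2 + h_5 X^3 / (1 - h_7 X / h_5)], a lower bound of [P(X)]. *)
Lemma upper4_tail nu : 0 < nu ->
  (nu / 2 - rayleigh nu 1 * upper4 nu - rayleigh nu 3 * upper4 nu ^ 2)
    * (rayleigh nu 5 - rayleigh nu 7 * upper4 nu)
  < rayleigh nu 5 ^ 2 * upper4 nu ^ 3.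
Proof.
  intros H; rewrite rayleigh_value_7, rayleigh_value_5, rayleigh_value_3, rayleigh_value_1 by lra.
  unfold upper4.
  pose proof (num4_pos nu H); apply Rminus_lt_0.
  match goal with |- 0 < ?X => replace X with
    (nu * (32 * (21 * nu ^ 3 + 181 * nu ^ 2 + 513 * nu + 473) ^ 2 * (nu + 8) * nu ^ 2 * (nu + 2) ^ 3
        * (nu + 4) ^ 2 * (nu + 6) ^ 2 * (nu + 7) ^ 3 * num3 nu ^ 3
      - (nu + 3) * (nu + 5) * ((nu + 3) * num4 nu ^ 2
          - 4 * (nu + 2) * (nu + 4) * (nu + 6) * (nu + 7) * num3 nu * num4 nu * (nu + 3)
          - 8 * nu * (nu + 2) ^ 2 * (nu + 4) * (nu + 6) ^ 2 * (nu + 7) ^ 2 * (5 * nu + 11) * num3 nu ^ 2)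
        * ((21 * nu ^ 3 + 181 * nu ^ 2 + 513 * nu + 473) * (nu + 8) * num4 nu
           - (429 * nu ^ 5 + 7640 * nu ^ 4 + 53752 * nu ^ 3 + 185430 * nu ^ 2 + 311387 * nu + 202738)
             * nu * (nu + 2) * (nu + 6) * num3 nu))
     / (2 ^ 12 * (nu + 1) ^ 6 * (nu + 2) ^ 3 * (nu + 3) ^ 4 * (nu + 4) * (nu + 5) ^ 2 * (nu + 6) * (nu + 8) * num4 nu ^ 3))
  end.
  2:{ field; repeat split; lra. }
  apply Rdiv_lt_0_compat; [apply Rmult_lt_0_compat; [lra|unfold num3, num4; poly_pos]|].
  pos.
Qed.

Lemma lower3_contraction nu : 0 < nu -> rayleigh nu 5 * lower3 nu < 1.
Proof.
  intros H; rewrite rayleigh_value_5 by lra; unfold lower3.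
  pose proof (num3_pos nu H); apply Rminus_lt_0.
  match goal with |- 0 < ?X => replace X with
    (((nu + 2) * (nu + 6) * num3 nu - (21 * nu ^ 3 + 181 * nu ^ 2 + 513 * nu + 473) * nu ^ 3)
     / ((nu + 2) * (nu + 6) * num3 nu))
  end.
  2:{ field; repeat split; lra. }
  apply Rdiv_lt_0_compat; [unfold num3; poly_pos|].
  pos.
Qed.

(** The norm of [al + be T + ga T^2] for [T^3 = tau]; its sign gives the sign of this number
    by [sum_three_cubes_neg]. *)
Lemma lower3_norm nu : 0 < nu ->
  let tau := lower3 nu in
  let al := (1 + nu / 2) * rayleigh nu 5 * tau - nu / 2 in
  let be := rayleigh nu 1 - (rayleigh nu 1 * rayleigh nu 5 - rayleigh nu 7) * tau in
  let ga := rayleigh nu 3 - (rayleigh nu 3 * rayleigh nu 5 - rayleigh nu 9) * tau in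
  al ^ 3 + be ^ 3 * tau + ga ^ 3 * tau ^ 2 - 3 * al * be * ga * tau < 0.
Proof.
  intros H; cbv zeta.
  rewrite rayleigh_value_9, rayleigh_value_7, rayleigh_value_5, rayleigh_value_3, rayleigh_value_1 by lra.
  unfold lower3.
  pose proof (num3_pos nu H).
  set (n3 := 5 * nu + 11).
  set (n5 := 21 * nu ^ 3 + 181 * nu ^ 2 + 513 * nu + 473).
  set (n7 := 429 * nu ^ 5 + 7640 * nu ^ 4 + 53752 * nu ^ 3 + 185430 * nu ^ 2 + 311387 * nu + 202738).
  set (n9 := 2431 * nu ^ 8 + 80425 * nu ^ 7 + 1152851 * nu ^ 6 + 9315667 * nu ^ 5 + 46240675 * nu ^ 4
             + 143917279 * nu ^ 3 + 273583653 * nu ^ 2 + 289891557 * nu + 130934438).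
  (* up to positive factors, [(nu + 6) * num3 nu - n5 * nu ^ 2] is the numerator of [- al], and the two sums
     ending in [n7 * nu ^ 3] and [n9 * nu ^ 3] are those of [be] and [ga] *)
  match goal with |- ?X < 0 => replace X with
    (- ((nu / 2) ^ 3 * (2 * ((nu + 6) * num3 nu - n5 * nu ^ 2) ^ 3 * (nu + 2) ^ 5 * (nu + 4) ^ 2 * (nu + 5)
          * (nu + 7) ^ 3 * (nu + 8) ^ 3 * (nu + 9) ^ 3 * (nu + 10) ^ 3 * num3 nu ^ 2
        - (2 * (nu + 4) * (nu + 7) * (nu + 8) * ((nu + 2) * (nu + 6) * num3 nu - n5 * nu ^ 3) + n7 * nu ^ 3) ^ 3
          * (nu + 3) ^ 2 * (nu + 5) ^ 2 * (nu + 2) * (nu + 9) ^ 3 * (nu + 10) ^ 3 * num3 nu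
        - 4 * nu ^ 3 * (nu + 3) * (nu + 4)
          * (n3 * (nu + 5) * (nu + 7) * (nu + 8) * (nu + 9) * (nu + 10)
               * ((nu + 2) * (nu + 6) * num3 nu - n5 * nu ^ 3) + n9 * nu ^ 3) ^ 3
        - 6 * ((nu + 6) * num3 nu - n5 * nu ^ 2)
          * (2 * (nu + 4) * (nu + 7) * (nu + 8) * ((nu + 2) * (nu + 6) * num3 nu - n5 * nu ^ 3) + n7 * nu ^ 3)
          * (n3 * (nu + 5) * (nu + 7) * (nu + 8) * (nu + 9) * (nu + 10)
               * ((nu + 2) * (nu + 6) * num3 nu - n5 * nu ^ 3) + n9 * nu ^ 3)
          * nu * (nu + 3) * (nu + 2) ^ 2 * (nu + 4) * (nu + 5) * (nu + 7) * (nu + 8)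
          * (nu + 9) ^ 2 * (nu + 10) ^ 2 * num3 nu)
     / (2 * (nu + 2) ^ 5 * (nu + 4) ^ 2 * (nu + 5) * (nu + 6) ^ 3 * (nu + 7) ^ 3 * (nu + 8) ^ 3
        * (nu + 9) ^ 3 * (nu + 10) ^ 3 * num3 nu ^ 5)))
  end.
  2:{ clearbody n3 n5 n7 n9; field; repeat split; lra. }
  apply Ropp_lt_gt_0_contravar, Rdiv_lt_0_compat; [apply Rmult_lt_0_compat|].
  - apply pow_lt; lra.
  - unfold num3, n3, n5, n7, n9; poly_pos.
  - pos.
Qed.

(** * Localisation of the root *)

Lemma sum_shift (a : nat -> R) m N :
  sum_f_R0 a (S m + N) = sum_f_R0 a m + sum_f_R0 (fun k => a (S m + k)%nat) N.
Proof.
  rewrite (tech2 a m (S m + N)) by lia; do 2 f_equal; lia.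
Qed.

(** By log-convexity the coefficients of [P] from the third one on decrease at most as fast as a
    geometric series of ratio [h_7 / h_5], so [P(X)] exceeds the rational function of [upper4_tail]. *)
Lemma odd_psum_exceeds_upper4 nu : 0 < nu -> exists N, nu / 2 < odd_psum nu (upper4 nu) N.
Proof.
  intros Hnu; assert (Hn : 0 <= nu) by lra.
  pose proof (num3_pos nu Hnu); pose proof (num4_pos nu Hnu).
  pose proof (upper4_ratio nu Hnu) as HR; pose proof (upper4_tail nu Hnu) as HT.
  pose proof (rayleigh_pos nu Hn) as Hp.
  assert (HX : 0 < upper4 nu).
  { unfold upper4; pos. }
  set (X := upper4 nu) in *.
  apply Classical_Pred_Type.not_all_not_ex; intros Hc.
  assert (HL : forall N, odd_psum nu X N <= nu / 2) by (intros N; apply Rnot_lt_le, Hc).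
  clear Hc.
  set (a := fun k => odd_rayleigh nu k * X ^ S k).
  set (r := rayleigh nu 7 / rayleigh nu 5).
  assert (Hr : forall k, (2 <= k)%nat -> r * odd_rayleigh nu k <= odd_rayleigh nu (S k)).
  { apply (log_convex_ratio (odd_rayleigh nu) r 2).
    - intros; now apply odd_rayleigh_pos.
    - intros; now apply odd_rayleigh_log_convex.
    - unfold odd_rayleigh, r; simpl (2 * 2 + 1)%nat; simpl (2 * 3 + 1)%nat.
      apply Req_le; field; specialize (Hp 5%nat); lra. }
  assert (Hr0 : 0 < r) by (apply Rdiv_lt_0_compat; apply Hp).
  assert (HrX : r * X < 1).
  { unfold r; apply Rmult_lt_reg_r with (rayleigh nu 5); [apply Hp|].
    replace (rayleigh nu 7 / rayleigh nu 5 * X * rayleigh nu 5) with (rayleigh nu 7 * X)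
      by (field; specialize (Hp 5%nat); lra). lra. }
  assert (Ha : forall k, a 2%nat * (r * X) ^ k <= a (2 + k)%nat).
  { induction k as [|k IH]; [simpl; lra|].
    apply Rle_trans with (r * X * a (2 + k)%nat).
    - replace (a 2%nat * (r * X) ^ S k) with (r * X * (a 2%nat * (r * X) ^ k)) by (simpl; ring).
      apply Rmult_le_compat_l; [nra|assumption].
    - replace (2 + S k)%nat with (S (2 + k)) by lia. unfold a.
      specialize (Hr (2 + k)%nat ltac:(lia)).
      apply Rmult_le_compat_r with (r := X ^ S (S (2 + k))) in Hr; [|now apply Rlt_le, pow_lt].
      change (X ^ S (S (2 + k))) with (X * X ^ S (2 + k)) in *. lra. }
  assert (HS : forall N, (a 0%nat + a 1%nat) + a 2%nat * sum_n (fun k => (r * X) ^ k) N <= nu / 2).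
  { intros N; eapply Rle_trans; [|apply (HL (2 + N)%nat)].
    unfold odd_psum; fold a; rewrite (sum_shift a 1 N), sum_n_Reals.
    apply Rplus_le_compat; [simpl; lra|].
    rewrite scal_sum; apply sum_Rle; intros k _.
    rewrite Rmult_comm; apply Ha. }
  assert (Hlim : a 0%nat + a 1%nat + a 2%nat * / (1 - r * X) <= nu / 2).
  { apply (is_lim_seq_le
      (fun N => (a 0%nat + a 1%nat) + a 2%nat * sum_n (fun k => (r * X) ^ k) N) (fun _ => nu / 2)
      (a 0%nat + a 1%nat + a 2%nat * / (1 - r * X)) (nu / 2) HS).
    - apply is_lim_seq_plus'; [apply is_lim_seq_const|].
      apply (is_lim_seq_scal_l _ (a 2%nat) (/ (1 - r * X))).
      apply (is_series_geom (r * X)). rewrite Rabs_pos_eq; [assumption|nra].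
    - apply is_lim_seq_const. }
  unfold a, odd_rayleigh in Hlim; simpl (2 * 0 + 1)%nat in Hlim;
    simpl (2 * 1 + 1)%nat in Hlim; simpl (2 * 2 + 1)%nat in Hlim.
  assert (HE : / (1 - r * X) = rayleigh nu 5 / (rayleigh nu 5 - rayleigh nu 7 * X)).
  { unfold r; field; repeat split; try lra; specialize (Hp 5%nat); lra. }
  rewrite HE in Hlim.
  apply Rmult_le_compat_r with (r := rayleigh nu 5 - rayleigh nu 7 * X) in Hlim; [|lra].
  replace ((rayleigh nu 1 * X ^ 1 + rayleigh nu 3 * X ^ 2 +
      rayleigh nu 5 * X ^ 3 * (rayleigh nu 5 / (rayleigh nu 5 - rayleigh nu 7 * X))) *
     (rayleigh nu 5 - rayleigh nu 7 * X))
    with ((rayleigh nu 1 * X + rayleigh nu 3 * X ^ 2) * (rayleigh nu 5 - rayleigh nu 7 * X)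
          + rayleigh nu 5 ^ 2 * X ^ 3) in Hlim by (field; lra).
  lra.
Qed.

(** In terms of the zeros of [J_nu] this is [sum_j j^(-2n-14) <= (sum_j j^(-12)) (sum_j j^(-2n-2))]. *)
Lemma rayleigh_step6 nu n : 0 < nu -> rayleigh nu (n + 6) <= rayleigh nu 5 * rayleigh nu n.
Proof.
  intros Hnu; assert (Hn : 0 <= nu) by lra.
  pose proof (rayleigh_pos nu Hn) as Hp.
  destruct (pow_root 6 (rayleigh nu 5) ltac:(lia) (Hp 5%nat)) as [R1 R2].
  set (rho := nroot 6 (rayleigh nu 5)) in *.
  assert (H : ratio_bound nu rho).
  { apply (ratio_bound_of_term nu rho 4); auto.
    - apply (pow_le_inv 6); [lia | apply Rmult_le_pos; apply Rlt_le; auto |].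
      rewrite Rpow_mult_distr, R2.
      change (rayleigh nu 5 ^ 6) with (rayleigh nu 5 * rayleigh nu 5 ^ 5).
      apply Rmult_le_compat_l; [apply Rlt_le, Hp | now apply rayleigh_base].
    - rewrite <- R2; simpl (4 + 2)%nat; lra. }
  destruct H as [_ H]; rewrite <- R2.
  assert (G : forall k, rayleigh nu (n + k) <= rho ^ k * rayleigh nu n).
  { induction k as [|k IH]; [replace (n + 0)%nat with n by lia; simpl; lra|].
    replace (n + S k)%nat with (S (n + k)) by lia.
    apply Rle_trans with (1 := H _).
    simpl; rewrite Rmult_assoc; apply Rmult_le_compat_l; lra. }
  apply G.
Qed.

Lemma sum_three_cubes_neg a b c : a ^ 3 + b ^ 3 + c ^ 3 - 3 * a * b * c < 0 -> a + b + c < 0.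
Proof.
  intros H; apply Rnot_le_lt; intros Hc; revert H; apply Rle_not_lt.
  replace (a ^ 3 + b ^ 3 + c ^ 3 - 3 * a * b * c)
    with ((a + b + c) * (((a - b) ^ 2 + (b - c) ^ 2 + (c - a) ^ 2) / 2)) by field.
  apply Rmult_le_pos; [assumption|].
  pose proof (pow2_ge_0 (a - b)); pose proof (pow2_ge_0 (b - c)); pose proof (pow2_ge_0 (c - a)); lra.
Qed.

Lemma lower3_pos nu : 0 < nu -> 0 < lower3 nu.
Proof.
  intros H; pose proof (num3_pos nu H); unfold lower3; pos.
Qed.

(** Let [a_k] be the terms of [P(T)] and [th = h_5 T^3 < 1].  By [rayleigh_step6]
    [a_(k+3) <= th a_k], so with the first five terms kept exactly
    [P (1 - th) <= a_0 + ... + a_4 - th (a_0 + a_1)].  Replacing [T^3] by [lower3 nu] turns the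
    claim that this is below [(nu/2) (1 - th)] into [al + be T + ga T^2 < 0]. *)
Lemma odd_psum_bounded_lower3 nu : 0 < nu ->
  exists B, B < nu / 2 /\ forall N, odd_psum nu (nroot 3 (lower3 nu)) N <= B.
Proof.
  intros Hnu; assert (Hn : 0 <= nu) by lra.
  pose proof (lower3_contraction nu Hnu) as Hth.
  pose proof (lower3_norm nu Hnu) as HN; cbv zeta in HN.
  destruct (pow_root 3 (lower3 nu) ltac:(lia) (lower3_pos nu Hnu)) as [T0 T3].
  set (T := nroot 3 (lower3 nu)) in *; rewrite <- T3 in *; clear T3.
  pose proof (rayleigh_pos nu Hn) as Hp.
  set (s1 := rayleigh nu 1) in *; set (s2 := rayleigh nu 3) in *;
  set (s3 := rayleigh nu 5) in *; set (s4 := rayleigh nu 7) in *; set (s5 := rayleigh nu 9) in *.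
  set (al := (1 + nu / 2) * s3 * T ^ 3 - nu / 2) in *.
  set (be := s1 - (s1 * s3 - s4) * T ^ 3) in *.
  set (ga := s2 - (s2 * s3 - s5) * T ^ 3) in *.
  assert (Hneg : al + be * T + ga * T ^ 2 < 0).
  { apply sum_three_cubes_neg.
    replace (al ^ 3 + (be * T) ^ 3 + (ga * T ^ 2) ^ 3 - 3 * al * (be * T) * (ga * T ^ 2))
      with (al ^ 3 + be ^ 3 * T ^ 3 + ga ^ 3 * (T ^ 3) ^ 2 - 3 * al * be * ga * T ^ 3) by ring.
    assumption. }
  set (th := s3 * T ^ 3) in *.
  exists ((s1 * T + s2 * T ^ 2 + s3 * T ^ 3 + s4 * T ^ 4 + s5 * T ^ 5 - th * (s1 * T + s2 * T ^ 2)) / (1 - th)).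
  split.
  { apply Rmult_lt_reg_r with (1 - th); [lra|].
    unfold Rdiv at 1; rewrite Rmult_assoc, Rinv_l, Rmult_1_r by lra.
    unfold al, be, ga in Hneg; unfold th; lra. }
  set (a := fun k => odd_rayleigh nu k * T ^ S k).
  assert (Ha : forall k, a (5 + k)%nat <= th * a (2 + k)%nat).
  { intros k; unfold a, th, odd_rayleigh.
    replace (2 * (5 + k) + 1)%nat with (2 * (2 + k) + 1 + 6)%nat by lia.
    pose proof (rayleigh_step6 nu (2 * (2 + k) + 1) Hnu) as H6; fold s3 in H6.
    replace (S (5 + k)) with (3 + S (2 + k))%nat by lia; rewrite pow_add.
    apply Rmult_le_compat_r with (r := T ^ 3 * T ^ S (2 + k)) in H6;
      [|apply Rmult_le_pos; apply Rlt_le, pow_lt; assumption].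
    eapply Rle_trans; [exact H6|]; apply Req_le; ring. }
  assert (Hpos : forall k, 0 < a k) by (intros; now apply odd_psum_term_pos).
  intros N.
  apply Rle_trans with (odd_psum nu T (5 + N)).
  { assert (M : forall m, odd_psum nu T N <= odd_psum nu T (m + N)); [|apply M].
    induction m as [|m IH]; [simpl; lra|].
    eapply Rle_trans; [exact IH|]; now apply odd_psum_incr. }
  apply Rmult_le_reg_r with (1 - th); [lra|].
  unfold Rdiv; rewrite (Rmult_assoc _ (/ (1 - th)) (1 - th)), Rinv_l, Rmult_1_r by lra.
  assert (E1 : odd_psum nu T (5 + N) = sum_f_R0 a 4 + sum_f_R0 (fun k => a (5 + k)%nat) N)
    by exact (sum_shift a 4 N).
  assert (E2 : sum_f_R0 a (2 + N) = sum_f_R0 a 1 + sum_f_R0 (fun k => a (2 + k)%nat) N)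
    by exact (sum_shift a 1 N).
  assert (E3 : sum_f_R0 (fun k => a (5 + k)%nat) N <= th * sum_f_R0 (fun k => a (2 + k)%nat) N).
  { rewrite scal_sum; apply sum_Rle; intros k _; rewrite Rmult_comm; apply Ha. }
  assert (E4 : sum_f_R0 a (2 + N) <= odd_psum nu T (5 + N)).
  { change (odd_psum nu T (2 + N) <= odd_psum nu T (5 + N)).
    replace (5 + N)%nat with (S (S (S (2 + N)))) by lia.
    pose proof (odd_psum_incr nu T (2 + N) Hn T0); pose proof (odd_psum_incr nu T (S (2 + N)) Hn T0);
      pose proof (odd_psum_incr nu T (S (S (2 + N))) Hn T0); lra. }
  assert (Hth0 : 0 < th) by (apply Rmult_lt_0_compat; [apply Hp | now apply pow_lt]).
  assert (E5 : sum_f_R0 a 4 = s1 * T + s2 * T ^ 2 + s3 * T ^ 3 + s4 * T ^ 4 + s5 * T ^ 5)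
    by (unfold a, odd_rayleigh; cbn [sum_f_R0 Nat.add Nat.mul]; fold s1 s2 s3 s4 s5; ring).
  assert (E6 : sum_f_R0 a 1 = s1 * T + s2 * T ^ 2)
    by (unfold a, odd_rayleigh; cbn [sum_f_R0 Nat.add Nat.mul]; fold s1 s2; ring).
  rewrite <- E5, <- E6.
  apply Rmult_le_compat_l with (r := th) in E4; [|lra].
  rewrite E2 in E4. nra.
Qed.

(** * Complex series and power series *)

(** Convergence by real and imaginary part, as in the definition of [CSeries]. *)
Definition is_cseries (u : nat -> C) (l : C) : Prop :=
  is_series (fun n => Re (u n)) (Re l) /\ is_series (fun n => Im (u n)) (Im l).

Lemma is_cseries_unique u l : is_cseries u l -> CSeries u = l.
Proof.
  intros [H1 H2]; unfold CSeries.
  rewrite (is_series_unique _ _ H1), (is_series_unique _ _ H2); now destruct l.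
Qed.

Lemma Im_le_Cmod z : Rabs (Im z) <= Cmod z.
Proof. eapply Rle_trans; [apply Rmax_r | apply Rmax_Cmod]. Qed.

Lemma CSeries_correct u : ex_series (fun n => Cmod (u n)) -> is_cseries u (CSeries u).
Proof.
  intros H; split; simpl; apply Series_correct;
    (apply (ex_series_le (K := R_AbsRing) (V := R_CompleteNormedModule)) with (2 := H); intros n);
    [apply re_le_Cmod | apply Im_le_Cmod].
Qed.

Lemma is_cseries_ext u v l : (forall n, u n = v n) -> is_cseries u l -> is_cseries v l.
Proof.
  intros E [H1 H2]; split;
    [apply is_series_ext with (2 := H1) | apply is_series_ext with (2 := H2)];
    intros n; now rewrite E.
Qed.

Lemma is_cseries_plus u v l m : is_cseries u l -> is_cseries v m ->
  is_cseries (fun n => u n + v n)%C (l + m)%C.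
Proof.
  intros [H1 H2] [H3 H4]; split;
    [exact (is_series_plus _ _ _ _ H1 H3) | exact (is_series_plus _ _ _ _ H2 H4)].
Qed.

Lemma is_cseries_scal (k : C) u l : is_cseries u l -> is_cseries (fun n => k * u n)%C (k * l)%C.
Proof.
  intros [H1 H2]; split; destruct k as [p q]; simpl.
  - exact (is_series_minus _ _ _ _ (is_series_scal_l p _ _ H1) (is_series_scal_l q _ _ H2)).
  - exact (is_series_plus _ _ _ _ (is_series_scal_l p _ _ H2) (is_series_scal_l q _ _ H1)).
Qed.

Lemma Re_mult_le z w : Re z * Re w + Im z * Im w <= Cmod z * Cmod w.
Proof.
  apply Rle_trans with (1 := Rle_abs _).
  apply Rsqr_incr_0_var; [|apply Rmult_le_pos; apply Cmod_ge_0].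
  rewrite <- Rsqr_abs; unfold Rsqr.
  replace (Cmod z * Cmod w * (Cmod z * Cmod w)) with (Cmod z ^ 2 * Cmod w ^ 2) by ring.
  rewrite !Cmod2_alt; pose proof (pow2_ge_0 (Re z * Im w - Im z * Re w)); nra.
Qed.

Lemma is_series_le (a b : nat -> R) (la lb : R) :
  (forall n, a n <= b n) -> is_series a la -> is_series b lb -> la <= lb.
Proof.
  intros H Ha Hb; apply (is_lim_seq_le (sum_n a) (sum_n b) la lb); auto.
  intros N; rewrite !sum_n_Reals; now apply sum_Rle.
Qed.

(** Projecting on the direction of [l] reduces this to a comparison of real series:
    [|l|^2 = sum_n Re (conj(l) u_n) <= |l| S]. *)
Lemma is_cseries_norm u l M S : is_cseries u l -> (forall n, Cmod (u n) <= M n) ->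
  is_series M S -> Cmod l <= S.
Proof.
  intros [H1 H2] HM HS.
  assert (H : Cmod l * Cmod l <= Cmod l * S).
  { replace (Cmod l * Cmod l) with (Re l * Re l + Im l * Im l)
      by (pose proof (Cmod2_alt l); simpl in H; lra).
    refine (is_series_le _ _ _ _ _ (is_series_plus _ _ _ _ (is_series_scal_l (Re l) _ _ H1)
              (is_series_scal_l (Im l) _ _ H2)) (is_series_scal_l (Cmod l) _ _ HS)).
    intros n; apply Rle_trans with (1 := Re_mult_le l (u n)).
    apply Rmult_le_compat_l; [apply Cmod_ge_0 | apply HM]. }
  destruct (Req_dec (Cmod l) 0) as [E|E].
  - rewrite E; apply (is_lim_seq_le (fun _ => 0) (sum_n M) 0 S).
    + intros N; rewrite sum_n_Reals; apply cond_pos_sum; intros n.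
      apply Rle_trans with (2 := HM n), Cmod_ge_0.
    + apply is_lim_seq_const.
    + exact HS.
  - pose proof (Cmod_ge_0 l); apply Rmult_le_reg_l with (Cmod l); lra.
Qed.

(** Only real coefficients occur, which gives access to the theory of [CV_radius]. *)
Definition cps (a : nat -> R) (z : C) : C := CSeries (fun n => RtoC (a n) * z ^ n)%C.

Lemma cps_term_norm a z n : Cmod (RtoC (a n) * z ^ n)%C = Rabs (a n * Cmod z ^ n).
Proof.
  rewrite Cmod_mult, Cmod_R, Cmod_pow, Rabs_mult; f_equal.
  symmetry; apply Rabs_pos_eq, pow_le, Cmod_ge_0.
Qed.

Lemma cps_abs a z : Rbar_lt (Cmod z) (CV_radius a) ->
  ex_series (fun n => Cmod (RtoC (a n) * z ^ n)%C).
Proof.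
  intros H; apply ex_series_ext with (fun n => Rabs (a n * Cmod z ^ n)).
  - intros n; now rewrite cps_term_norm.
  - apply CV_disk_inside; now rewrite Rabs_pos_eq by apply Cmod_ge_0.
Qed.

Lemma cps_correct a z : Rbar_lt (Cmod z) (CV_radius a) ->
  is_cseries (fun n => RtoC (a n) * z ^ n)%C (cps a z).
Proof. intros; now apply CSeries_correct, cps_abs. Qed.

Lemma cps_0 a : cps a 0 = RtoC (a O).
Proof.
  apply is_cseries_unique; split.
  - apply is_series_ext with (fun n => a n * 0 ^ n).
    + intros [|n]; simpl; ring.
    + pose proof (is_pseries_0 a) as H; apply is_pseries_R in H. exact H.
  - apply is_series_ext with (fun n => 0 * a n * 0 ^ n).
    + intros [|n]; simpl; ring.
    + pose proof (is_pseries_0 (fun n => 0 * a n)) as H; apply is_pseries_R in H.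
      simpl; rewrite Rmult_0_l in H; exact H.
Qed.

(** The terms of the complex Cauchy product, split into the four real Cauchy products of the
    components. *)
Lemma cps_conv_term (a b : nat -> R) z n :
  (RtoC (conv a b n) * z ^ n)%C =
  (sum_f_R0 (fun k => Re (RtoC (a k) * z ^ k)%C * Re (RtoC (b (n - k)%nat) * z ^ (n - k))%C) n
   - sum_f_R0 (fun k => Im (RtoC (a k) * z ^ k)%C * Im (RtoC (b (n - k)%nat) * z ^ (n - k))%C) n,
   sum_f_R0 (fun k => Re (RtoC (a k) * z ^ k)%C * Im (RtoC (b (n - k)%nat) * z ^ (n - k))%C) n
   + sum_f_R0 (fun k => Im (RtoC (a k) * z ^ k)%C * Re (RtoC (b (n - k)%nat) * z ^ (n - k))%C) n).
Proof.
  rewrite conv_sum, <- minus_sum, <- plus_sum.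
  assert (E : forall k, (k <= n)%nat -> (z ^ n = z ^ k * z ^ (n - k))%C).
  { intros k Hk; rewrite <- Cpow_add_r; f_equal; lia. }
  assert (T : forall k, (k <= n)%nat ->
    a k * b (n - k)%nat * Re (z ^ n)%C =
      Re (RtoC (a k) * z ^ k)%C * Re (RtoC (b (n - k)%nat) * z ^ (n - k))%C
      - Im (RtoC (a k) * z ^ k)%C * Im (RtoC (b (n - k)%nat) * z ^ (n - k))%C /\
    a k * b (n - k)%nat * Im (z ^ n)%C =
      Re (RtoC (a k) * z ^ k)%C * Im (RtoC (b (n - k)%nat) * z ^ (n - k))%C
      + Im (RtoC (a k) * z ^ k)%C * Re (RtoC (b (n - k)%nat) * z ^ (n - k))%C).
  { intros k Hk; rewrite (E k Hk); generalize (z ^ k)%C (z ^ (n - k))%C; intros [p q] [r s].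
    simpl; split; ring. }
  replace (RtoC (sum_f_R0 (fun k => (a k * b (n - k)%nat)%R) n) * z ^ n)%C
    with ((Re (z ^ n)%C * sum_f_R0 (fun k => a k * b (n - k)%nat) n)%R,
          (Im (z ^ n)%C * sum_f_R0 (fun k => a k * b (n - k)%nat) n)%R)
    by (generalize (z ^ n)%C; intros [p q]; unfold Cmult, RtoC; simpl; f_equal; ring).
  rewrite !scal_sum; f_equal; apply sum_eq; intros k Hk; destruct (T k Hk) as [T1 T2]; lra.
Qed.

Lemma cps_mult a b z :
  Rbar_lt (Cmod z) (CV_radius a) -> Rbar_lt (Cmod z) (CV_radius b) ->
  is_cseries (fun n => RtoC (conv a b n) * z ^ n)%C (cps a z * cps b z)%C.
Proof.
  intros Ha Hb.
  destruct (cps_correct a z Ha) as [A1 A2]; destruct (cps_correct b z Hb) as [B1 B2].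
  assert (ab : forall c, Rbar_lt (Cmod z) (CV_radius c) ->
    ex_series (fun n => Rabs (Re (RtoC (c n) * z ^ n)%C)) /\
    ex_series (fun n => Rabs (Im (RtoC (c n) * z ^ n)%C))).
  { intros c Hc; pose proof (cps_abs c z Hc) as H.
    split; (apply (ex_series_le (K := R_AbsRing) (V := R_CompleteNormedModule)) with (2 := H));
      intros n; refine (Rle_trans _ _ _ (Req_le _ _ (Rabs_Rabsolu _)) _);
      [apply re_le_Cmod | apply Im_le_Cmod]. }
  destruct (ab a Ha) as [A3 A4]; destruct (ab b Hb) as [B3 B4].
  pose proof (is_series_mult _ _ _ _ A1 B1 A3 B3) as P1.
  pose proof (is_series_mult _ _ _ _ A2 B2 A4 B4) as P2.
  pose proof (is_series_mult _ _ _ _ A1 B2 A3 B4) as P3.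
  pose proof (is_series_mult _ _ _ _ A2 B1 A4 B3) as P4.
  split.
  - refine (is_series_ext _ _ _ _ (is_series_minus _ _ _ _ P1 P2)).
    intros n; rewrite cps_conv_term; reflexivity.
  - refine (is_series_ext _ _ _ _ (is_series_plus _ _ _ _ P3 P4)).
    intros n; rewrite cps_conv_term; reflexivity.
Qed.

(** * Complex differentiation *)

Notation is_cderive f z l := (is_derive (K := C_AbsRing) (V := C_NormedModule) f z l).

Lemma is_cderive_eps (f : C -> C) (z l : C) :
  is_cderive f z l <->
  (forall e : posreal, exists d : posreal, forall w : C, Cmod (w - z) < d ->
     Cmod (f w - f z - (w - z) * l) <= e * Cmod (w - z)).
Proof.
  split.
  - intros [_ H] e.
    destruct (H z (fun P HP => HP) e) as [d Hd].
    exists d; intros w Hw; exact (Hd w Hw).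
  - intros H; split; [apply is_linear_scal_l|].
    intros y Hy.
    assert (Ey : z = y).
    { apply (is_filter_lim_locally_unique (K := C_AbsRing) (V := AbsRing_NormedModule C_AbsRing)); exact Hy. }
    subst y; intros e; destruct (H e) as [d Hd].
    exists d; intros w Hw; exact (Hd w Hw).
Qed.

(** The complex numbers carry two normed module structures over themselves, with convertible norms
    and different uniform structures; the product and chain rules are stated over the second one. *)
Lemma is_cderive_ring (f : C -> C) (z l : C) :
  is_cderive f z l <->
  is_derive (K := C_AbsRing) (V := AbsRing_NormedModule C_AbsRing) f z l.
Proof.
  split; intros [_ H]; (split; [apply is_linear_scal_l|]; exact H).
Qed.

Lemma is_cderive_quad (f : C -> C) (z l : C) (K d : R) : 0 < d ->
  (forall w, Cmod (w - z) < d -> Cmod (f w - f z - (w - z) * l) <= K * Cmod (w - z) ^ 2) ->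
  is_cderive f z l.
Proof.
  intros Hd H; apply is_cderive_eps; intros e.
  assert (HK : 0 < Rabs K + 1) by (pose proof (Rabs_pos K); lra).
  assert (H0 : 0 < Rmin d (e / (Rabs K + 1))).
  { apply Rmin_pos; [assumption|]. apply Rdiv_lt_0_compat; [apply cond_pos|assumption]. }
  exists (mkposreal _ H0); simpl; intros w Hw.
  assert (H1 : Cmod (w - z) < d) by (eapply Rlt_le_trans; [exact Hw | apply Rmin_l]).
  assert (H2 : Cmod (w - z) < e / (Rabs K + 1)) by (eapply Rlt_le_trans; [exact Hw | apply Rmin_r]).
  eapply Rle_trans; [now apply H|].
  pose proof (Cmod_ge_0 (w - z)) as H3; pose proof (Rle_abs K).
  simpl; rewrite Rmult_1_r, <- Rmult_assoc; apply Rmult_le_compat_r; [assumption|].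
  apply Rle_trans with ((Rabs K + 1) * Cmod (w - z)).
  - apply Rmult_le_compat_r; lra.
  - apply Rmult_lt_compat_l with (r := Rabs K + 1) in H2; [|assumption].
    replace ((Rabs K + 1) * (e / (Rabs K + 1))) with (pos e) in H2 by (field; lra). lra.
Qed.

Lemma is_cderive_mult (f g : C -> C) z df dg :
  is_cderive f z df -> is_cderive g z dg ->
  is_cderive (fun w => f w * g w)%C z (df * g z + f z * dg)%C.
Proof.
  intros Hf Hg; apply is_cderive_ring in Hf; apply is_cderive_ring in Hg.
  apply is_cderive_ring.
  exact (is_derive_mult (K := C_AbsRing) f g z df dg Hf Hg Cmult_comm).
Qed.

Lemma is_cderive_comp (f g : C -> C) z df dg :
  is_cderive f (g z) df -> is_cderive g z dg ->
  is_cderive (fun w => f (g w)) z (dg * df)%C.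
Proof.
  intros Hf Hg; apply is_cderive_ring in Hg.
  exact (is_derive_comp (K := C_AbsRing) (V := C_NormedModule) f g z df dg Hf Hg).
Qed.

Lemma is_cderive_plus (f g : C -> C) z df dg :
  is_cderive f z df -> is_cderive g z dg ->
  is_cderive (fun w => f w + g w)%C z (df + dg)%C.
Proof. exact (is_derive_plus (K := C_AbsRing) (V := C_NormedModule) f g z df dg). Qed.

Lemma is_cderive_id z : is_cderive (fun w => w) z (RtoC 1).
Proof. apply is_cderive_ring; exact (is_derive_id (K := C_AbsRing) z). Qed.

Lemma is_cderive_const (c z : C) : is_cderive (fun _ => c) z (RtoC 0).
Proof. exact (is_derive_const (K := C_AbsRing) (V := C_NormedModule) c z). Qed.

(** Induction through
    [w^(n+1) - z^(n+1) - (n+1) z^n (w-z) = w (w^n - z^n - n z^(n-1) (w-z)) + n z^(n-1) (w-z)^2]. *)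
Lemma pow_taylor_bound (z w : C) (r : R) n : Cmod z <= r -> Cmod w <= r ->
  Cmod (w ^ (S (S n)) - z ^ (S (S n)) - (w - z) * (RtoC (INR (S (S n))) * z ^ (S n)))%C
  <= INR (S (S n)) * INR (S n) * r ^ n * Cmod (w - z) ^ 2.
Proof.
  intros Hz Hw; pose proof (Cmod_ge_0 z) as Hz0.
  induction n as [|n IH].
  - replace (w ^ 2 - z ^ 2 - (w - z) * (RtoC (INR 2) * z ^ 1))%C with ((w - z) ^ 2)%C
      by (simpl; rewrite RtoC_plus; ring).
    rewrite Cmod_pow; simpl INR; pose proof (pow2_ge_0 (Cmod (w - z))); simpl (r ^ 0); lra.
  - replace (w ^ S (S (S n)) - z ^ S (S (S n)) - (w - z) * (RtoC (INR (S (S (S n)))) * z ^ S (S n)))%C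
      with (w * (w ^ S (S n) - z ^ S (S n) - (w - z) * (RtoC (INR (S (S n))) * z ^ S n))
            + RtoC (INR (S (S n))) * z ^ S n * (w - z) ^ 2)%C
      by (rewrite (S_INR (S (S n))), RtoC_plus; simpl; ring).
    eapply Rle_trans; [apply Cmod_triangle|].
    rewrite !Cmod_mult, !Cmod_pow, Cmod_R, Rabs_pos_eq by apply pos_INR.
    pose proof (pow2_ge_0 (Cmod (w - z))) as Hq; set (q := Cmod (w - z) ^ 2) in *.
    assert (H1 : Cmod z ^ S n <= r ^ S n) by (apply pow_incr; split; assumption).
    assert (Hr : 0 <= r) by lra.
    pose proof (pow_le r n Hr); pose proof (pow_le r (S n) Hr).
    pose proof (pos_INR n).
    apply Rle_trans with (r * (INR (S (S n)) * INR (S n) * r ^ n * q)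
                          + INR (S (S n)) * r ^ S n * q).
    + apply Rplus_le_compat.
      * apply Rmult_le_compat; [apply Cmod_ge_0 | apply Cmod_ge_0 | assumption | assumption].
      * apply Rmult_le_compat_r; [assumption|]. apply Rmult_le_compat_l; [apply pos_INR|assumption].
    + simpl (r ^ S n); rewrite !S_INR.
      assert (0 <= r * r ^ n * q * (INR n + 2)).
      { apply Rmult_le_pos; [apply Rmult_le_pos; [apply Rmult_le_pos|]|]; lra. }
      lra.
Qed.

Lemma CV_radius_abs a : CV_radius (fun n => Rabs (a n)) = CV_radius a.
Proof.
  unfold CV_radius, CV_disk; apply Lub_Rbar_eqset; intros x.
  split; apply ex_series_ext; intros n; rewrite !Rabs_mult, ?Rabs_Rabsolu; reflexivity.
Qed.

Lemma is_series_incr2 (a : nat -> R) (l : R) :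
  a O = 0 -> a 1%nat = 0 -> is_series (fun n => a (S (S n))) l -> is_series a l.
Proof.
  intros H0 H1 H.
  apply is_series_decr_1; simpl; rewrite H0.
  apply is_series_decr_1; simpl; rewrite H1.
  replace (plus _ _) with l; [exact H|].
  change (@eq R l (l + - 0 + - 0)); ring.
Qed.

(** Term by term the Taylor remainder is at most [n (n-1) |a_n| r^(n-2) |w - z|^2] on [|z|, |w| < r], and the
    sum of these bounds is the second derivative of the series of the [|a_n|] at [r]. *)
Lemma cps_derive a z : Rbar_lt (Cmod z) (CV_radius a) ->
  is_cderive (cps a) z (cps (PS_derive a) z).
Proof.
  intros Hz.
  assert (Hr : exists r, Cmod z < r /\ Rbar_lt r (CV_radius a)).
  { destruct (CV_radius a) as [R| |]; simpl in Hz; [|exists (Cmod z + 1); simpl; split; [lra|exact I]|easy].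
    exists ((Cmod z + R) / 2); simpl; lra. }
  destruct Hr as [r [Hzr Hr]].
  pose proof (Cmod_ge_0 z) as Hz0.
  set (a' := PS_derive (PS_derive (fun n => Rabs (a n)))).
  assert (Hs : ex_series (fun n => a' n * r ^ n)).
  { assert (E : Rbar_lt (Rabs r) (CV_radius a')).
    { unfold a'; rewrite !CV_radius_derive, CV_radius_abs, Rabs_pos_eq by lra; assumption. }
    pose proof (CV_radius_inside _ _ E) as [l Hl]; apply is_pseries_R in Hl.
    exists l; exact Hl. }
  destruct Hs as [K HK].
  apply (is_cderive_quad _ _ _ K (r - Cmod z)); [lra|].
  intros w Hw.
  assert (Hwr : Cmod w < r).
  { replace w with (w - z + z)%C by ring. eapply Rle_lt_trans; [apply Cmod_triangle|]. lra. }
  assert (Hwa : Rbar_lt (Cmod w) (CV_radius a)) by (apply Rbar_lt_trans with r; assumption).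
  pose proof (cps_correct a w Hwa) as S1; pose proof (cps_correct a z Hz) as S2.
  assert (Hz' : Rbar_lt (Cmod z) (CV_radius (PS_derive a))) by now rewrite CV_radius_derive.
  pose proof (cps_correct (PS_derive a) z Hz') as S3.
  (* the derived series as [sum_n n a_n z^(n-1)], aligned with the other two; at [n = 0] the factor [n] vanishes *)
  assert (S4 : is_cseries (fun n => RtoC (INR n * a n) * z ^ (pred n))%C (cps (PS_derive a) z)).
  { destruct S3 as [T1 T2]; split.
    - apply is_series_decr_1; simpl.
      replace (plus _ _) with (Re (cps (PS_derive a) z))
        by (match goal with |- ?x = _ => change (@eq R x (x + - (0 * a O * 1 - 0 * 0))) end; ring).
      apply is_series_ext with (2 := T1); intros n; unfold PS_derive; simpl; ring.
    - apply is_series_decr_1; simpl.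
      replace (plus _ _) with (Im (cps (PS_derive a) z))
        by (match goal with |- ?x = _ => change (@eq R x (x + - (0 * a O * 0 + 0 * 1))) end; ring).
      apply is_series_ext with (2 := T2); intros n; unfold PS_derive; simpl; ring. }
  pose proof (is_cseries_plus _ _ _ _ (is_cseries_plus _ _ _ _ S1
    (is_cseries_scal (- RtoC 1)%C _ _ S2)) (is_cseries_scal (- (w - z))%C _ _ S4)) as S5.
  replace (cps a w - cps a z - (w - z) * cps (PS_derive a) z)%C
    with (cps a w + - RtoC 1 * cps a z + - (w - z) * cps (PS_derive a) z)%C
    by ring.
  set (M := fun n => match n with S (S m) => a' m * r ^ m * Cmod (w - z) ^ 2 | _ => 0 end).
  apply (is_cseries_norm _ _ M _ S5).
  - intros n; replace (RtoC (a n) * w ^ n + - RtoC 1 * (RtoC (a n) * z ^ n)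
             + - (w - z) * (RtoC (INR n * a n) * z ^ pred n))%C
      with (RtoC (a n) * (w ^ n - z ^ n - (w - z) * (RtoC (INR n) * z ^ pred n)))%C
      by (rewrite RtoC_mult; ring).
    rewrite Cmod_mult, Cmod_R.
    destruct n as [|[|n]].
    + simpl; replace (1 - 1 - (w - z) * (RtoC 0 * 1))%C with (RtoC 0) by ring.
      rewrite Cmod_0; lra.
    + simpl; replace (w * 1 - z * 1 - (w - z) * (RtoC 1 * 1))%C with (RtoC 0) by ring.
      rewrite Cmod_0; lra.
    + change (pred (S (S n))) with (S n); unfold M.
      apply Rle_trans with (Rabs (a (S (S n))) *
         (INR (S (S n)) * INR (S n) * r ^ n * Cmod (w - z) ^ 2)).
      * apply Rmult_le_compat_l; [apply Rabs_pos|]. apply pow_taylor_bound; lra.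
      * unfold a', PS_derive; apply Req_le; ring.
  - apply is_series_incr2; [reflexivity|reflexivity|].
    unfold M.
    refine (is_series_ext _ _ _ _ (is_series_scal_r (Cmod (w - z) ^ 2) _ _ HK)).
    reflexivity.
Qed.

(** * The complex exponential *)

Lemma Cexp_plus z w : Cexp (z + w)%C = (Cexp z * Cexp w)%C.
Proof.
  destruct z as [p q], w as [r s]; unfold Cexp, Cmult; simpl.
  rewrite exp_plus, cos_plus, sin_plus; f_equal; ring.
Qed.

Lemma Cexp_0 : Cexp 0 = RtoC 1.
Proof. unfold Cexp, RtoC; simpl; rewrite exp_0, cos_0, sin_0; f_equal; ring. Qed.

Lemma Cmod_Cexp z : Cmod (Cexp z) = exp (Re z).
Proof.
  unfold Cmod, Cexp; simpl.
  replace (exp (Re z) * cos (Im z) * (exp (Re z) * cos (Im z) * 1) +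
           exp (Re z) * sin (Im z) * (exp (Re z) * sin (Im z) * 1))
    with (exp (Re z) ^ 2 * (Rsqr (sin (Im z)) + Rsqr (cos (Im z)))) by (unfold Rsqr; ring).
  rewrite sin2_cos2, Rmult_1_r; apply sqrt_pow2, Rlt_le, exp_pos.
Qed.

Lemma Cexp_neq_0 z : Cexp z <> 0.
Proof.
  intros H; pose proof (Cmod_Cexp z) as E; rewrite H, Cmod_0 in E.
  pose proof (exp_pos (Re z)); lra.
Qed.

Lemma Rabs_sin_le x : Rabs (sin x) <= Rabs x.
Proof.
  replace (sin x) with (sin x - sin 0) by (rewrite sin_0; ring).
  replace (Rabs x) with (1 * Rabs (x - 0)) by (rewrite Rminus_0_r; ring).
  apply (bounded_variation sin cos); intros t _; split; [apply is_derive_sin|].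
  apply Rabs_le; pose proof (COS_bound t); lra.
Qed.

Lemma cos_quadratic x : Rabs (cos x - 1) <= x ^ 2 / 2.
Proof.
  replace (cos x) with (1 - 2 * sin (x / 2) ^ 2).
  2:{ replace x with (2 * (x / 2)) at 2 by field. rewrite cos_2a_sin; ring. }
  pose proof (Rabs_sin_le (x / 2)) as H.
  apply Rsqr_le_abs_1 in H; unfold Rsqr in H.
  replace (1 - 2 * sin (x / 2) ^ 2 - 1) with (- (2 * sin (x / 2) ^ 2)) by ring.
  rewrite Rabs_Ropp, Rabs_pos_eq by (pose proof (pow2_ge_0 (sin (x / 2))); lra). lra.
Qed.

Lemma sin_quadratic x : Rabs x <= 1 -> Rabs (sin x - x) <= x ^ 2.
Proof.
  intros Hx.
  replace (sin x - x) with ((sin x - x) - (sin 0 - 0)) by (rewrite sin_0; ring).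
  replace (x ^ 2) with (Rabs x * Rabs (x - 0)).
  2:{ rewrite Rminus_0_r; simpl; rewrite Rmult_1_r, <- Rabs_mult; apply Rabs_pos_eq, Rle_0_sqr. }
  apply (bounded_variation (fun t => sin t - t) (fun t => cos t - 1)).
  intros t Ht; rewrite !Rminus_0_r in Ht; split.
  - apply (is_derive_minus sin (fun t => t)); [apply is_derive_sin | apply (is_derive_id (K := R_AbsRing))].
  - eapply Rle_trans; [apply cos_quadratic|].
    assert (t ^ 2 <= Rabs x).
    { replace (t ^ 2) with (Rabs t * Rabs t)
        by (rewrite <- Rabs_mult; simpl; rewrite Rmult_1_r; apply Rabs_pos_eq, Rle_0_sqr).
      apply Rle_trans with (Rabs x * 1); [|lra].
      apply Rmult_le_compat; try apply Rabs_pos; lra. }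
    pose proof (Rabs_pos x); lra.
Qed.

Lemma exp_quadratic x : Rabs x <= / 2 -> Rabs (exp x - 1 - x) <= 2 * x ^ 2.
Proof.
  intros Hx; apply Rabs_le_between in Hx.
  assert (H1 : 1 + x <= exp x).
  { destruct (Req_dec x 0) as [->|E]; [rewrite exp_0; lra | apply Rlt_le; now apply exp_ineq1]. }
  assert (H2 : 1 - x <= exp (- x)).
  { destruct (Req_dec x 0) as [->|E]; [rewrite Ropp_0, exp_0; lra|].
    apply Rlt_le; pose proof (exp_ineq1 (- x)); lra. }
  assert (H3 : exp x * (1 - x) <= 1).
  { replace 1 with (exp x * exp (- x)) at 2 by (rewrite <- exp_plus, Rplus_opp_r, exp_0; ring).
    apply Rmult_le_compat_l; [apply Rlt_le, exp_pos | assumption]. }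
  rewrite Rabs_pos_eq by lra.
  apply Rmult_le_reg_r with (1 - x); [lra|].
  pose proof (pow2_ge_0 x). nra.
Qed.

(** From the quadratic estimates of [exp], [cos] and [sin]; the constant is generous. *)
Lemma Cexp_quadratic w : Cmod w < / 2 -> Cmod (Cexp w - 1 - w)%C <= 16 * Cmod w ^ 2.
Proof.
  intros Hw; rewrite Cmod2_alt; destruct w as [p q]; simpl (Re _); simpl (Im _).
  pose proof (re_le_Cmod (p, q)) as Hp; pose proof (Im_le_Cmod (p, q)) as Hq; simpl in Hp, Hq.
  assert (Hp' : Rabs p <= / 2) by lra. assert (Hq' : Rabs q <= 1) by lra.
  pose proof (exp_quadratic p Hp') as E; pose proof (sin_quadratic q Hq') as S;
    pose proof (cos_quadratic q) as K; pose proof (Rabs_sin_le q) as S'.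
  pose proof (COS_bound q) as Kb.
  pose proof (pow2_ge_0 p) as P2; pose proof (pow2_ge_0 q) as Q2.
  eapply Rle_trans; [apply Cmod_2Rmax|].
  assert (HRe : Rabs (Re (Cexp (p, q) - 1 - (p, q))%C) <= 2 * p ^ 2 + 2 * q ^ 2).
  { simpl. replace (exp p * cos q + - (1) + - p) with ((exp p - 1 - p) * cos q + (1 + p) * (cos q - 1)) by ring.
    eapply Rle_trans; [apply Rabs_triang|]; rewrite !Rabs_mult.
    assert (Rabs (cos q) <= 1) by (apply Rabs_le; lra).
    assert (Rabs (1 + p) <= 2) by (apply Rabs_le; apply Rabs_le_between in Hp'; lra).
    apply Rplus_le_compat.
    - apply Rle_trans with (2 * p ^ 2 * 1); [|lra]. apply Rmult_le_compat; try apply Rabs_pos; lra.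
    - apply Rle_trans with (2 * (q ^ 2 / 2)); [|lra]. apply Rmult_le_compat; try apply Rabs_pos; lra. }
  assert (HIm : Rabs (Im (Cexp (p, q) - 1 - (p, q))%C) <= 4 * p ^ 2 + 4 * q ^ 2).
  { simpl. replace (exp p * sin q + - 0 + - q) with ((exp p - 1 - p) * sin q + p * sin q + (sin q - q)) by ring.
    eapply Rle_trans; [apply Rabs_triang|].
    assert (Rabs (sin q) <= 1) by lra.
    assert (Rabs ((exp p - 1 - p) * sin q) <= 2 * p ^ 2 * 1)
      by (rewrite Rabs_mult; apply Rmult_le_compat; try apply Rabs_pos; lra).
    assert (Rabs (p * sin q) <= p ^ 2 + q ^ 2).
    { rewrite Rabs_mult; apply Rle_trans with (Rabs p * Rabs q);
        [apply Rmult_le_compat_l; [apply Rabs_pos|lra]|].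
      rewrite <- (pow2_abs p), <- (pow2_abs q). pose proof (pow2_ge_0 (Rabs p - Rabs q)).
      pose proof (pow2_ge_0 (Rabs p + Rabs q)). nra. }
    pose proof (Rabs_triang ((exp p - 1 - p) * sin q) (p * sin q)). lra. }
  assert (Hs : sqrt 2 <= 2).
  { rewrite <- (sqrt_Rsqr 2) at 2 by lra. apply sqrt_le_1_alt; unfold Rsqr; lra. }
  apply Rle_trans with (2 * (4 * p ^ 2 + 4 * q ^ 2)); [|lra].
  apply Rmult_le_compat; [apply sqrt_pos | | assumption |].
  - eapply Rle_trans; [apply Rabs_pos | apply Rmax_l].
  - apply Rmax_lub; [eapply Rle_trans; [exact HRe|]; lra | exact HIm].
Qed.

Lemma is_cderive_Cexp z : is_cderive Cexp z (Cexp z).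
Proof.
  apply (is_cderive_quad _ _ _ (16 * Cmod (Cexp z)) (/ 2)); [lra|].
  intros w Hw.
  replace (Cexp w - Cexp z - (w - z) * Cexp z)%C with (Cexp z * (Cexp (w - z) - 1 - (w - z)))%C.
  2:{ replace (Cexp w) with (Cexp z * Cexp (w - z))%C by (rewrite <- Cexp_plus; f_equal; ring). ring. }
  rewrite Cmod_mult.
  replace (16 * Cmod (Cexp z) * Cmod (w - z) ^ 2) with (Cmod (Cexp z) * (16 * Cmod (w - z) ^ 2)) by ring.
  apply Rmult_le_compat_l; [apply Cmod_ge_0 | now apply Cexp_quadratic].
Qed.

(** * Restriction to rays *)

(** Stated for a real linear functional [pr] of norm at most one, to be used for the real and for the
    imaginary part. *)
Lemma is_cderive_ray (F : C -> C) (y l : C) (t : R) (pr : C -> R) :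
  (forall z, Rabs (pr z) <= Cmod z) ->
  (forall z w, pr (z - w)%C = pr z - pr w) -> (forall (h : R) z, pr (RtoC h * z)%C = h * pr z) ->
  is_cderive F (RtoC t * y)%C l ->
  is_derive (fun s => pr (F (RtoC s * y)%C)) t (pr (y * l)%C).
Proof.
  intros Hn Hm Hs HF; apply is_derive_Reals; intros e He.
  assert (Hy : 0 < Cmod y + 1) by (pose proof (Cmod_ge_0 y); lra).
  assert (He' : 0 < e / (2 * (Cmod y + 1))) by (apply Rdiv_lt_0_compat; lra).
  destruct (proj1 (is_cderive_eps _ _ _) HF (mkposreal _ He')) as [d Hd]; simpl in Hd.
  assert (Hd' : 0 < d / (Cmod y + 1)) by (apply Rdiv_lt_0_compat; [apply cond_pos | lra]).
  exists (mkposreal _ Hd'); intros h Hh0 Hh; simpl in Hh.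
  assert (E : (RtoC (t + h) * y - RtoC t * y)%C = (RtoC h * y)%C) by (rewrite RtoC_plus; ring).
  assert (Hh1 : Rabs h * Cmod y <= Rabs h * (Cmod y + 1))
    by (apply Rmult_le_compat_l; [apply Rabs_pos | lra]).
  specialize (Hd (RtoC (t + h) * y)%C); rewrite E, Cmod_mult, Cmod_R in Hd.
  assert (Hh2 : Rabs h * (Cmod y + 1) < d).
  { apply Rmult_lt_compat_r with (r := Cmod y + 1) in Hh; [|assumption].
    replace (d / (Cmod y + 1) * (Cmod y + 1)) with (pos d) in Hh by (field; lra). assumption. }
  specialize (Hd ltac:(lra)).
  pose proof (Rle_trans _ _ _ (Hn _) Hd) as H.
  rewrite !Hm in H; replace (RtoC h * y * l)%C with (RtoC h * (y * l))%C in H by ring.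
  rewrite Hs in H.
  replace ((pr (F (RtoC (t + h) * y)%C) - pr (F (RtoC t * y)%C)) / h - pr (y * l)%C)
    with ((pr (F (RtoC (t + h) * y)%C) - pr (F (RtoC t * y)%C) - h * pr (y * l)%C) / h)
    by (field; assumption).
  unfold Rdiv; rewrite Rabs_mult, Rabs_inv.
  assert (Hh3 : 0 < Rabs h) by now apply Rabs_pos_lt.
  apply Rmult_lt_reg_r with (Rabs h); [assumption|].
  rewrite Rmult_assoc, Rinv_l, Rmult_1_r by lra.
  eapply Rle_lt_trans; [exact H|].
  apply Rle_lt_trans with (e / (2 * (Cmod y + 1)) * (Rabs h * (Cmod y + 1))).
  - apply Rmult_le_compat_l; lra.
  - replace (e / (2 * (Cmod y + 1)) * (Rabs h * (Cmod y + 1))) with (e * Rabs h / 2) by (field; lra).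
    assert (0 < e * Rabs h) by (apply Rmult_lt_0_compat; lra). lra.
Qed.

Lemma is_cderive_ray_Re F y l t : is_cderive F (RtoC t * y)%C l ->
  is_derive (fun s => Re (F (RtoC s * y)%C)) t (Re (y * l)%C).
Proof.
  apply is_cderive_ray; [apply re_le_Cmod | |].
  - intros [a b] [c d]; reflexivity.
  - intros h [a b]; simpl; ring.
Qed.

Lemma is_cderive_ray_Im F y l t : is_cderive F (RtoC t * y)%C l ->
  is_derive (fun s => Im (F (RtoC s * y)%C)) t (Im (y * l)%C).
Proof.
  apply is_cderive_ray; [apply Im_le_Cmod | |].
  - intros [a b] [c d]; reflexivity.
  - intros h [a b]; simpl; ring.
Qed.

Lemma cderive_0_const (F : C -> C) (y : C) :
  (forall z, Cmod z <= Cmod y -> is_cderive F z (RtoC 0)) -> F y = F (RtoC 0).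
Proof.
  intros H.
  assert (R : forall t, 0 <= t <= 1 -> is_cderive F (RtoC t * y)%C (RtoC 0)).
  { intros t Ht; apply H; rewrite Cmod_mult, Cmod_R, Rabs_pos_eq by lra.
    pose proof (Cmod_ge_0 y); nra. }
  assert (E1 : Re (F (RtoC 0 * y)%C) = Re (F (RtoC 1 * y)%C)).
  { apply (eq_is_derive (fun s => Re (F (RtoC s * y)%C)) 0 1); [|lra].
    intros t Ht; pose proof (is_cderive_ray_Re F y _ t (R t Ht)) as G.
    replace (Re (y * RtoC 0)%C) with 0 in G by (simpl; ring); exact G. }
  assert (E2 : Im (F (RtoC 0 * y)%C) = Im (F (RtoC 1 * y)%C)).
  { apply (eq_is_derive (fun s => Im (F (RtoC s * y)%C)) 0 1); [|lra].
    intros t Ht; pose proof (is_cderive_ray_Im F y _ t (R t Ht)) as G.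
    replace (Im (y * RtoC 0)%C) with 0 in G by (simpl; ring); exact G. }
  replace (RtoC 1 * y)%C with y in E1, E2 by ring.
  replace (RtoC 0 * y)%C with (RtoC 0) in E1, E2 by ring.
  destruct (F y), (F (RtoC 0)); simpl in *; congruence.
Qed.

(** The derivative of [|f|^2] along the real axis is [2 |f|^2 Re (f'/f)]. *)
Lemma Re_log_derivative_modulus (f g : C -> C) (lf lg : C) (x d : R) :
  0 < d -> is_cderive f (RtoC x) lf -> is_cderive g (RtoC x) lg ->
  (forall s, Rabs (s - x) < d -> Cmod (f (RtoC s)) = Cmod (g (RtoC s))) ->
  f (RtoC x) <> 0 -> g (RtoC x) <> 0 ->
  Re (lf / f (RtoC x))%C = Re (lg / g (RtoC x))%C.
Proof.
  intros Hd Hf Hg Hmod Hf0 Hg0.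
  assert (D : forall (k : C -> C) l, is_cderive k (RtoC x) l -> k (RtoC x) <> 0 ->
    is_derive (fun s => Cmod (k (RtoC s)) ^ 2) x
      (2 * Cmod (k (RtoC x)) ^ 2 * Re (l / k (RtoC x))%C)).
  { intros k l Hk Hk0.
    assert (E : (RtoC x * RtoC 1)%C = RtoC x) by ring.
    pose proof (is_cderive_ray_Re k (RtoC 1) l x ltac:(rewrite E; exact Hk)) as G1.
    pose proof (is_cderive_ray_Im k (RtoC 1) l x ltac:(rewrite E; exact Hk)) as G2.
    apply is_derive_ext with (fun s => Re (k (RtoC s * RtoC 1)%C) ^ 2 + Im (k (RtoC s * RtoC 1)%C) ^ 2).
    { intros s; rewrite Cmod2_alt; replace (RtoC s * RtoC 1)%C with (RtoC s) by ring; reflexivity. }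
    pose proof (is_derive_plus _ _ _ _ _ (is_derive_pow _ 2 _ _ G1) (is_derive_pow _ 2 _ _ G2)) as G.
    replace (2 * Cmod (k (RtoC x)) ^ 2 * Re (l / k (RtoC x))%C) with
      (plus (INR 2 * Re (RtoC 1 * l)%C * Re (k (RtoC x * RtoC 1)%C) ^ pred 2)
            (INR 2 * Im (RtoC 1 * l)%C * Im (k (RtoC x * RtoC 1)%C) ^ pred 2)); [exact G|].
    rewrite E, Cmod2_alt; clear -Hk0. revert Hk0; generalize (k (RtoC x)); intros [p q] H; destruct l as [a b].
    unfold plus; simpl.
    assert (H' : p ^ 2 + q ^ 2 <> 0).
    { intros H'; apply H; assert (p = 0) by nra; assert (q = 0) by nra; subst; reflexivity. }
    simpl in H'; field. rewrite <- !Rmult_assoc, ?Rmult_1_r in *; lra. }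
  pose proof (D f lf Hf Hf0) as D1; pose proof (D g lg Hg Hg0) as D2.
  assert (D3 : is_derive (fun s => Cmod (f (RtoC s)) ^ 2) x
      (2 * Cmod (g (RtoC x)) ^ 2 * Re (lg / g (RtoC x))%C)).
  { apply is_derive_ext_loc with (2 := D2).
    exists (mkposreal d Hd); intros s Hs; rewrite Hmod; [reflexivity | exact Hs]. }
  pose proof (is_derive_unique _ _ _ D1) as U1; rewrite (is_derive_unique _ _ _ D3) in U1.
  rewrite (Hmod x) in U1 by (rewrite Rminus_diag, Rabs_R0; assumption).
  assert (Cmod (g (RtoC x)) <> 0) by (intros E; apply Hg0, Cmod_eq_0, E).
  apply Rmult_eq_reg_l with (2 * Cmod (g (RtoC x)) ^ 2); [lra|].
  apply Rmult_integral_contrapositive; split; [lra | now apply pow_nonzero].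
Qed.

(** * The Gamma integral *)

(** The integral is the supremum of the integrals over compact intervals. *)
Lemma is_RInt_gen_nonneg (f : R -> R) (B : R) :
  (forall x, 0 < x -> 0 <= f x) -> (forall x, 0 < x -> continuous f x) ->
  (forall x y, 0 < x < y -> RInt f x y <= B) ->
  exists l, is_RInt_gen f (at_right 0) (Rbar_locally p_infty) l /\
    forall x y, 0 < x < y -> RInt f x y <= l.
Proof.
  intros Hpos Hc HB.
  assert (Hex : forall x y, 0 < x -> 0 < y -> ex_RInt f x y).
  { intros x y Hx Hy; apply (ex_RInt_continuous (V := R_CompleteNormedModule)); intros z Hz; apply Hc.
    apply Rlt_le_trans with (2 := proj1 Hz); now apply Rmin_glb_lt. }
  set (S := fun v => exists x y, 0 < x < y /\ v = RInt f x y).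
  destruct (completeness S) as [l [Hub Hlub]].
  - exists B; intros v [x [y [Hxy ->]]]; now apply HB.
  - exists (RInt f 1 2), 1, 2; split; [lra|reflexivity].
  - exists l.
    assert (Hl : forall x y, 0 < x < y -> RInt f x y <= l)
      by (intros x y Hxy; apply Hub; exists x, y; auto).
    split; [|assumption].
    apply filterlimi_locally; intros e.
    assert (H : exists x y, 0 < x < y /\ l - e < RInt f x y).
    { apply Classical_Prop.NNPP; intros Hno.
      assert (l <= l - e); [|pose proof (cond_pos e); lra].
      apply Hlub; intros v [x [y [Hxy ->]]]; apply Rnot_lt_le; intros Hlt.
      apply Hno; now exists x, y. }
    destruct H as [x0 [y0 [Hxy0 H0]]].
    apply (Filter_prod _ _ _ (fun x => 0 < x < x0) (fun y => y0 < y)).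
    + exists (mkposreal x0 (proj1 Hxy0)); intros x Hx Hx0; split; [assumption|].
      assert (Hx' : Rabs (x - 0) < x0) by exact Hx.
      rewrite Rminus_0_r in Hx'; apply Rabs_def2 in Hx'; lra.
    + exists y0; auto.
    + intros x y Hx Hy; exists (RInt f x y); split.
      * apply (RInt_correct (V := R_CompleteNormedModule)), Hex; simpl; lra.
      * assert (E : RInt f x y = RInt f x x0 + RInt f x0 y0 + RInt f y0 y).
        { rewrite <- (RInt_Chasles f x y0 y), <- (RInt_Chasles f x x0 y0)
            by (apply Hex; lra). reflexivity. }
        assert (0 <= RInt f x x0) by (apply RInt_ge_0; [lra | apply Hex; lra | intros; apply Hpos; lra]).
        assert (0 <= RInt f y0 y) by (apply RInt_ge_0; [lra | apply Hex; lra | intros; apply Hpos; lra]).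
        pose proof (Hl x y ltac:(lra)).
        change (Rabs (RInt f x y - l) < e); apply Rabs_def1; pose proof (cond_pos e); lra.
Qed.

Lemma gamma_kernel_derive a x : 0 < x ->
  is_derive (fun t => Rpower t a * exp (- t)) x
    (a * (Rpower x (a - 1) * exp (- x)) - Rpower x a * exp (- x)).
Proof.
  intros Hx; unfold Rpower; auto_derive; [assumption|].
  replace ((a - 1) * ln x) with (a * ln x + - ln x) by ring.
  rewrite exp_plus, (exp_Ropp (ln x)), exp_ln by assumption; field; lra.
Qed.

Lemma gamma_kernel_continuous a x : 0 < x ->
  continuous (fun t => Rpower t a * exp (- t)) x.
Proof.
  intros Hx; apply (ex_derive_continuous (K := R_AbsRing) (V := R_NormedModule)).
  eexists; now apply gamma_kernel_derive.
Qed.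

(** The inequality [ln v <= v - 1] at [v = x / (2a)]. *)
Lemma gamma_kernel_bound a x : 0 < a -> 0 < x ->
  Rpower x a * exp (- x) <= exp (a * (ln (2 * a) - 1)) * exp (- (x / 2)).
Proof.
  intros Ha Hx; unfold Rpower; rewrite <- !exp_plus.
  assert (H : ln x <= x / (2 * a) - 1 + ln (2 * a)).
  { replace (ln x) with (ln (x / (2 * a)) + ln (2 * a)).
    2:{ rewrite <- ln_mult by (try apply Rdiv_lt_0_compat; lra). f_equal; field; lra. }
    set (y := x / (2 * a)). assert (Hy : 0 < y) by (apply Rdiv_lt_0_compat; lra).
    assert (ln y <= y - 1); [|lra].
    destruct (Req_dec (ln y) 0) as [E|E].
    - rewrite E; rewrite <- (exp_ln y Hy), E, exp_0; lra.
    - pose proof (exp_ineq1 (ln y) E) as G; rewrite exp_ln in G by assumption; lra. }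
  apply Rmult_le_compat_l with (r := a) in H; [|lra].
  replace (a * (x / (2 * a) - 1 + ln (2 * a))) with (x / 2 + a * (ln (2 * a) - 1)) in H by (field; lra).
  assert (Hle : a * ln x + - x <= a * (ln (2 * a) - 1) + - (x / 2)) by lra.
  destruct Hle as [Hle|Hle]; [apply Rlt_le; now apply exp_increasing | rewrite Hle; lra].
Qed.

Lemma Gamma_correct a : 1 < a ->
  is_RInt_gen (fun t => Rpower t (a - 1) * exp (- t)) (at_right 0) (Rbar_locally p_infty) (Gamma a)
  /\ 0 < Gamma a.
Proof.
  intros Ha; set (f := fun t => Rpower t (a - 1) * exp (- t)).
  set (K := exp ((a - 1) * (ln (2 * (a - 1)) - 1))).
  assert (HK : 0 < K) by apply exp_pos.
  assert (Hpos : forall x, 0 < f x) by (intros; apply Rmult_lt_0_compat; apply exp_pos).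
  destruct (is_RInt_gen_nonneg f (2 * K)) as [l [Hl Hle]].
  - intros; now apply Rlt_le.
  - intros; now apply gamma_kernel_continuous.
  - intros x y Hxy.
    assert (HI : is_RInt (fun t => K * exp (- (t / 2))) x y (-2 * K * exp (- (y / 2)) - -2 * K * exp (- (x / 2)))).
    { apply (is_RInt_derive (fun t => -2 * K * exp (- (t / 2)))).
      - intros t _; auto_derive; [trivial|]; change (t * / 2) with (t / 2); field.
      - intros t _; apply (ex_derive_continuous (K := R_AbsRing) (V := R_NormedModule)); auto_derive; trivial. }
    apply Rle_trans with (RInt (fun t => K * exp (- (t / 2))) x y).
    + apply RInt_le; [lra | | eexists; exact HI |].
      * apply (ex_RInt_continuous (V := R_CompleteNormedModule)); intros z Hz; apply gamma_kernel_continuous.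
        rewrite Rmin_left in Hz by lra; lra.
      * intros z Hz; apply gamma_kernel_bound; lra.
    + rewrite (is_RInt_unique _ _ _ _ HI).
      assert (exp (- (x / 2)) < 1) by (rewrite <- exp_0; apply exp_increasing; lra).
      pose proof (exp_pos (- (y / 2))). nra.
  - assert (E : Gamma a = l)
      by exact (is_RInt_gen_unique (V := R_CompleteNormedModule) (Fa := at_right 0)
                  (Fb := Rbar_locally p_infty) f l Hl).
    rewrite E; split; [exact Hl|].
    apply Rlt_le_trans with (RInt f 1 2); [|apply Hle; lra].
    apply RInt_gt_0; [lra | intros; apply Hpos | intros; apply gamma_kernel_continuous; lra].
Qed.

(** The function [t^a exp(-t)] vanishes at both ends, so its derivative has integral zero. *)
Lemma Gamma_succ a : 1 < a -> Gamma (a + 1) = a * Gamma a.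
Proof.
  intros Ha.
  destruct (Gamma_correct a Ha) as [H1 _]; destruct (Gamma_correct (a + 1) ltac:(lra)) as [H2 _].
  replace (a + 1 - 1) with a in H2 by ring.
  pose proof (is_RInt_gen_minus _ _ _ _ (is_RInt_gen_scal _ a _ H1) H2) as H3.
  set (f := fun t => Rpower t a * exp (- t)) in *.
  assert (Hev : filter_prod (at_right 0) (Rbar_locally p_infty)
            (fun ab : R * R => 0 < fst ab /\ 0 < snd ab)).
  { apply (Filter_prod _ _ _ (fun x => 0 < x) (fun y => 0 < y)); [ | exists 0; auto | auto].
    exists (mkposreal 1 Rlt_0_1); auto. }
  assert (HD : forall x, 0 < x -> Derive f x = a * (Rpower x (a - 1) * exp (- x)) - Rpower x a * exp (- x))
    by (intros; apply is_derive_unique; now apply gamma_kernel_derive).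
  assert (H4 : is_RInt_gen (Derive f) (at_right 0) (Rbar_locally p_infty) (0 - 0)).
  { apply is_RInt_gen_Derive.
    - apply filter_imp with (2 := Hev); intros [p q] [Hp Hq] x Hx; simpl in *.
      eexists; apply gamma_kernel_derive.
      apply Rlt_le_trans with (2 := proj1 Hx); now apply Rmin_glb_lt.
    - apply filter_imp with (2 := Hev); intros [p q] [Hp Hq] x Hx; simpl in *.
      assert (Hx0 : 0 < x) by (apply Rlt_le_trans with (2 := proj1 Hx); now apply Rmin_glb_lt).
      apply continuous_ext_loc with
        (fun x => a * (Rpower x (a - 1) * exp (- x)) - Rpower x a * exp (- x)).
      + exists (mkposreal x Hx0); intros y Hy; symmetry; apply HD.
        assert (Hy' : Rabs (y - x) < x) by exact Hy. apply Rabs_def2 in Hy'; lra.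
      + apply (continuous_minus (V := R_NormedModule)).
        * apply (continuous_scal_r (V := R_NormedModule) a); now apply gamma_kernel_continuous.
        * now apply gamma_kernel_continuous.
    - apply filterlim_locally; intros e.
      assert (He : 0 < Rmin 1 e) by (apply Rmin_pos; [lra | apply cond_pos]).
      exists (mkposreal _ He); intros x Hx Hx0.
      assert (Hx' : Rabs (x - 0) < Rmin 1 e) by exact Hx.
      rewrite Rminus_0_r, Rabs_pos_eq in Hx' by lra.
      assert (x < 1) by (eapply Rlt_le_trans; [exact Hx' | apply Rmin_l]).
      assert (x < e) by (eapply Rlt_le_trans; [exact Hx' | apply Rmin_r]).
      assert (Hf0 : 0 < f x) by (apply Rmult_lt_0_compat; apply exp_pos).
      change (Rabs (f x - 0) < e); rewrite Rminus_0_r, Rabs_pos_eq by lra.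
      apply Rle_lt_trans with (x * 1); [|lra]; unfold f; apply Rmult_le_compat;
        try (apply Rlt_le, exp_pos).
      + rewrite <- (Rpower_1 x) at 2 by assumption; unfold Rpower.
        assert (ln x < 0) by (rewrite <- ln_1; apply ln_increasing; lra).
        apply Rlt_le, exp_increasing; nra.
      + rewrite <- exp_0; apply Rlt_le, exp_increasing; lra.
    - apply (filterlim_le_le (fun _ => 0) f
        (fun x => exp (a * (ln (2 * a) - 1)) * exp (- (x / 2))) (Finite 0)).
      + exists 0; intros x Hx; split; [apply Rlt_le, Rmult_lt_0_compat; apply exp_pos|].
        apply gamma_kernel_bound; lra.
      + apply filterlim_const.
      + replace (Finite 0) with (Rbar_mult (exp (a * (ln (2 * a) - 1))) 0)
          by (simpl; f_equal; ring).
        apply (is_lim_scal_l (fun x => exp (- (x / 2))) _ p_infty 0).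
        apply (is_lim_comp exp (fun x => - (x / 2)) p_infty 0 m_infty).
        * apply is_lim_exp_m.
        * apply (is_lim_ext (fun x => (- / 2) * x)); [intros; field|].
          replace m_infty with (Rbar_mult (- / 2) p_infty); [apply is_lim_scal_l, is_lim_id|].
          simpl; destruct (Rle_dec 0 (- / 2)); [exfalso; lra|reflexivity].
        * exists 0; intros; discriminate. }
  assert (H5 : is_RInt_gen (Derive f) (at_right 0) (Rbar_locally p_infty)
                 (minus (scal a (Gamma a)) (Gamma (a + 1)))).
  { apply is_RInt_gen_ext with (2 := H3).
    apply filter_imp with (2 := Hev); intros [p q] [Hp Hq] x Hx; simpl in *.
    rewrite HD; [reflexivity|].
    apply Rlt_trans with (2 := proj1 Hx); now apply Rmin_glb_lt. }
  pose proof (is_RInt_gen_unique (V := R_CompleteNormedModule) (Fa := at_right 0)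
                (Fb := Rbar_locally p_infty) _ _ H4) as U1.
  pose proof (is_RInt_gen_unique (V := R_CompleteNormedModule) (Fa := at_right 0)
                (Fb := Rbar_locally p_infty) _ _ H5) as U2.
  rewrite U1 in U2; unfold minus, plus, opp, scal in U2; simpl in U2; unfold mult in U2; simpl in U2.
  lra.
Qed.

Lemma Gamma_poch a n : 1 < a -> Gamma (a + INR n) = Gamma a * poch a n.
Proof.
  intros Ha; induction n as [|n IH]; [simpl; rewrite Rplus_0_r; ring|].
  pose proof (pos_INR n).
  rewrite S_INR, <- Rplus_assoc, Gamma_succ, IH by lra; simpl; ring.
Qed.

(** * Logarithm of the Bessel power series *)

Lemma bessel_coef_neq_0 nu n : 0 <= nu -> bessel_coef nu n <> 0.
Proof.
  intros Hn; unfold bessel_coef; pose proof (poch_pos (nu + 1) n ltac:(lra)).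
  pose proof (INR_fact_neq_0 n).
  apply Rmult_integral_contrapositive; split; [apply pow_nonzero; lra|].
  apply Rinv_neq_0_compat; repeat apply Rmult_integral_contrapositive_currified;
    [assumption | apply pow_nonzero; lra | lra].
Qed.

Lemma bessel_coef_radius nu : 0 <= nu -> CV_radius (bessel_coef nu) = p_infty.
Proof.
  intros Hn; apply CV_radius_infinite_DAlembert; [intros; now apply bessel_coef_neq_0|].
  apply is_lim_seq_le_le with (fun _ => 0) (fun n => / INR (S n)).
  - intros n; split; [apply Rabs_pos|].
    rewrite bessel_coef_succ by assumption.
    pose proof (lt_0_INR (S n) ltac:(lia)) as HI.
    replace (- bessel_coef nu n / (4 * INR (S n) * (nu + INR (S n))) / bessel_coef nu n)
      with (- / (4 * INR (S n) * (nu + INR (S n))))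
      by (pose proof (bessel_coef_neq_0 nu n Hn); field; repeat split; lra).
    assert (1 <= INR (S n)) by (rewrite S_INR; pose proof (pos_INR n); lra).
    rewrite Rabs_Ropp, Rabs_pos_eq.
    + apply Rinv_le_contravar; [assumption|]. nra.
    + apply Rlt_le, Rinv_0_lt_compat; repeat apply Rmult_lt_0_compat; lra.
  - apply is_lim_seq_const.
  - apply (is_lim_seq_inv (fun n => INR (S n)) p_infty); [|discriminate].
    apply -> is_lim_seq_incr_1; apply is_lim_seq_INR.
Qed.

Lemma rayleigh_radius nu rho (r : R) : 0 <= nu -> ratio_bound nu rho ->
  0 <= r -> rho * r < 1 -> Rbar_lt r (CV_radius (rayleigh nu)).
Proof.
  intros Hn HB Hr0 Hlt; pose proof HB as [Hr _].
  apply (CV_radius_geometric _ (rayleigh nu 0) rho); auto.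
  intros n; rewrite Rabs_pos_eq by (apply Rlt_le; now apply rayleigh_pos).
  now apply rayleigh_geometric.
Qed.

(** The primitive [g] of [h] with [g(0) = 0]. *)
Definition log_coef (nu : R) (n : nat) : R :=
  match n with O => 0 | S k => rayleigh nu k / INR (S k) end.

Lemma log_coef_derive nu n : PS_derive (log_coef nu) n = rayleigh nu n.
Proof.
  unfold PS_derive, log_coef; field; apply not_0_INR; lia.
Qed.

Lemma log_coef_radius nu : CV_radius (log_coef nu) = CV_radius (rayleigh nu).
Proof.
  rewrite <- CV_radius_derive; apply CV_radius_ext, log_coef_derive.
Qed.

Lemma cps_ext a b z : (forall n, a n = b n) -> cps a z = cps b z.
Proof.
  intros H; unfold cps, CSeries; f_equal; apply Series_ext; intros n; now rewrite H.
Qed.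

Lemma is_cderive_log nu rho z : 0 <= nu -> ratio_bound nu rho -> rho * Cmod z < 1 ->
  is_cderive (cps (log_coef nu)) z (cps (rayleigh nu) z).
Proof.
  intros Hn Hr Hz.
  rewrite <- (cps_ext _ _ z (log_coef_derive nu)).
  apply cps_derive; rewrite log_coef_radius.
  apply (rayleigh_radius nu rho); auto; apply Cmod_ge_0.
Qed.

Lemma bessel_log_derivative nu rho z : 0 <= nu -> ratio_bound nu rho -> rho * Cmod z < 1 ->
  cps (PS_derive (bessel_coef nu)) z = (- (cps (bessel_coef nu) z * cps (rayleigh nu) z))%C.
Proof.
  intros Hn Hr Hz.
  assert (H1 : Rbar_lt (Cmod z) (CV_radius (bessel_coef nu))) by now rewrite bessel_coef_radius.
  assert (H2 : Rbar_lt (Cmod z) (CV_radius (rayleigh nu)))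
    by (apply (rayleigh_radius nu rho); auto; apply Cmod_ge_0).
  pose proof (cps_mult _ _ z H1 H2) as H.
  apply (is_cseries_scal (- RtoC 1)%C) in H.
  replace (- (cps (bessel_coef nu) z * cps (rayleigh nu) z))%C
    with (- RtoC 1 * (cps (bessel_coef nu) z * cps (rayleigh nu) z))%C by ring.
  apply is_cseries_unique; apply is_cseries_ext with (2 := H); intros n.
  rewrite conv_bessel_coef_rayleigh by assumption; unfold PS_derive.
  rewrite RtoC_opp; ring.
Qed.

(** [f exp(g)] has derivative [(f' + f h) exp(g) = 0]. *)
Lemma bessel_exp nu rho z : 0 <= nu -> ratio_bound nu rho -> rho * Cmod z < 1 ->
  (cps (bessel_coef nu) z * Cexp (cps (log_coef nu) z))%C = RtoC 1.
Proof.
  intros Hn Hr Hz.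
  rewrite (cderive_0_const (fun z => cps (bessel_coef nu) z * Cexp (cps (log_coef nu) z))%C z).
  - rewrite !cps_0; unfold log_coef; rewrite Cexp_0.
    unfold bessel_coef; simpl; rewrite <- RtoC_mult; f_equal; field.
  - intros w Hw.
    assert (Hw' : rho * Cmod w < 1).
    { destruct Hr as [Hr _]; apply Rle_lt_trans with (rho * Cmod z); [|assumption].
      apply Rmult_le_compat_l; lra. }
    assert (D1 : is_cderive (cps (bessel_coef nu)) w (cps (PS_derive (bessel_coef nu)) w))
      by (apply cps_derive; now rewrite bessel_coef_radius).
    pose proof (is_cderive_comp Cexp (cps (log_coef nu)) w _ _
      (is_cderive_Cexp _) (is_cderive_log nu rho w Hn Hr Hw')) as D2.
    pose proof (is_cderive_mult _ _ _ _ _ D1 D2) as D3; cbv beta in D3.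
    rewrite (bessel_log_derivative nu rho w Hn Hr Hw') in D3.
    match type of D3 with is_derive _ _ ?l => replace (RtoC 0) with l by ring end.
    exact D3.
Qed.

(** * The branch of the normalised product *)

(** [- ln (f(z^2) f(-z^2))], by [bessel_exp]. *)
Definition log_pi (nu : R) (z : C) : C :=
  (cps (log_coef nu) (z * z) + cps (log_coef nu) (- (z * z)))%C.

Definition u_branch (nu : R) (z : C) : C :=
  (z * Cexp (RtoC (- (1 / (2 * nu))) * log_pi nu z))%C.

(** Equal to [2 P(y^2)]; the present form is the one that differentiating [log_pi] produces, and it needs no
    splitting of complex series into even and odd terms. *)
Definition odd_part (nu : R) (y : C) : C :=
  (y * (cps (rayleigh nu) y - cps (rayleigh nu) (- y)))%C.

Lemma u_branch_derive nu rho z : 0 < nu -> ratio_bound nu rho -> rho * Cmod z ^ 2 < 1 ->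
  is_cderive (u_branch nu) z
    (Cexp (RtoC (- (1 / (2 * nu))) * log_pi nu z) * (1 - RtoC (/ nu) * odd_part nu (z * z)))%C.
Proof.
  intros Hnu Hr Hz; assert (Hn : 0 <= nu) by lra.
  assert (H1 : rho * Cmod (z * z) < 1) by (rewrite Cmod_mult; simpl in Hz; lra).
  assert (H2 : rho * Cmod (- (z * z)) < 1) by (rewrite Cmod_opp; assumption).
  pose proof (is_cderive_mult (fun w => w) (fun w => w) z _ _ (is_cderive_id z) (is_cderive_id z)) as S1.
  pose proof (is_cderive_mult (fun _ => - RtoC 1)%C _ z _ _ (is_cderive_const _ z) S1) as S2.
  cbv beta in S1, S2.
  pose proof (is_cderive_comp _ (fun w => w * w)%C z _ _ (is_cderive_log nu rho _ Hn Hr H1) S1) as D1.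
  assert (H2' : rho * Cmod (- RtoC 1 * (z * z)) < 1).
  { replace (- RtoC 1 * (z * z))%C with (- (z * z))%C by ring; assumption. }
  pose proof (is_cderive_comp _ (fun w => - RtoC 1 * (w * w))%C z _ _
                (is_cderive_log nu rho _ Hn Hr H2') S2) as D2.
  pose proof (is_cderive_plus _ _ _ _ _ D1 D2) as D3; cbv beta in D3.
  pose proof (is_cderive_mult (fun _ => RtoC (- (1 / (2 * nu)))) _ z _ _ (is_cderive_const _ z) D3) as D4.
  pose proof (is_cderive_comp Cexp _ z _ _ (is_cderive_Cexp _) D4) as D5.
  pose proof (is_cderive_mult (fun w => w) _ z _ _ (is_cderive_id z) D5) as D6.
  cbv beta in D6.
  assert (Eo : forall w, (- RtoC 1 * (w * w) = - (w * w))%C) by (intros; ring).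
  match type of D6 with is_derive _ _ ?l => set (L := l) in * end.
  replace (Cexp (RtoC (- (1 / (2 * nu))) * log_pi nu z)
            * (1 - RtoC (/ nu) * odd_part nu (z * z)))%C with L.
  - apply (is_derive_ext (K := C_AbsRing) (V := C_NormedModule)) with (2 := D6).
    intros w; unfold u_branch, log_pi; rewrite <- Eo; reflexivity.
  - unfold L, log_pi, odd_part; rewrite Eo.
    replace (RtoC (/ nu)) with (RtoC 2 * RtoC (1 / (2 * nu)))%C
      by (rewrite <- RtoC_mult; f_equal; field; lra).
    rewrite RtoC_opp; ring.
Qed.

Lemma PSeries_is_series (a : nat -> R) (x : R) : Rbar_lt (Rabs x) (CV_radius a) ->
  is_series (fun n => a n * x ^ n) (PSeries a x).
Proof.
  intros H; exact (proj1 (is_pseries_R a x _) (PSeries_correct _ _ (CV_radius_inside _ _ H))).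
Qed.

Lemma cps_real a (r : R) : Rbar_lt (Rabs r) (CV_radius a) -> cps a (RtoC r) = RtoC (PSeries a r).
Proof.
  intros H; apply is_cseries_unique; split.
  - apply is_series_ext with (2 := PSeries_is_series _ _ H); intros n; rewrite <- RtoC_pow; simpl; ring.
  - apply is_series_ext with (fun n => 0 * a n * 0 ^ n).
    + intros n; rewrite <- RtoC_pow; simpl; ring.
    + pose proof (proj1 (is_pseries_R _ _ _) (is_pseries_0 (fun n => 0 * a n))) as P.
      cbv beta in P; rewrite Rmult_0_l in P; exact P.
Qed.

Lemma rayleigh_odd_part_real nu rho r : 0 <= nu -> ratio_bound nu rho ->
  0 <= r -> rho * r < 1 ->
  r * (PSeries (rayleigh nu) r - PSeries (rayleigh nu) (- r)) = 2 * odd_sum nu (r ^ 2).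
Proof.
  intros Hn HB Hr0 Hlt; pose proof HB as [Hr _].
  assert (Hlt2 : rho ^ 2 * r ^ 2 < 1).
  { rewrite <- Rpow_mult_distr; assert (0 <= rho * r) by (apply Rmult_le_pos; lra). nra. }
  assert (P1 : ex_pseries (fun n => rayleigh nu (2 * n)%nat) (r ^ 2)).
  { apply CV_radius_inside; rewrite Rabs_pos_eq by apply pow2_ge_0.
    apply (CV_radius_geometric _ (rayleigh nu 0) (rho ^ 2)); auto; [now apply pow_lt | apply pow2_ge_0|].
    intros n; rewrite Rabs_pos_eq by (apply Rlt_le; now apply rayleigh_pos).
    rewrite <- pow_mult; now apply rayleigh_geometric. }
  assert (P2 : ex_pseries (fun n => rayleigh nu (2 * n + 1)%nat) (r ^ 2)).
  { apply CV_radius_inside, (odd_rayleigh_radius nu rho); auto; apply pow2_ge_0. }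
  rewrite (PSeries_odd_even _ r P1 P2).
  rewrite (PSeries_odd_even _ (- r)) by (replace ((- r) ^ 2) with (r ^ 2) by ring; assumption).
  replace ((- r) ^ 2) with (r ^ 2) by ring.
  unfold odd_sum, odd_rayleigh; ring.
Qed.

Lemma odd_part_real nu rho r : 0 <= nu -> ratio_bound nu rho ->
  0 <= r -> rho * r < 1 -> odd_part nu (RtoC r) = RtoC (2 * odd_sum nu (r ^ 2)).
Proof.
  intros Hn Hr Hr0 Hlt; unfold odd_part.
  pose proof (rayleigh_radius nu rho r Hn Hr Hr0 Hlt) as Hcv.
  rewrite <- RtoC_opp, !cps_real by (rewrite ?Rabs_Ropp, Rabs_pos_eq; assumption).
  rewrite <- RtoC_minus, <- RtoC_mult; f_equal; now apply (rayleigh_odd_part_real nu rho).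
Qed.

(** The coefficients [h_n (1 - (-1)^n)] of [odd_part] are nonnegative, so its modulus is largest on
    the positive axis. *)
Lemma odd_part_norm nu rho y : 0 <= nu -> ratio_bound nu rho -> rho * Cmod y < 1 ->
  Cmod (odd_part nu y) <= 2 * odd_sum nu (Cmod y ^ 2).
Proof.
  intros Hn Hr Hy; pose proof (Cmod_ge_0 y) as Hy0.
  pose proof (rayleigh_radius nu rho (Cmod y) Hn Hr Hy0 Hy) as Hcv.
  assert (Hcv' : Rbar_lt (Cmod (- y)) (CV_radius (rayleigh nu))) by (rewrite Cmod_opp; assumption).
  pose proof (is_cseries_scal y _ _ (is_cseries_plus _ _ _ _ (cps_correct _ _ Hcv)
    (is_cseries_scal (- RtoC 1)%C _ _ (cps_correct _ _ Hcv')))) as S1.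
  replace (y * (cps (rayleigh nu) y + - RtoC 1 * cps (rayleigh nu) (- y)))%C with (odd_part nu y) in S1
    by (unfold odd_part; ring).
  rewrite <- (rayleigh_odd_part_real nu rho) by assumption.
  assert (R1 : is_series (fun n => rayleigh nu n * Cmod y ^ n) (PSeries (rayleigh nu) (Cmod y))).
  { apply PSeries_is_series; rewrite Rabs_pos_eq; assumption. }
  assert (R2 : is_series (fun n => rayleigh nu n * (- Cmod y) ^ n) (PSeries (rayleigh nu) (- Cmod y))).
  { apply PSeries_is_series; rewrite Rabs_Ropp, Rabs_pos_eq; assumption. }
  pose proof (is_series_scal_l (Cmod y) _ _ (is_series_minus _ _ _ _ R1 R2)) as R3.
  refine (is_cseries_norm _ _ _ _ S1 _ R3).
  intros n; cbv beta.
  replace (y * (RtoC (rayleigh nu n) * y ^ n + - RtoC 1 * (RtoC (rayleigh nu n) * (- y) ^ n)))%C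
    with (RtoC (rayleigh nu n * (1 - (-1) ^ n)) * (y * y ^ n))%C.
  2:{ replace ((- y) ^ n)%C with (RtoC ((-1) ^ n) * y ^ n)%C.
      - rewrite RtoC_mult, RtoC_minus; ring.
      - induction n as [|n IH]; [simpl; ring|].
        simpl; rewrite <- IH, RtoC_mult. replace (RtoC (-1)) with (- RtoC 1)%C by (rewrite <- RtoC_opp; f_equal; ring). ring. }
  rewrite !Cmod_mult, Cmod_R, Cmod_pow, Rabs_mult.
  rewrite (Rabs_pos_eq (rayleigh nu n)) by (apply Rlt_le; now apply rayleigh_pos).
  assert (Hs : Rabs (1 - (-1) ^ n) = 1 - (-1) ^ n).
  { apply Rabs_pos_eq. destruct (Nat.even n) eqn:Ev.
    - apply Nat.even_spec in Ev; destruct Ev as [k ->]; rewrite pow_1_even; lra.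
    - assert (O : Nat.odd n = true) by (rewrite <- Nat.negb_even, Ev; reflexivity).
      apply Nat.odd_spec in O; destruct O as [k ->].
      replace (2 * k + 1)%nat with (S (2 * k)) by lia; rewrite pow_1_odd; lra. }
  rewrite Hs; apply Req_le.
  change (rayleigh nu n * (1 - (-1) ^ n) * (Cmod y * Cmod y ^ n)
    = Cmod y * (rayleigh nu n * Cmod y ^ n - rayleigh nu n * (- Cmod y) ^ n)).
  replace (- Cmod y) with (-1 * Cmod y) by ring; rewrite Rpow_mult_distr; ring.
Qed.

Lemma polar (z : C) : z <> RtoC 0 -> Cexp (ln (Cmod z), Carg z) = z.
Proof.
  intros Hz; pose proof (Cmod_gt_0 z) as [Hm _]; specialize (Hm Hz).
  unfold Cexp; simpl; rewrite exp_ln by assumption.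
  pose proof (re_le_Cmod z) as HRe; pose proof (Cmod2_alt z) as Hsq.
  assert (Hb : -1 <= Re z / Cmod z <= 1).
  { apply Rabs_le_between in HRe; split;
      apply Rmult_le_reg_r with (Cmod z); try assumption;
      unfold Rdiv; rewrite Rmult_assoc, Rinv_l; lra. }
  assert (Hsin : sin (acos (Re z / Cmod z)) = Rabs (Im z) / Cmod z).
  { rewrite sin_acos by assumption.
    replace (1 - Rsqr (Re z / Cmod z)) with ((Rabs (Im z) / Cmod z) ^ 2).
    - apply sqrt_pow2, Rmult_le_pos; [apply Rabs_pos | now apply Rlt_le, Rinv_0_lt_compat].
    - unfold Rsqr. replace (Rabs (Im z) / Cmod z) with (Rabs (Im z) * / Cmod z) by reflexivity.
      rewrite Rpow_mult_distr, pow2_abs.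
      replace (Im z ^ 2) with (Cmod z ^ 2 - Re z ^ 2) by lra. field; lra. }
  unfold Carg; destruct (Rle_dec 0 (Im z)) as [H|H].
  - rewrite cos_acos, Hsin, Rabs_pos_eq by assumption.
    destruct z as [p q]; simpl in *; f_equal; field; lra.
  - rewrite cos_neg, sin_neg, cos_acos, Hsin, Rabs_left by (assumption || lra).
    destruct z as [p q]; simpl in *; f_equal; field; lra.
Qed.

(** Covers [J_nu] with [s = 1] and [I_nu] with [s = -1]. *)
Lemma Bessel_series nu (s : R) (e : nat -> R) (z : C) : 0 < nu ->
  (forall n, e n / (INR (fact n) * Gamma (nu + INR n + 1))
             = / Gamma (nu + 1) * (bessel_coef nu n * 4 ^ n * s ^ n)) ->
  CSeries (fun n => RtoC (e n / (INR (fact n) * Gamma (nu + INR n + 1))) * (z / 2) ^ (2 * n))%C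
  = (RtoC (/ Gamma (nu + 1)) * cps (bessel_coef nu) (RtoC s * (z * z)))%C.
Proof.
  intros Hnu He.
  assert (H : Rbar_lt (Cmod (RtoC s * (z * z))) (CV_radius (bessel_coef nu)))
    by (rewrite bessel_coef_radius by lra; exact I).
  apply is_cseries_unique.
  apply is_cseries_ext with (2 := is_cseries_scal (RtoC (/ Gamma (nu + 1))) _ _ (cps_correct _ _ H)).
  intros n; rewrite He, Cpow_mult_r, !RtoC_mult, !RtoC_pow, Cpow_mult_l.
  replace ((z / RtoC 2) ^ 2)%C with (/ RtoC 4 * (z * z))%C.
  2:{ replace (RtoC 4) with (RtoC 2 * RtoC 2)%C by (rewrite <- RtoC_mult; f_equal; ring).
      simpl; field. }
  rewrite (Cpow_mult_l (/ RtoC 4)%C).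
  assert (E4 : (RtoC 4 ^ n * (/ RtoC 4) ^ n)%C = RtoC 1).
  { rewrite <- Cpow_mult_l, Cinv_r, Cpow_1_l; [reflexivity|].
    intros E; apply RtoC_inj in E; lra. }
  transitivity (RtoC (/ Gamma (nu + 1)) * (RtoC (bessel_coef nu n) * RtoC s ^ n) * (z * z) ^ n
    * (RtoC 4 ^ n * (/ RtoC 4) ^ n))%C; [rewrite E4; ring | ring].
Qed.

Lemma bessel_coef_Gamma nu n : 0 < nu ->
  (-1) ^ n / (INR (fact n) * Gamma (nu + INR n + 1)) = / Gamma (nu + 1) * (bessel_coef nu n * 4 ^ n).
Proof.
  intros Hnu; replace (nu + INR n + 1) with (nu + 1 + INR n) by ring.
  rewrite Gamma_poch by lra; unfold bessel_coef.
  pose proof (proj2 (Gamma_correct (nu + 1) ltac:(lra))).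
  pose proof (poch_pos (nu + 1) n ltac:(lra)); pose proof (INR_fact_neq_0 n).
  pose proof (pow_nonzero 4 n ltac:(lra)).
  field; repeat split; lra.
Qed.

Lemma PiBessel_factor nu (z : C) : 0 < nu -> z <> RtoC 0 ->
  PiBessel nu z =
  (Cpower (z / 2) nu * Cpower (z / 2) nu * RtoC (/ Gamma (nu + 1) ^ 2)
   * (cps (bessel_coef nu) (z * z) * cps (bessel_coef nu) (- (z * z))))%C.
Proof.
  intros Hnu Hz; unfold PiBessel, BesselJ, BesselI.
  rewrite (Bessel_series nu 1 (fun n => (-1) ^ n)) by
    (auto; intros n; rewrite bessel_coef_Gamma, pow1 by assumption; ring).
  rewrite (Bessel_series nu (-1) (fun n => 1)).
  - replace (RtoC 1 * (z * z))%C with (z * z)%C by ring.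
    replace (RtoC (-1) * (z * z))%C with (- (z * z))%C
      by (replace (RtoC (-1)) with (- RtoC 1)%C by (rewrite <- RtoC_opp; f_equal; ring); ring).
    pose proof (proj2 (Gamma_correct (nu + 1) ltac:(lra))).
    replace (/ Gamma (nu + 1) ^ 2) with (/ Gamma (nu + 1) * / Gamma (nu + 1)) by (field; lra).
    rewrite RtoC_mult; ring.
  - assumption.
  - intros n.
    transitivity ((-1) ^ n / (INR (fact n) * Gamma (nu + INR n + 1)) * (-1) ^ n).
    + unfold Rdiv. rewrite (Rmult_comm ((-1) ^ n)), Rmult_assoc, <- Rpow_mult_distr.
      replace (-1 * -1) with 1 by ring; rewrite pow1; ring.
    + rewrite bessel_coef_Gamma by assumption; ring.
Qed.

(** A logarithm of [2^(2 nu) Gamma(nu+1)^2 Pi_nu(z)].  It uses the argument of [z/2] because the powers in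
    the Bessel functions do; whatever the cut, [exp (log_value / (2 nu))] is the function [u_branch]. *)
Definition log_value (nu : R) (z : C) : C :=
  (RtoC (2 * nu) * (RtoC (ln 2) + (ln (Cmod (z / 2)), Carg (z / 2))) - log_pi nu z)%C.

Lemma half_neq_0 (z : C) : z <> RtoC 0 -> (z / 2)%C <> RtoC 0.
Proof.
  intros Hz E; apply Hz.
  replace z with (z / 2 * 2)%C; [rewrite E; ring|].
  field; intros E2; apply RtoC_inj in E2; lra.
Qed.

Lemma Cexp_log_value nu rho (z : C) : 0 < nu -> ratio_bound nu rho -> z <> RtoC 0 ->
  rho * Cmod z ^ 2 < 1 ->
  Cexp (log_value nu z) = (RtoC (Rpower 2 (2 * nu) * Gamma (nu + 1) ^ 2) * PiBessel nu z)%C.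
Proof.
  intros Hnu Hr Hz Hlt; assert (Hn : 0 <= nu) by lra.
  rewrite PiBessel_factor by assumption.
  pose proof (proj2 (Gamma_correct (nu + 1) ltac:(lra))) as HG.
  assert (H1 : rho * Cmod (z * z) < 1) by (rewrite Cmod_mult; simpl in Hlt; lra).
  assert (H2 : rho * Cmod (- (z * z)) < 1) by (rewrite Cmod_opp; assumption).
  pose proof (bessel_exp nu rho _ Hn Hr H1) as E1; pose proof (bessel_exp nu rho _ Hn Hr H2) as E2.
  unfold Cpower; destruct (Ceq_dec (z / 2) 0) as [E|_]; [now apply half_neq_0 in E|].
  set (L := (ln (Cmod (z / 2)), Carg (z / 2)) : C).
  replace (log_value nu z) with
    (RtoC (2 * nu * ln 2) + (RtoC nu * L + RtoC nu * L) + - log_pi nu z)%C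
    by (unfold log_value; fold L; rewrite !RtoC_mult; ring).
  rewrite !Cexp_plus.
  assert (Ep : Cexp (- log_pi nu z) = (cps (bessel_coef nu) (z * z) * cps (bessel_coef nu) (- (z * z)))%C).
  { transitivity (Cexp (- log_pi nu z)
      * ((cps (bessel_coef nu) (z * z) * Cexp (cps (log_coef nu) (z * z)))
         * (cps (bessel_coef nu) (- (z * z)) * Cexp (cps (log_coef nu) (- (z * z))))))%C;
      [rewrite E1, E2; ring|].
    transitivity (Cexp (- log_pi nu z) * Cexp (log_pi nu z)
      * (cps (bessel_coef nu) (z * z) * cps (bessel_coef nu) (- (z * z))))%C.
    - unfold log_pi at 3; rewrite Cexp_plus; ring.
    - rewrite <- Cexp_plus, Cplus_comm, Cplus_opp_r, Cexp_0; ring. }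
  rewrite Ep.
  assert (E3 : Cexp (RtoC (2 * nu * ln 2)) = RtoC (Rpower 2 (2 * nu))).
  { unfold Cexp, Rpower, RtoC; simpl; rewrite cos_0, sin_0; f_equal; ring. }
  rewrite E3.
  replace (RtoC nu * L)%C with ((nu * ln (Cmod (z / 2)))%R, (nu * Carg (z / 2))%R)
    by (unfold L, Cmult, RtoC; simpl; f_equal; ring).
  rewrite (RtoC_mult (Rpower 2 (2 * nu))).
  set (c := Cexp _).
  transitivity (RtoC (Rpower 2 (2 * nu)) * (c * c)
    * (cps (bessel_coef nu) (z * z) * cps (bessel_coef nu) (- (z * z)))
    * (RtoC (Gamma (nu + 1) ^ 2) * RtoC (/ Gamma (nu + 1) ^ 2)))%C; [|ring].
  rewrite <- (RtoC_mult (Gamma (nu + 1) ^ 2)), Rinv_r by (apply pow_nonzero; lra). ring.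
Qed.

Lemma u_branch_exp nu (z : C) : 0 < nu -> z <> RtoC 0 ->
  u_branch nu z = Cexp (RtoC (1 / (2 * nu)) * log_value nu z)%C.
Proof.
  intros Hnu Hz; unfold u_branch, log_value.
  set (L := (ln (Cmod (z / 2)), Carg (z / 2)) : C).
  replace (RtoC (1 / (2 * nu)) * (RtoC (2 * nu) * (RtoC (ln 2) + L) - log_pi nu z))%C
    with ((RtoC (ln 2) + L) + RtoC (- (1 / (2 * nu))) * log_pi nu z)%C.
  2:{ rewrite RtoC_opp.
      transitivity ((RtoC (1 / (2 * nu)) * RtoC (2 * nu)) * (RtoC (ln 2) + L)
                    - RtoC (1 / (2 * nu)) * log_pi nu z)%C; [|ring].
      rewrite <- RtoC_mult; replace (1 / (2 * nu) * (2 * nu)) with 1 by (field; lra). ring. }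
  rewrite !Cexp_plus; f_equal.
  unfold L; rewrite (polar (z / 2)) by now apply half_neq_0.
  replace (Cexp (RtoC (ln 2))) with (RtoC 2).
  - field; intros E; apply RtoC_inj in E; lra.
  - unfold Cexp, RtoC; simpl; rewrite exp_ln, cos_0, sin_0 by lra; f_equal; ring.
Qed.

(** Two logarithms of the same number have the same real part, and the exponent [1/(2 nu)] is
    real. *)
Lemma modulus_u nu rho r (u : C -> C) (z : C) : 0 < nu -> ratio_bound nu rho -> is_u nu r u ->
  z <> RtoC 0 -> Cmod z < r -> rho * Cmod z ^ 2 < 1 -> Cmod (u z) = Cmod (u_branch nu z).
Proof.
  intros Hnu Hr [_ [_ [_ Hp]]] Hz Hzr Hlt.
  pose proof (Cexp_log_value nu rho z Hnu Hr Hz Hlt) as E.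
  rewrite u_branch_exp by assumption.
  destruct (Hp z Hz Hzr) as [[H0 _]|[l [Hl Hu]]].
  - exfalso; rewrite <- E in H0; now apply Cexp_neq_0 in H0.
  - rewrite Hu, !Cmod_Cexp.
    assert (ER : Re l = Re (log_value nu z)).
    { apply exp_inv. rewrite <- !Cmod_Cexp; f_equal; congruence. }
    f_equal; destruct l as [p q], (log_value nu z) as [p' q']; simpl in *; rewrite ER; ring.
Qed.

Lemma is_u_branch nu rho t : 0 < nu -> ratio_bound nu rho -> rho * t ^ 2 < 1 ->
  is_u nu t (u_branch nu).
Proof.
  intros Hnu Hr Ht; pose proof Hr as [Hr0 _].
  assert (Hz : forall z, Cmod z < t -> rho * Cmod z ^ 2 < 1).
  { intros z Hz; pose proof (Cmod_ge_0 z); apply Rle_lt_trans with (2 := Ht).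
    apply Rmult_le_compat_l; [lra|]. apply pow_incr; lra. }
  assert (E0 : cps (log_coef nu) 0 = RtoC 0) by (rewrite cps_0; reflexivity).
  assert (L0 : log_pi nu 0 = RtoC 0).
  { unfold log_pi; replace (- (RtoC 0 * RtoC 0))%C with (RtoC 0) by ring.
    replace (RtoC 0 * RtoC 0)%C with (RtoC 0) by ring; rewrite E0; ring. }
  split; [|split; [|split]].
  - intros z Hz'; eexists; apply (u_branch_derive nu rho); auto.
  - unfold u_branch; ring.
  - assert (H0 : rho * Cmod (RtoC 0) ^ 2 < 1) by (rewrite Cmod_0; lra).
    pose proof (u_branch_derive nu rho (RtoC 0) Hnu Hr H0) as D.
    rewrite L0 in D; unfold odd_part in D.
    match type of D with is_derive _ _ ?l => replace (RtoC 1) with l; [exact D|] end.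
    replace (RtoC (- (1 / (2 * nu))) * RtoC 0)%C with (RtoC 0) by ring.
    rewrite Cexp_0; ring.
  - intros z Hz0 Hzt; right; exists (log_value nu z); split.
    + apply (Cexp_log_value nu rho); auto.
    + now apply u_branch_exp.
Qed.

Lemma u_branch_log_derivative nu rho (z : C) : 0 < nu -> ratio_bound nu rho -> z <> RtoC 0 ->
  rho * Cmod z ^ 2 < 1 ->
  u_branch nu z <> RtoC 0 /\
  (z * C_derive (u_branch nu) z / u_branch nu z = 1 - RtoC (/ nu) * odd_part nu (z * z))%C.
Proof.
  intros Hnu Hr Hz Hlt.
  rewrite (is_C_derive_unique _ _ _ (u_branch_derive nu rho z Hnu Hr Hlt)).
  unfold u_branch; set (E := Cexp _); assert (HE : E <> RtoC 0) by apply Cexp_neq_0.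
  split; [now apply Cmult_neq_0|]. field; auto.
Qed.

(** Each term of [P(x)] is at most [x / x1] times the corresponding term of [P(x1)]. *)
Lemma odd_sum_lt nu rho x x1 : 0 <= nu -> ratio_bound nu rho ->
  0 < x < x1 -> rho ^ 2 * x1 < 1 -> odd_sum nu x < odd_sum nu x1.
Proof.
  intros Hn HB Hx Hx1; pose proof HB as [Hr _].
  assert (Hpos : 0 < odd_sum nu x1).
  { apply Rlt_le_trans with (odd_psum nu x1 0).
    - unfold odd_psum; simpl; apply Rmult_lt_0_compat; [now apply odd_rayleigh_pos | lra].
    - apply (odd_psum_le_odd_sum nu rho); auto; lra. }
  assert (Hr2 : 0 < rho ^ 2) by now apply pow_lt.
  apply Rle_lt_trans with (x / x1 * odd_sum nu x1).
  - apply (is_lim_seq_le (odd_psum nu x) (fun N => x / x1 * odd_psum nu x1 N)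
      (odd_sum nu x) (x / x1 * odd_sum nu x1)).
    + intros N; unfold odd_psum; rewrite scal_sum; apply sum_Rle; intros k _.
      rewrite Rmult_assoc; apply Rmult_le_compat_l; [apply Rlt_le; now apply odd_rayleigh_pos|].
      change (x ^ S k) with (x * x ^ k); change (x1 ^ S k) with (x1 * x1 ^ k).
      replace (x1 * x1 ^ k * (x / x1)) with (x * x1 ^ k) by (field; lra).
      apply Rmult_le_compat_l; [lra|]. apply pow_incr; lra.
    + apply (odd_psum_lim nu rho); auto; try lra.
      apply Rle_lt_trans with (2 := Hx1); apply Rmult_le_compat_l; lra.
    + apply (is_lim_seq_scal_l _ (x / x1) (odd_sum nu x1)).
      apply (odd_psum_lim nu rho); auto; lra.
  - rewrite <- (Rmult_1_l (odd_sum nu x1)) at 2.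
    apply Rmult_lt_compat_r; [assumption|].
    apply Rmult_lt_reg_r with x1; [lra|]. unfold Rdiv; rewrite Rmult_assoc, Rinv_l; lra.
Qed.

(** [Re (1 - (1/nu) w) >= 1 - |w| / nu] with [w = 2 P(z^4)], and [|P(z^4)| <= P(|z|^4) < P(t^4)]. *)
Lemma u_branch_starlike nu rho t : 0 < nu -> ratio_bound nu rho -> 0 < t ->
  rho * t ^ 2 < 1 -> odd_sum nu (t ^ 4) = nu / 2 -> starlike_on_disc t (u_branch nu).
Proof.
  intros Hnu Hr Ht Hlt Hpsi z Hz Hzt; pose proof Hr as [Hr0 _].
  pose proof (proj1 (Cmod_gt_0 z) Hz) as Hm.
  assert (Hz2 : Cmod z ^ 2 <= t ^ 2) by (apply pow_incr; lra).
  assert (Hlt' : rho * Cmod z ^ 2 < 1).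
  { apply Rle_lt_trans with (2 := Hlt); apply Rmult_le_compat_l; lra. }
  destruct (u_branch_log_derivative nu rho z Hnu Hr Hz Hlt') as [H0 HE].
  split; [exact H0|]; rewrite HE.
  assert (Hzz : Cmod (z * z) = Cmod z ^ 2) by (rewrite Cmod_mult; ring).
  assert (HN : Cmod (odd_part nu (z * z)) <= 2 * odd_sum nu ((Cmod z ^ 2) ^ 2)).
  { rewrite <- Hzz; apply (odd_part_norm nu rho); auto; [lra | rewrite Hzz; assumption]. }
  assert (HL : odd_sum nu ((Cmod z ^ 2) ^ 2) < nu / 2).
  { rewrite <- Hpsi; apply (odd_sum_lt nu rho); auto; [lra| |].
    - replace ((Cmod z ^ 2) ^ 2) with (Cmod z ^ 4) by ring; split; [now apply pow_lt|].
      apply Rnot_le_lt; intros Hc; apply (Rlt_not_le _ _ Hzt).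
      apply (pow_le_inv 4); [lia | lra | assumption].
    - replace (rho ^ 2 * t ^ 4) with ((rho * t ^ 2) ^ 2) by ring.
      assert (0 <= rho * t ^ 2) by (apply Rmult_le_pos; [lra | apply pow2_ge_0]). nra. }
  pose proof (re_le_Cmod (odd_part nu (z * z))) as HR.
  pose proof (Rle_abs (Re (odd_part nu (z * z)))) as HA.
  assert (Hi : 0 < / nu) by now apply Rinv_0_lt_compat.
  replace (Re (1 - RtoC (/ nu) * odd_part nu (z * z))%C) with (1 - / nu * Re (odd_part nu (z * z)))
    by (generalize (odd_part nu (z * z)); intros [p q]; simpl; ring).
  assert (/ nu * Re (odd_part nu (z * z)) < / nu * nu) by (apply Rmult_lt_compat_l; lra).
  rewrite Rinv_l in H by lra; lra.
Qed.

(** At [z = t] the function [u_branch] has [z u'/u = 0]; any other branch has the same modulus on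
    the positive axis near [t], hence the same real part of [z u'/u] at [t]. *)
Lemma not_starlike_beyond nu rho t r u : 0 < nu -> ratio_bound nu rho -> 0 < t ->
  rho * t ^ 2 < 1 -> odd_sum nu (t ^ 4) = nu / 2 -> t < r ->
  is_u nu r u -> starlike_on_disc r u -> False.
Proof.
  intros Hnu Hr Ht Hlt Hpsi Htr Hu Hstar; pose proof Hr as [Hr0 _].
  assert (Htm : Cmod (RtoC t) = t) by (rewrite Cmod_R, Rabs_pos_eq; lra).
  assert (Ht0 : RtoC t <> RtoC 0) by (intros E; apply RtoC_inj in E; lra).
  destruct (Hstar (RtoC t) Ht0 ltac:(lra)) as [Hu0 HRe].
  destruct (u_branch_log_derivative nu rho (RtoC t) Hnu Hr Ht0 ltac:(rewrite Htm; assumption)) as [Hb0 Hb].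
  set (w := u_branch nu) in *.
  assert (Dw : is_cderive w (RtoC t) (C_derive w (RtoC t))).
  { apply C_derive_correct; [exact (RtoC 0)|]; eexists; apply (u_branch_derive nu rho); auto.
    rewrite Htm; assumption. }
  assert (Du : is_cderive u (RtoC t) (C_derive u (RtoC t))).
  { apply C_derive_correct; [exact (RtoC 0)|]; apply (proj1 Hu); rewrite Htm; assumption. }
  assert (Hs : t < sqrt (/ rho)).
  { rewrite <- (sqrt_pow2 t) by lra; apply sqrt_lt_1_alt; split; [apply pow2_ge_0|].
    apply Rmult_lt_reg_l with rho; [assumption|]. rewrite Rinv_r; lra. }
  (* keep the points near [t] positive, in the disc of [u], and where the series of [h] converges *)
  set (d := Rmin (t / 2) (Rmin (r - t) (sqrt (/ rho) - t))).
  assert (Hd : 0 < d) by (repeat apply Rmin_pos; lra).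
  assert (HM : forall s, Rabs (s - t) < d -> Cmod (u (RtoC s)) = Cmod (w (RtoC s))).
  { intros s Hs'; apply Rabs_def2 in Hs'.
    assert (d <= t / 2) by apply Rmin_l.
    assert (d <= r - t) by (eapply Rle_trans; [apply Rmin_r | apply Rmin_l]).
    assert (d <= sqrt (/ rho) - t) by (eapply Rle_trans; [apply Rmin_r | apply Rmin_r]).
    assert (Hsm : Cmod (RtoC s) = s) by (rewrite Cmod_R, Rabs_pos_eq; lra).
    apply (modulus_u nu rho r); auto.
    - intros E; apply RtoC_inj in E; lra.
    - lra.
    - rewrite Hsm; apply Rmult_lt_reg_l with (/ rho); [now apply Rinv_0_lt_compat|].
      rewrite <- Rmult_assoc, Rinv_l, Rmult_1_l, Rmult_1_r by lra.
      rewrite <- (pow2_sqrt (/ rho)) by (apply Rlt_le, Rinv_0_lt_compat; assumption).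
      simpl; rewrite ?Rmult_1_r.
      apply Rmult_le_0_lt_compat; lra. }
  pose proof (Re_log_derivative_modulus u w _ _ t d Hd Du Dw HM Hu0 Hb0) as EQ.
  assert (Hzero : Re (RtoC t * C_derive w (RtoC t) / w (RtoC t))%C = 0).
  { rewrite Hb, <- RtoC_mult.
    rewrite (odd_part_real nu rho) by (auto; try lra; try nra; simpl in Hlt; lra).
    replace ((t * t) ^ 2) with (t ^ 4) by ring; rewrite Hpsi.
    simpl; field; lra. }
  assert (Es : forall l v : C, v <> RtoC 0 -> Re (RtoC t * l / v)%C = t * Re (l / v)%C).
  { intros l v _; replace (RtoC t * l / v)%C with (RtoC t * (l / v))%C by (unfold Cdiv; ring).
    generalize (l / v)%C; intros [p q]; simpl; ring. }
  rewrite Es in HRe, Hzero by assumption. rewrite EQ, Hzero in HRe; lra.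
Qed.

Lemma starlikeness_radius_eq nu rho t : 0 < nu -> ratio_bound nu rho -> 0 < t ->
  rho * t ^ 2 < 1 -> odd_sum nu (t ^ 4) = nu / 2 -> starlikeness_radius_u nu = Finite t.
Proof.
  intros Hnu Hr Ht Hlt Hpsi; unfold starlikeness_radius_u.
  apply is_lub_Rbar_unique; split.
  - intros r [_ [u [Hu Hs]]]; simpl; apply Rnot_lt_le; intros Htr.
    exact (not_starlike_beyond nu rho t r u Hnu Hr Ht Hlt Hpsi Htr Hu Hs).
  - intros b Hb; apply Hb; split; [assumption|].
    exists (u_branch nu); split; [now apply (is_u_branch nu rho) | now apply (u_branch_starlike nu rho)].
Qed.

(** * Comparison of the bounds *)

Lemma Rdiv_lt_cross a b c d : 0 < b -> 0 < d -> 0 < c * b - a * d -> a / b < c / d.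
Proof.
  intros Hb Hd H; apply Rminus_lt_0.
  replace (c / d - a / b) with ((c * b - a * d) / (b * d)) by (field; lra).
  apply Rdiv_lt_0_compat; [assumption | now apply Rmult_lt_0_compat].
Qed.

Lemma quad_pos nu : 0 < nu -> 0 < 5 * nu ^ 2 + 15 * nu + 12.
Proof. intros; poly_pos. Qed.

Lemma upper4_lt_upper3 nu : 0 < nu ->
  upper4 nu < 8 * nu * (nu + 1) ^ 2 * poch (nu + 3) 3 * (5 * nu ^ 2 + 15 * nu + 12) / num3 nu.
Proof.
  intros H; unfold upper4; apply Rdiv_lt_cross; [now apply num4_pos | now apply num3_pos|].
  replace (8 * nu * (nu + 1) ^ 2 * poch (nu + 3) 3 * (5 * nu ^ 2 + 15 * nu + 12) * num4 nu
    - 32 * nu * (nu + 1) ^ 2 * (nu + 2) ^ 2 * (nu + 4) * (nu + 6) * (nu + 7) * num3 nu * num3 nu)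
    with (8 * nu * (nu + 1) ^ 2 * (nu + 4) * ((nu + 3) * (nu + 5) * (5 * nu ^ 2 + 15 * nu + 12) * num4 nu
      - 4 * (nu + 2) ^ 2 * (nu + 6) * (nu + 7) * num3 nu * num3 nu)) by (simpl; ring).
  apply Rmult_lt_0_compat.
  - pos.
  - unfold num3, num4; poly_pos.
Qed.

Lemma upper3_lt_upper2 nu : 0 < nu ->
  8 * nu * (nu + 1) ^ 2 * poch (nu + 3) 3 * (5 * nu ^ 2 + 15 * nu + 12) / num3 nu
  < 16 * (poch nu 4 * poch (nu + 1) 2) / (5 * nu ^ 2 + 15 * nu + 12).
Proof.
  intros H; apply Rdiv_lt_cross; [now apply num3_pos | now apply quad_pos|].
  replace (16 * (poch nu 4 * poch (nu + 1) 2) * num3 nu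
    - 8 * nu * (nu + 1) ^ 2 * poch (nu + 3) 3 * (5 * nu ^ 2 + 15 * nu + 12) * (5 * nu ^ 2 + 15 * nu + 12))
    with (8 * nu * (nu + 1) ^ 2 * (nu + 3) * (2 * (nu + 2) ^ 2 * num3 nu
      - (nu + 4) * (nu + 5) * (5 * nu ^ 2 + 15 * nu + 12) ^ 2)) by (simpl; ring).
  apply Rmult_lt_0_compat.
  - pos.
  - unfold num3; poly_pos.
Qed.

Lemma upper2_lt_upper1 nu : 0 < nu ->
  16 * (poch nu 4 * poch (nu + 1) 2) / (5 * nu ^ 2 + 15 * nu + 12)
  < 8 * nu * (nu + 1) ^ 2 * (nu + 2).
Proof.
  intros H; rewrite <- (Rdiv_1_r (8 * nu * (nu + 1) ^ 2 * (nu + 2))).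
  apply Rdiv_lt_cross; [now apply quad_pos | lra|].
  replace (8 * nu * (nu + 1) ^ 2 * (nu + 2) * (5 * nu ^ 2 + 15 * nu + 12)
      - 16 * (poch nu 4 * poch (nu + 1) 2) * 1)
    with (8 * nu * (nu + 1) ^ 2 * (nu + 2) * (nu * (3 * nu + 5))) by (simpl; ring).
  pos.
Qed.

Lemma lower1_lt_lower2 nu : 0 < nu ->
  (16 * (nu * (nu + 1) ^ 2)) ^ 2
  < 2 ^ 8 * (poch nu 3 * poch nu 4 * (nu + 1) ^ 2) / (5 * nu ^ 2 + 15 * nu + 12).
Proof.
  intros H; rewrite <- (Rdiv_1_r ((16 * (nu * (nu + 1) ^ 2)) ^ 2)).
  apply Rdiv_lt_cross; [lra | now apply quad_pos|].
  replace (2 ^ 8 * (poch nu 3 * poch nu 4 * (nu + 1) ^ 2) * 1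
      - (16 * (nu * (nu + 1) ^ 2)) ^ 2 * (5 * nu ^ 2 + 15 * nu + 12))
    with (2 ^ 8 * nu ^ 2 * (nu + 1) ^ 4 * ((nu + 2) ^ 2 * (nu + 3) - (5 * nu ^ 2 + 15 * nu + 12)))
    by (simpl; ring).
  apply Rmult_lt_0_compat.
  - pos.
  - replace ((nu + 2) ^ 2 * (nu + 3) - (5 * nu ^ 2 + 15 * nu + 12)) with (nu ^ 3 + 2 * nu ^ 2 + nu) by ring.
    poly_pos.
Qed.

Lemma lower2_lt_lower3 nu : 0 < nu ->
  (2 ^ 8 * (poch nu 3 * poch nu 4 * (nu + 1) ^ 2) / (5 * nu ^ 2 + 15 * nu + 12)) ^ 3
  < (2 ^ 11 * nu * poch nu 4 * poch nu 6 * (nu + 1) ^ 4 / num3 nu) ^ 2.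
Proof.
  intros H; pose proof (num3_pos nu H); pose proof (quad_pos nu H).
  unfold Rdiv; rewrite !(Rpow_mult_distr _ (/ _)), !pow_inv.
  apply Rdiv_lt_cross; [now apply pow_lt | now apply pow_lt|].
  replace ((2 ^ 11 * nu * poch nu 4 * poch nu 6 * (nu + 1) ^ 4) ^ 2 * (5 * nu ^ 2 + 15 * nu + 12) ^ 3
      - (2 ^ 8 * (poch nu 3 * poch nu 4 * (nu + 1) ^ 2)) ^ 3 * num3 nu ^ 2)
    with (2 ^ 22 * nu ^ 6 * (nu + 1) ^ 12 * (nu + 2) ^ 4 * (nu + 3) ^ 3
      * ((nu + 3) * (nu + 4) ^ 2 * (nu + 5) ^ 2 * (5 * nu ^ 2 + 15 * nu + 12) ^ 3
         - 4 * (nu + 2) ^ 2 * num3 nu ^ 2)) by (simpl; ring).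
  apply Rmult_lt_0_compat.
  - pos.
  - unfold num3; poly_pos.
Qed.

Lemma root_lt (k : R) (m : nat) (y t : R) : (0 < m)%nat -> 0 <= k -> 0 < y -> 0 < t ->
  k ^ m * y < t ^ m -> k * nroot m y < t.
Proof.
  intros Hm Hk Hy Ht H; destruct (pow_root m y Hm Hy) as [R1 R2].
  apply (pow_lt_inv m); [lra|]. rewrite Rpow_mult_distr, R2; assumption.
Qed.

Lemma lt_root (k : R) (m : nat) (y t : R) : (0 < m)%nat -> 0 <= k -> 0 < y ->
  t ^ m < k ^ m * y -> t < k * nroot m y.
Proof.
  intros Hm Hk Hy H; destruct (pow_root m y Hm Hy) as [R1 R2].
  apply (pow_lt_inv m); [apply Rmult_le_pos; lra|]. rewrite Rpow_mult_distr, R2; assumption.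
Qed.

Theorem theorem9 :
  forall nu : R, 0 < nu ->
  let nu7 := 21 * nu ^ 4 + 173 * nu ^ 3 + 533 * nu ^ 2 + 717 * nu + 360 in
  let nu8 := 429 * nu ^ 8 + 8688 * nu ^ 7 + 76280 * nu ^ 6 + 377494 * nu ^ 5
             + 1148139 * nu ^ 4 + 2194202 * nu ^ 3 + 2574064 * nu ^ 2
             + 1698048 * nu + 483840 in
  exists t : R,
    starlikeness_radius_u nu = Finite t /\
    t < nroot 4 (8 * nu * (nu + 1) ^ 2 * (nu + 2)) /\
    (2 * nroot 4 (nu * (nu + 1) ^ 2) < t /\
     t < 2 * nroot 4 (poch nu 4 * poch (nu + 1) 2
                      / (5 * nu ^ 2 + 15 * nu + 12))) /\
    (2 * nroot 8 (poch nu 3 * poch nu 4 * (nu + 1) ^ 2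
                  / (5 * nu ^ 2 + 15 * nu + 12)) < t /\
     t < nroot 4 (8 * nu * (nu + 1) ^ 2 * poch (nu + 3) 3
                  * (5 * nu ^ 2 + 15 * nu + 12) / nu7)) /\
    (nroot 12 (2 ^ 11 * nu * poch nu 4 * poch nu 6 * (nu + 1) ^ 4 / nu7) < t /\
     t < 2 * nroot 4 (2 * nu * (nu + 1) ^ 2 * (nu + 2) ^ 2 * (nu + 4)
                      * (nu + 6) * (nu + 7) * nu7 / nu8)).
Proof.
  intros nu Hnu n7 n8; assert (Hn : 0 <= nu) by lra.
  change n7 with (num3 nu) in *; change n8 with (num4 nu) in *; clear n7 n8.
  pose proof (num3_pos nu Hnu) as H7; pose proof (num4_pos nu Hnu) as H8.
  pose proof (quad_pos nu Hnu) as H5.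
  destruct (odd_root_exists nu (nu / 2) Hn ltac:(lra)) as [x [rho [Hx [Hr [Hrx Hpsi]]]]].
  destruct (pow_root 4 x ltac:(lia) Hx) as [Ht Htx].
  set (t := nroot 4 x) in *.
  exists t; split.
  { pose proof Hr as [Hr0 _].
    apply (starlikeness_radius_eq nu rho); auto; [|now rewrite Htx].
    apply (pow_lt_inv 2); [lra|]; rewrite pow1.
    replace ((rho * t ^ 2) ^ 2) with (rho ^ 2 * t ^ 4) by ring. rewrite Htx; assumption. }
  assert (HU : t ^ 4 < upper4 nu).
  { rewrite Htx; apply (odd_root_lt nu rho x (upper4 nu) (nu / 2)); auto.
    - unfold upper4; pos.
    - now apply odd_psum_exceeds_upper4. }
  assert (HL : lower3 nu < t ^ 12).
  { destruct (odd_psum_bounded_lower3 nu Hnu) as [B [HB1 HB2]].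
    pose proof (odd_root_gt nu rho x _ _ B Hn Hr Hx Hrx Hpsi HB2 HB1) as HT.
    destruct (pow_root 3 (lower3 nu) ltac:(lia) (lower3_pos nu Hnu)) as [T0 T3].
    rewrite <- T3; replace (t ^ 12) with (x ^ 3) by (rewrite <- Htx; ring).
    apply Rnot_le_lt; intros Hc; apply (Rlt_not_le _ _ HT).
    apply (pow_le_inv 3); [lia | lra | assumption]. }
  assert (HL' : 2 ^ 11 * nu * poch nu 4 * poch nu 6 * (nu + 1) ^ 4 / num3 nu < t ^ 12).
  { replace (2 ^ 11 * nu * poch nu 4 * poch nu 6 * (nu + 1) ^ 4) with
      (2 ^ 11 * nu ^ 3 * (nu + 1) ^ 6 * (nu + 2) ^ 2 * (nu + 3) ^ 2 * (nu + 4) * (nu + 5))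
      by (simpl; ring). exact HL. }
  pose proof (upper4_lt_upper3 nu Hnu); pose proof (upper3_lt_upper2 nu Hnu);
    pose proof (upper2_lt_upper1 nu Hnu).
  pose proof (lower1_lt_lower2 nu Hnu) as L12; pose proof (lower2_lt_lower3 nu Hnu) as L23.
  assert (Hpos2 : 0 < poch nu 3 * poch nu 4 * (nu + 1) ^ 2 / (5 * nu ^ 2 + 15 * nu + 12)).
  { pos. }
  assert (HL2 : 2 ^ 8 * (poch nu 3 * poch nu 4 * (nu + 1) ^ 2) / (5 * nu ^ 2 + 15 * nu + 12) < t ^ 8).
  { apply (pow_lt_inv 3); [apply pow_le; lra|].
    apply Rlt_trans with (1 := L23). replace ((t ^ 8) ^ 3) with ((t ^ 12) ^ 2) by ring.
    assert (0 < 2 ^ 11 * nu * poch nu 4 * poch nu 6 * (nu + 1) ^ 4 / num3 nu).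
    { pos. }
    assert (G : forall y z, 0 < y < z -> y ^ 2 < z ^ 2) by (intros; nra).
    apply G; lra. }
  assert (HL1 : 16 * (nu * (nu + 1) ^ 2) < t ^ 4).
  { apply (pow_lt_inv 2); [apply pow_le; lra|].
    replace ((t ^ 4) ^ 2) with (t ^ 8) by ring. lra. }
  repeat split.
  - rewrite <- (Rmult_1_l (nroot _ _)); apply lt_root; [lia | lra | |].
    + pos.
    + rewrite pow1; lra.
  - apply root_lt; [lia | lra | | assumption |].
    + pos.
    + lra.
  - apply lt_root; [lia | lra | |].
    + pos.
    + unfold Rdiv in *; lra.
  - apply root_lt; [lia | lra | assumption | assumption |].
    unfold Rdiv in *; lra.
  - rewrite <- (Rmult_1_l (nroot _ _)); apply lt_root; [lia | lra | |].
    + pos.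
    + rewrite pow1; lra.
  - rewrite <- (Rmult_1_l (nroot _ _)); apply root_lt; [lia | lra | | assumption |].
    + pos.
    + rewrite pow1; lra.
  - apply lt_root; [lia | lra | |].
    + pos.
    + unfold upper4 in HU; unfold Rdiv in *; lra.
Qed.
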